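(* Let $L>0$. There is a constant $C>0$ depending only on $L$ such that the following holds. For each $n\in\mathbb{N}$, let $A_n,B_n$ be fixed (deterministic) $n\times n$ Hermitian matrices with spectra contained in $[-L,L]$, and let $U_n$ be Haar-distributed in $\mathbb{U}(n)$ (all $U_n$ defined on a common probability space). Let $M_n=U_nA_nU_n^*+B_n$ and let $\mu_n=\mathbb{E}\mu_{M_n}$. Then with probability $1$, $$d_1(\mu_{M_n},\mu_n)\le Cn^{-2/3}$$ for all sufficiently large $n$.
   Context: $\mathbb{U}(n)$ is the unitary group. For an $n\times n$ normal matrix $X$ with eigenvalues $\lambda_1,\dots,\lambda_n$ (with multiplicity), $\mu_X=\frac1n\sum_{i=1}^n\delta_{\lambda_i}$. $\mathbb{E}\mu_{M_n}$ is the mean measure, $(\mathbb{E}\mu_{M_n})(S)=\mathbb{E}[\mu_{M_n}(S)]$. $d_1$ is the $L_1$ Wasserstein distance, $d_1(\mu,\rho)=\inf_\pi\int|x-y|\,d\pi(x,y)$, the infimum over couplings $\pi$ of $\mu$ and $\rho$. No assumption is made on the joint distribution of the $U_n$. *)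

(* Defs.v *)
From HB Require Import structures.
From mathcomp Require Import all_boot all_order all_algebra.
From mathcomp Require Import complex.
From mathcomp Require Import all_classical all_reals all_analysis.
Export numFieldNormedType.Exports.

Set Implicit Arguments.
Unset Strict Implicit.
Unset Printing Implicit Defensive.

Import Order.TTheory GRing.Theory Num.Theory.
Local Open Scope classical_set_scope.
Local Open Scope ring_scope.
Local Open Scope complex_scope.
Local Open Scope sesquilinear_scope.

(* The alias R[i]^o is the one that carries the norm topology of R[i]. *)
Definition borelmx (R : realType) (n : nat) : measurableType _ :=
  g_sigma_algebraType (@open 'M[R[i]^o]_n).

Definition spectrum_within (R : realType) (n : nat) (L : R) (A : 'M[R[i]]_n) :=
  forall a : R[i], eigenvalue A a -> - L%:C <= a <= L%:C.

(* Haar measure on U(n) is the unique Borel probability measure on U(n) that is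
   invariant under left translations. *)
Definition haar_distributed d (T : measurableType d) (R : realType)
    (P : probability T R) (n : nat) (U : {RV P >-> borelmx R n}) :=
  (forall t, (U t : 'M[R[i]]_n) \is unitarymx) /\
  forall (V : 'M[R[i]]_n) (S : set (borelmx R n)),
    V \is unitarymx -> measurable S ->
    distribution P U [set V *m (X : 'M[R[i]]_n) | X in S] = distribution P U S.

(* Only used for Hermitian X, whose eigenvalues are real: taking real parts
   just turns them into elements of R. *)
Definition spectral_measure (R : realType) (n : nat) (X : 'M[R[i]]_n)
    (S : set R) : \bar R :=
  ((n%:R^-1)%:E * \sum_(i < n) \d_(complex.Re (spectral_diag X 0%R i)) S)%E.

Definition mean_spectral_measure d (T : measurableType d) (R : realType)
    (P : probability T R) (n : nat) (M : T -> 'M[R[i]]_n)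
    (S : set R) : \bar R :=
  (\int[P]_t spectral_measure (M t) S)%E.

(* The distance is taken between set functions so that the mean measure needs
   no proof of sigma-additivity; without a coupling the infimum is +oo. *)
Definition is_coupling (R : realType) (mu rho : set R -> \bar R)
    (pi : probability (R * R)%type R) :=
  forall S : set R, measurable S ->
    pushforward pi fst S = mu S /\ pushforward pi snd S = rho S.

Definition wasserstein1 (R : realType) (mu rho : set R -> \bar R) : \bar R :=
  ereal_inf [set (\int[pi]_z `|z.1 - z.2|%:E)%E
            | pi in [set pi | is_coupling mu rho pi]].

Definition randomized_sum (R : realType) (n : nat) (A B U : 'M[R[i]]_n) :=
  U *m A *m U^t* + B.

(* Main.v *)
From HB Require Import structures.
Require Import Defs.
From mathcomp Require Import all_boot all_order all_algebra.
From mathcomp Require Import complex ring lra.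
From mathcomp Require Import all_classical all_reals all_analysis.
From mathcomp Require Import measurable_realfun.
(** Write W = U A U^t*, so that M = W + B. The proof bounds the fluctuations of linear
    statistics (1/n) sum_i f(lambda_i) for 1-Lipschitz f at the scale L / n, takes a union
    bound over finitely many f that determine the distribution of the eigenvalues up to
    resolution n ^ (-2/3), and concludes by the Borel-Cantelli lemma.

    Concentration. The unitary group acts by conjugation on the orbit of A; an
    antihermitian X gives a derivation (der) of polynomial functions, and the
    Casimir element gives minus a Laplacian (casimir) with squared gradient carre.
    The Casimir element is central, which yields a Bochner formula (bochner), and the
    commutators of second derivatives yield a curvature bound of order n (hessian_ge).
    An approximate maximum principle applied to carre h h then bounds the
    gradient of the solution h of (casimir + s) h = f by that of f, with a gain of a
    factor 2 / n (gradient_bound). Integrating by parts against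
    f = casimir h + s h and letting s tend to 0 gives
    E f ^ (2k) <= (4 k v / n) ^ k when E f = 0 and carre f f <= v (moment_bound). The curvature,
    the maximum principle and linear algebra on spaces of polynomials of bounded
    degree thus replace the logarithmic Sobolev inequality on the unitary group, and the only fact
    about the Haar measure that is used is that derivatives have mean 0 (haar_state).

    For f = (1/n) tr P(W + B) - const the gradient is the commutator of W with P'(M) / n, so
    v = 4 L ^ 2 / n as soon as |P'| <= 1 on [- 2 L, 2 L], which contains the spectrum of M
    (linstat_moment). General 1-Lipschitz functions are approximated by such
    polynomials through Bernstein's construction (lipschitz_polynomial).

    Transport. On the line the quantile coupling bounds the distance of two laws on [- 2 L, 2 L]
    by the integral of |F - G|. On a grid of m cells of width w = 4 L / m this is, up to
    a multiple of w, a sum over cells of differences of integrals of ramp functions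
    (wasserstein_grid, grid_compare), that is the maximum over 2 ^ m choices of
    signs of the deviation of one 1-Lipschitz linear statistic (empirical_wasserstein).
    Moments of order 2m defeat the 2 ^ m terms of the union bound and give a
    deviation of order L m ^ (1/2) / n outside an event of probability 8 ^ (- m). With m close to
    n ^ (2/3) both errors are of order L n ^ (-2/3), and 8 ^ (- m) <= n ^ (-2) is summable
    (exceptional_set).

    Eigenvalues are not handled as measurable functions directly: only symmetric
    polynomial statistics are seen to be measurable, as traces, and measurability of
    the random measure follows by approximation (empirical_measurable). *)

Set Implicit Arguments.
Unset Strict Implicit.
Unset Printing Implicit Defensive.
Import Order.TTheory GRing.Theory Num.Theory.
Local Open Scope ring_scope.
Local Open Scope sesquilinear_scope.

(** * Polynomial approximation with a derivative bound *)

Section Bernstein.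
Variable R : realType.
Implicit Types (g : nat -> R) (x : R).

(** de Casteljau recursion for the Bernstein polynomial of degree N with control
    values g 0, ..., g N; it makes every identity below an induction that never
    meets a binomial coefficient. *)
Fixpoint bernstein N g : {poly R} :=
  if N is N'.+1 then (1 - 'X) * bernstein N' g + 'X * bernstein N' (fun k => g k.+1)
  else (g 0%N)%:P.

Lemma bernsteinS_horner N g x :
  (bernstein N.+1 g).[x] = (1 - x) * (bernstein N g).[x] + x * (bernstein N (fun k => g k.+1)).[x].
Proof. by rewrite /= !hornerE. Qed.

Lemma bernsteinB N g1 g2 : bernstein N (fun k => g1 k - g2 k) = bernstein N g1 - bernstein N g2.
Proof.
elim: N g1 g2 => [|N IH] g1 g2 /=; first by rewrite polyCB.
by rewrite !IH; ring.
Qed.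

Lemma bernstein_le N g1 g2 x : 0 <= x <= 1 -> (forall k, g1 k <= g2 k) ->
  (bernstein N g1).[x] <= (bernstein N g2).[x].
Proof.
move=> /andP[x0 x1]; elim: N g1 g2 => [|N IH] g1 g2 h; first by rewrite /= !hornerC.
by rewrite !bernsteinS_horner lerD // ler_wpM2l ?subr_ge0 // IH.
Qed.

Lemma bernstein_cst N c : bernstein N (fun=> c) = c%:P.
Proof. by elim: N => [//|N /= ->]; ring. Qed.

Lemma deriv_1subX : (1 - 'X : {poly R})^`() = -1.
Proof. by rewrite derivB derivX -polyC1 derivC sub0r. Qed.

(** A derivative of a Bernstein polynomial is a Bernstein polynomial of the finite
    differences; so a Lipschitz bound on f is inherited, with the same constant,
    by its approximations. This is why Bernstein polynomials are used here. *)
Lemma deriv_bernstein N g : (bernstein N.+1 g)^`() = N.+1%:R *: bernstein N (fun k => g k.+1 - g k).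
Proof.
elim: N g => [|N IH] g.
  rewrite /= derivD !derivM deriv_1subX derivX !derivC scale1r polyCB.
  by ring.
transitivity ((-1) * bernstein N.+1 g + (1 - 'X) * (bernstein N.+1 g)^`()
   + (bernstein N.+1 (fun k => g k.+1) + 'X * (bernstein N.+1 (fun k => g k.+1))^`())).
  by rewrite [LHS]derivD !derivM deriv_1subX derivX mul1r.
rewrite !IH -[N.+2%:R]natr1 scalerDl scale1r.
have e : bernstein N.+1 (fun k => g k.+1 - g k) = (1 - 'X) * bernstein N (fun k => g k.+1 - g k)
  + 'X * bernstein N (fun k => g k.+2 - g k.+1) by [].
rewrite {1}e (bernsteinB N.+1) -!mul_polyC /=.
by ring.
Qed.

(** The second moment about a of a binomial variable: squared bias plus variance. *)
Lemma bernstein_second_moment N a x :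
  (bernstein N (fun k => (k%:R - a) ^+ 2)).[x] = (N%:R * x - a) ^+ 2 + N%:R * x * (1 - x).
Proof.
elim: N a => [|N IH] a; first by rewrite /= hornerC; ring.
rewrite bernsteinS_horner IH.
have -> : (fun k => (k.+1%:R - a) ^+ 2) = (fun k : nat => (k%:R - (a - 1)) ^+ 2).
  by apply/funext => k; rewrite -natr1; ring.
by rewrite IH -natr1; ring.
Qed.

Lemma bernsteinD N g1 g2 : bernstein N (fun k => g1 k + g2 k) = bernstein N g1 + bernstein N g2.
Proof.
elim: N g1 g2 => [|N IH] g1 g2 /=; first by rewrite polyCD.
by rewrite !IH; ring.
Qed.

Lemma bernsteinZ N c g : bernstein N (fun k => c * g k) = c%:P * bernstein N g.
Proof.
elim: N g => [|N IH] g /=; first by rewrite polyCM.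
by rewrite !IH; ring.
Qed.

(** The error is at most c times the mean distance of k / N to x, which is at most
    N ^ (-1/2); the degree N is a square so that this root is a natural number. *)
Lemma bernstein_approx (f : R -> R) (c : R) (M : nat) x : (0 < M)%N -> 0 <= c ->
  (forall x y, `|f x - f y| <= c * `|x - y|) -> 0 <= x <= 1 ->
  `|(bernstein (M * M) (fun k => f (k%:R / (M * M)%:R))).[x] - f x| <= c / M%:R.
Proof.
move=> M0 c0 fL x01; set N := (M * M)%N.
have M0R : (0 : R) < M%:R by rewrite ltr0n.
have N0R : (0 : R) < N%:R by rewrite ltr0n muln_gt0 M0.
rewrite -[f x in X in `|X|](hornerC (f x) x) -(bernstein_cst N) -hornerN -hornerD -bernsteinB.
(* 2 |u| <= 1 / M + M u ^ 2 replaces the Cauchy-Schwarz inequality, so that the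
   second moment can be used directly. *)
pose b k : R := c / 2 * (M%:R^-1 + M%:R * (k%:R / N%:R - x) ^+ 2).
have bound (k : nat) : `|f (k%:R / N%:R) - f x| <= b k.
  apply: le_trans (fL _ _) _; rewrite /b -mulrA ler_wpM2l //.
  set u := _ - x; rewrite -(ler_pM2l M0R).
  have -> : M%:R * (2^-1 * (M%:R^-1 + M%:R * u ^+ 2)) = (1 + (M%:R * `|u|) ^+ 2) / 2.
    by rewrite exprMn real_normK ?num_real //; field; exact: lt0r_neq0.
  by have := sqr_ge0 (M%:R * `|u| - 1); rewrite sqrrB mulr1 expr1n; lra.
have bE : (bernstein N b).[x] = c / 2 * (M%:R^-1 + M%:R^-1 * (x * (1 - x))).
  have -> : b = fun k : nat => c / 2 * (M%:R^-1 + (M%:R / N%:R ^+ 2) * (k%:R - N%:R * x) ^+ 2).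
    apply/funext => k; rewrite /b; congr (_ * (_ + _)).
    have -> : k%:R / N%:R - x = (k%:R - N%:R * x) / N%:R by field; exact: lt0r_neq0.
    by rewrite expr_div_n; ring.
  rewrite bernsteinZ bernsteinD bernstein_cst bernsteinZ !hornerE.
  rewrite bernstein_second_moment subrr expr0n /= add0r.
  rewrite /N natrM; field; exact: lt0r_neq0.
have le1 : (bernstein N b).[x] <= c / M%:R.
  rewrite bE mulrDr; case/andP: x01 => x0 x1.
  have h : x * (1 - x) <= 1 by nra.
  have : c / 2 * (M%:R^-1 * (x * (1 - x))) <= c / 2 * (M%:R^-1 * 1).
    by rewrite !ler_wpM2l ?invr_ge0 ?divr_ge0 // ltW.
  by rewrite mulr1; lra.
rewrite ler_norml; apply/andP; split; last first.
  apply: le_trans le1; apply: bernstein_le => // k.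
  exact: le_trans (ler_norm _) (bound k).
rewrite lerNl; apply: le_trans le1; rewrite -hornerN.
rewrite (_ : - bernstein _ _ = bernstein N (fun k => - 1 * (f (k%:R / N%:R) - f x))); last first.
  by rewrite bernsteinZ polyCN polyC1 mulN1r.
apply: bernstein_le => // k; rewrite mulN1r.
by apply: le_trans (bound k); rewrite -normrN ler_norm.
Qed.

(** Bernstein approximation on [0, 1], transported to [- r, r] by an affine map. *)
Theorem lipschitz_polynomial (r e : R) (f : R -> R) : 0 < r -> 0 < e ->
  (forall x y, `|f x - f y| <= `|x - y|) ->
  exists p : {poly R}, (forall x, `|x| <= r -> `|p.[x] - f x| <= e) /\
    (forall x, `|x| <= r -> `|p^`().[x]| <= 1).
Proof.
move=> r0 e0 fL; pose M := (Num.truncn (2 * r / e)).+1.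
have M0R : (0 : R) < M%:R by rewrite ltr0n.
have Me : 2 * r / M%:R <= e.
  by rewrite ler_pdivrMr // [e * _]mulrC -ler_pdivrMr // ltW // truncnS_gt.
pose g y := f (2 * r * y - r).
have gL x y : `|g x - g y| <= 2 * r * `|x - y|.
  apply: le_trans (fL _ _) _.
  by rewrite opprD opprK addrACA addNr addr0 -mulrBr normrM gtr0_norm // mulr_gt0.
have [N NE] : exists N, (M * M)%N = N.+1 by exists (M * M).-1; rewrite prednK // muln_gt0.
pose q : {poly R} := (2 * r)^-1 *: ('X + r%:P).
have qE x : q.[x] = (x + r) / (2 * r) by rewrite /q !hornerE mulrC.
have q01 x : `|x| <= r -> 0 <= q.[x] <= 1.
  have r2 : 0 < 2 * r by rewrite mulr_gt0.
  rewrite ler_norml qE => /andP[h1 h2]; apply/andP; split.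
    by apply: divr_ge0; [lra|exact: ltW].
  by rewrite ler_pdivrMr //; lra.
pose gk k := g (k%:R / (M * M)%:R).
exists (bernstein (M * M) gk \Po q); split => x xr.
  rewrite horner_comp.
  have c0 : 0 <= 2 * r by rewrite mulr_ge0 // ltW.
  have := @bernstein_approx g (2 * r) M q.[x] isT c0 gL (q01 x xr).
  have -> : g q.[x] = f x.
    by rewrite /g qE; congr f; field; exact: lt0r_neq0.
  by move=> /le_trans; apply.
have dq : q^`() = ((2 * r)^-1)%:P.
  by rewrite /q derivZ derivD derivX derivC addr0 -mul_polyC mulr1.
rewrite deriv_comp hornerM horner_comp dq hornerC NE deriv_bernstein hornerZ.
have bd k : `|gk k.+1 - gk k| <= 2 * r / N.+1%:R.
  apply: le_trans (gL _ _) _; rewrite -mulrBl.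
  have -> : k.+1%:R - k%:R = 1 :> R by rewrite -natr1; ring.
  by rewrite NE mul1r gtr0_norm ?invr_gt0 ?ltr0n.
have hb : `|(bernstein N (fun k => gk k.+1 - gk k)).[q.[x]]| <= 2 * r / N.+1%:R.
  rewrite ler_norml; apply/andP; split.
    rewrite -[leLHS](hornerC _ q.[x]) -(bernstein_cst N); apply: bernstein_le (q01 x xr) _ => k.
    by have := bd k; rewrite ler_norml => /andP[].
  rewrite -[leRHS](hornerC _ q.[x]) -(bernstein_cst N); apply: bernstein_le (q01 x xr) _ => k.
  by have := bd k; rewrite ler_norml => /andP[].
have r2 : 0 < 2 * r by rewrite mulr_gt0.
rewrite !normrM gtr0_norm ?ltr0n // [`|(2 * r)^-1|]gtr0_norm ?invr_gt0 //.
rewrite ler_pdivrMr // mul1r mulrC -ler_pdivlMr ?ltr0n //.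
Qed.

End Bernstein.

(** * Polynomial functions of a matrix and their formal derivatives *)

Section PolynomialFunctions.
Variables (C : numClosedFieldType) (n : nat).
Implicit Types (X Y W : 'M[C]_n) (c : C).

(** Expressions for the polynomial functions of the entries of a matrix W; Lin Y
    stands for W |-> tr (Y W). Keeping them syntactic lets the derivations below
    be defined by recursion and makes arguments by degree plain inductions. *)
Inductive polyfun :=
  | Cst of C | Lin of 'M[C]_n | Add of polyfun & polyfun | Mul of polyfun & polyfun.

Fixpoint ev p W : C :=
  match p with
  | Cst c => c
  | Lin Y => \tr (Y *m W)
  | Add p q => ev p W + ev q W
  | Mul p q => ev p W * ev q W
  end.

(** The derivation of direction X: for antihermitian X it is the derivative of
    t |-> p (e ^ (t X) W e ^ (- t X)) at t = 0, the vector field W |-> X W - W X. The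
    formula makes sense, and is linear in X, for every complex matrix. *)
Fixpoint der X p : polyfun :=
  match p with
  | Cst _ => Cst 0
  | Lin Y => Lin (Y *m X - X *m Y)
  | Add p q => Add (der X p) (der X q)
  | Mul p q => Add (Mul (der X p) q) (Mul p (der X q))
  end.

(** Represents the complex conjugate of p on Hermitian matrices. *)
Fixpoint bar p : polyfun :=
  match p with
  | Cst c => Cst (c^*)
  | Lin Y => Lin (Y^t*)
  | Add p q => Add (bar p) (bar q)
  | Mul p q => Mul (bar p) (bar q)
  end.

Definition Sum (I : Type) (r : seq I) (F : I -> polyfun) :=
  \big[Add/Cst 0]_(i <- r) F i.

Lemma ev_Sum (I : Type) (r : seq I) (F : I -> polyfun) W :
  ev (Sum r F) W = \sum_(i <- r) ev (F i) W.
Proof. exact: (big_morph (ev^~ W)). Qed.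

Lemma der_Sum (I : Type) (r : seq I) (F : I -> polyfun) X :
  der X (Sum r F) = Sum r (fun i => der X (F i)).
Proof. exact: (big_morph (der X)). Qed.

Definition Scale c p := Mul (Cst c) p.

Lemma ev_der_Scale c p X W : ev (der X (Scale c p)) W = c * ev (der X p) W.
Proof. by rewrite /= mul0r add0r. Qed.

Lemma ev_derD p X Y W : ev (der (X + Y) p) W = ev (der X p) W + ev (der Y p) W.
Proof.
elim: p => [c|Z|p IHp q IHq|p IHp q IHq] /=; first by rewrite addr0.
- rewrite -mxtraceD -mulmxDl; congr (\tr (_ *m _)).
  by rewrite mulmxDr mulmxDl opprD addrACA.
- by rewrite IHp IHq addrACA.
- by rewrite IHp IHq; ring.
Qed.

Lemma ev_derZ p c X W : ev (der (c *: X) p) W = c * ev (der X p) W.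
Proof.
elim: p => [a|Z|p IHp q IHq|p IHp q IHq] /=; first by rewrite mulr0.
- by rewrite -scalemxAl -scalemxAr -scalerBr -scalemxAl mxtraceZ.
- by rewrite IHp IHq mulrDr.
- by rewrite IHp IHq; ring.
Qed.

Lemma ev_der0 p W : ev (der 0 p) W = 0.
Proof. by have := ev_derZ p 0 0 W; rewrite scale0r mul0r. Qed.

Lemma ev_derN p X W : ev (der (- X) p) W = - ev (der X p) W.
Proof. by rewrite -scaleN1r ev_derZ mulN1r. Qed.

Lemma ev_der_sum (I : Type) (r : seq I) (F : I -> 'M[C]_n) p W :
  ev (der (\sum_(i <- r) F i) p) W = \sum_(i <- r) ev (der (F i) p) W.
Proof.
apply: (big_morph (fun X => ev (der X p) W)) => [X Y|]; first exact: ev_derD.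
exact: ev_der0.
Qed.

(** X |-> der X is an antihomomorphism of Lie algebras. *)
Lemma ev_der_comm p X Y W :
  ev (der X (der Y p)) W - ev (der Y (der X p)) W
  = ev (der (Y *m X - X *m Y) p) W.
Proof.
elim: p => [a|Z|p IHp q IHq|p IHp q IHq] /=; first by rewrite subr0.
- rewrite -raddfB -mulmxBl /=; congr (\tr (_ *m _)).
  rewrite !mulmxBr !mulmxBl !mulmxA; apply/matrixP => i j; rewrite !mxE.
  by ring.
- by rewrite -IHp -IHq; ring.
- by rewrite -IHp -IHq; ring.
Qed.

(** Scalar matrices act trivially by conjugation. In the curvature bound this
    removes the trace part of the gradient, where the commutators would vanish. *)
Lemma ev_der1 p W : ev (der 1%:M p) W = 0.
Proof.
elim: p => [a|Z|p IHp q IHq|p IHp q IHq] //=.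
- by rewrite mulmx1 mul1mx subrr mul0mx mxtrace0.
- by rewrite IHp IHq addr0.
- by rewrite IHp IHq mul0r mulr0 addr0.
Qed.

Lemma trmxC_mul m (k l : nat) (X : 'M[C]_(m, k)) (Y : 'M[C]_(k, l)) : (X *m Y)^t* = Y^t* *m X^t*.
Proof. by rewrite trmx_mul map_mxM. Qed.

Lemma trmxCB m k (X Y : 'M[C]_(m, k)) : (X - Y)^t* = X^t* - Y^t*.
Proof. by rewrite linearB /= map_mxB. Qed.

Lemma conj_mxtrace X : (\tr X)^* = \tr (X^t*).
Proof. by rewrite trace_map_mx mxtrace_tr. Qed.

Lemma ev_bar p W : W^t* = W -> ev (bar p) W = (ev p W)^*.
Proof.
move=> hW; elim: p => [a|Z|p IHp q IHq|p IHp q IHq] //=.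
- by rewrite conj_mxtrace trmxC_mul hW mxtrace_mulC.
- by rewrite IHp IHq rmorphD.
- by rewrite IHp IHq rmorphM.
Qed.

Lemma ev_der_bar p X W : W^t* = W ->
  ev (der X (bar p)) W = - (ev (der (X^t*) p) W)^*.
Proof.
move=> hW; elim: p => [a|Z|p IHp q IHq|p IHp q IHq] /=.
- by rewrite rmorph0 oppr0.
- have -> : (Z^t* *m X - X *m Z^t*) = - (Z *m X^t* - X^t* *m Z)^t*.
    by rewrite trmxCB !trmxC_mul trmxCK opprB.
  by rewrite mulNmx raddfN conj_mxtrace trmxC_mul hW [\tr (W *m _)]mxtrace_mulC.
- by rewrite IHp IHq rmorphD opprD.
- by rewrite IHp IHq !ev_bar // rmorphD !rmorphM /= opprD mulNr mulrN.
Qed.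

Lemma ev_der_der_bar p X Y W : W^t* = W ->
  ev (der X (der Y (bar p))) W = (ev (der (X^t*) (der (Y^t*) p)) W)^*.
Proof.
move=> hW; elim: p => [a|Z|p IHp q IHq|p IHp q IHq] /=.
- by rewrite rmorph0.
- rewrite conj_mxtrace trmxC_mul hW [RHS]mxtrace_mulC; congr (\tr (_ *m _)).
  rewrite !(trmxCB, trmxC_mul, trmxCK) !(mulmxBl, mulmxBr) !mulmxA.
  by apply/matrixP => i j; rewrite !mxE; ring.
- by rewrite IHp IHq rmorphD.
- by rewrite IHp IHq !ev_der_bar // !ev_bar // !(rmorphD, rmorphM) /=; ring.
Qed.

Local Notation E i j := (delta_mx i j : 'M[C]_n).

(** Polynomial functions of bounded degree form a finite-dimensional space stable
    under all derivations; hence operators built from derivations act on it as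
    matrices, and equations for them can be solved by linear algebra. *)
Lemma closed_family p : exists (I : finType) (e : I -> polyfun)
   (D : 'M[C]_n -> I -> I -> C) (c : I -> C),
   (forall W, ev p W = \sum_k c k * ev (e k) W) /\
   (forall X k W, ev (der X (e k)) W = \sum_l D X k l * ev (e l) W).
Proof.
elim: p => [a|Z|p IHp q IHq|p IHp q IHq].
- exists unit, (fun=> Cst 1), (fun _ _ _ => 0), (fun=> a); split => [W|X k W].
    by rewrite big_const card_unit /= addr0 mulr1.
  by rewrite big1 // => l; rewrite mul0r.
- have linE (Y W : 'M[C]_n) :
    \tr (Y *m W) = \sum_(ij : 'I_n * 'I_n) Y ij.1 ij.2 * \tr (E ij.1 ij.2 *m W).
    rewrite [in LHS](matrix_sum_delta Y) -(pair_bigA _ (fun i j => Y i j * \tr (E i j *m W))) /=.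
    rewrite mulmx_suml raddf_sum; apply: eq_bigr => i _ /=.
    rewrite mulmx_suml raddf_sum; apply: eq_bigr => j _ /=.
    by rewrite -scalemxAl mxtraceZ.
  exists ('I_n * 'I_n)%type, (fun ij => Lin (E ij.1 ij.2)),
   (fun X ij kl => (E ij.1 ij.2 *m X - X *m E ij.1 ij.2) kl.1 kl.2), (fun ij => Z ij.1 ij.2).
  by split => [W|X k W] /=; rewrite linE.
- have [I1 [e1 [D1 [c1 [p1 d1]]]]] := IHp.
  have [I2 [e2 [D2 [c2 [p2 d2]]]]] := IHq.
  exists (I1 + I2)%type,
   (fun k => match k with inl i => e1 i | inr i => e2 i end),
   (fun X k l => match k, l with inl i, inl j => D1 X i j
      | inr i, inr j => D2 X i j | _, _ => 0 end),
   (fun k => match k with inl i => c1 i | inr i => c2 i end).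
  split => [W|X [k|k] W] /=; rewrite big_sumType /= ?p1 ?p2 //.
    by rewrite d1 [X in _ = _ + X]big1 ?addr0 // => i _; rewrite mul0r.
  by rewrite d2 [X in _ = X + _]big1 ?add0r // => i _; rewrite mul0r.
- have [I1 [e1 [D1 [c1 [p1 d1]]]]] := IHp.
  have [I2 [e2 [D2 [c2 [p2 d2]]]]] := IHq.
  exists (I1 * I2)%type, (fun k => Mul (e1 k.1) (e2 k.2)),
   (fun X k l => D1 X k.1 l.1 * (l.2 == k.2)%:R + (l.1 == k.1)%:R * D2 X k.2 l.2),
   (fun k => c1 k.1 * c2 k.2).
  split => [W|X [k1 k2] W] /=.
    rewrite p1 p2 -(pair_bigA _ (fun i j => c1 i * c2 j * (ev (e1 i) W * ev (e2 j) W))) /=.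
    by rewrite mulr_suml; apply: eq_bigr => i _; rewrite mulr_sumr;
      apply: eq_bigr => j _; ring.
  rewrite d1 d2.
  rewrite -(pair_bigA _ (fun i j =>
    (D1 X k1 i * (j == k2)%:R + (i == k1)%:R * D2 X k2 j) * (ev (e1 i) W * ev (e2 j) W))) /=.
  under [RHS]eq_bigr do under eq_bigr do rewrite mulrDl.
  under [RHS]eq_bigr do rewrite big_split /=.
  rewrite big_split /=; congr (_ + _).
    rewrite mulr_suml; apply: eq_bigr => i _.
    rewrite (bigD1 k2) //= eqxx mulr1 big1 ?addr0 ?mulrA // => j /negPf ->.
    by rewrite mulr0 mul0r.
  rewrite (bigD1 k1) //= [X in _ = _ + X]big1 => [|i /negPf nik].
    by rewrite addr0 mulr_sumr; apply: eq_bigr => j _; rewrite eqxx mul1r; ring.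
  by rewrite big1 // => j _; rewrite nik !mul0r.
Qed.

Lemma trace_orbit_der X Y (g W : 'M[C]_n) : X^t* = - X ->
  \tr (Y *m (X *m g *m W *m g^t* + g *m W *m (X *m g)^t*))
  = \tr ((Y *m X - X *m Y) *m (g *m W *m g^t*)).
Proof.
move=> hX; rewrite trmxC_mul hX mulmxDr raddfD /= mulmxBl raddfB /=.
rewrite !mulmxN raddfN /= !mulmxA; congr (_ - _).
by rewrite mxtrace_mulC !mulmxA.
Qed.

End PolynomialFunctions.

(** * Unitary diagonalization *)

Section UnitaryConjugation.
Variables (C : numClosedFieldType) (n : nat).
Implicit Types (X Q V : 'M[C]_n) (d : 'rV[C]_n).

(** The matrix with eigenvalues d and unitary eigenvector matrix Q. *)
Definition udiag Q d := Q^t* *m diag_mx d *m Q.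

Lemma unitarymx_adjM Q : Q \is unitarymx -> Q^t* *m Q = 1%:M.
Proof. by move=> uQ; rewrite -invmx_unitary // mulVmx // unitarymx_unit. Qed.

Lemma diag_mxM d d' : diag_mx d *m diag_mx d' = diag_mx (\row_k (d 0 k * d' 0 k)).
Proof. by rewrite mulmx_diag; congr diag_mx; apply/rowP => k; rewrite !mxE. Qed.

Lemma udiagM Q d d' : Q \is unitarymx ->
  udiag Q d *m udiag Q d' = udiag Q (\row_k (d 0 k * d' 0 k)).
Proof.
move=> /unitarymxP hQ; rewrite /udiag -diag_mxM !mulmxA -[_ *m Q *m Q^t*]mulmxA hQ.
by rewrite mulmx1.
Qed.

Lemma udiag_adj Q d : (udiag Q d)^t* = udiag Q (\row_k (d 0 k)^*).
Proof.
rewrite /udiag !trmxC_mul trmxCK !mulmxA; congr (_ *m _ *m _).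
by rewrite tr_diag_mx map_diag_mx; congr diag_mx; apply/rowP => k; rewrite !mxE.
Qed.

Lemma udiagN Q d : udiag Q (- d) = - udiag Q d.
Proof. by rewrite /udiag raddfN mulmxN mulNmx. Qed.

Lemma udiag_const Q : Q \is unitarymx -> udiag Q (const_mx 1) = 1%:M.
Proof. by move=> hQ; rewrite /udiag diag_const_mx mulmx1 unitarymx_adjM. Qed.

Lemma udiag_unitary Q d : Q \is unitarymx -> (forall k, `|d 0 k| = 1) ->
  udiag Q d \is unitarymx.
Proof.
move=> hQ hd; apply/unitarymxP; rewrite udiag_adj udiagM // -(udiag_const hQ).
by congr udiag; apply/rowP => k; rewrite !mxE -normCK hd expr1n.
Qed.

Lemma normal_udiag X : X \is normalmx -> X = udiag (spectralmx X) (spectral_diag X).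
Proof. by move=> /orthomx_spectralP eX; rewrite {1}eX invmx_unitary ?spectral_unitarymx. Qed.

Lemma hermsymmxP X : reflect (X^t* = X) (X \is hermsymmx).
Proof. by rewrite qualifE /= expr0 scale1r eq_sym; apply: (iffP eqP). Qed.

Lemma antiherm_udiag X : X^t* = - X -> exists Q d,
  [/\ Q \is unitarymx, forall k, (d 0 k)^* = - d 0 k & X = udiag Q d].
Proof.
move=> hX; have nX : X \is normalmx by apply/normalmxP; rewrite hX mulmxN mulNmx.
exists (spectralmx X), (spectral_diag X).
split; [exact: spectral_unitarymx| |exact: normal_udiag].
move=> k; have := hX; rewrite {1 2}(normal_udiag nX) udiag_adj.
set Q := spectralmx X; have uQ : Q \is unitarymx by exact: spectral_unitarymx.
rewrite -mulNmx -mulmxN => /(congr1 (fun M => Q *m M *m Q^t*)).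
rewrite /udiag !mulmxA (unitarymxP uQ) !mul1mx -!mulmxA (unitarymxP uQ) !mulmx1.
by move=> /matrixP/(_ k k); rewrite !mxE eqxx !mulr1n.
Qed.

Lemma unitary_udiag V : V \is unitarymx -> exists Q d,
  [/\ Q \is unitarymx, forall k, `|d 0 k| = 1 & V = udiag Q d].
Proof.
move=> uV; have nV : V \is normalmx.
  by apply/normalmxP; rewrite (unitarymxP uV) unitarymx_adjM.
exists (spectralmx V), (spectral_diag V).
split; [exact: spectral_unitarymx| |exact: normal_udiag].
move=> k; have := unitarymxP uV; rewrite {1 2}(normal_udiag nV) udiag_adj.
set Q := spectralmx V; have uQ : Q \is unitarymx by exact: spectral_unitarymx.
rewrite udiagM // => /(congr1 (fun M => Q *m M *m Q^t*)).
rewrite /udiag mulmx1 !mulmxA (unitarymxP uQ) !mul1mx -!mulmxA (unitarymxP uQ) !mulmx1.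
move=> /matrixP/(_ k k); rewrite !mxE eqxx !mulr1n -normCK => /eqP.
by rewrite sqrp_eq1 ?normr_ge0 // => /eqP.
Qed.

End UnitaryConjugation.

(** * Differentiation along one-parameter unitary groups *)

Section ComplexParts.
Variable R : realType.
Implicit Types z w : R[i].
Local Notation Re := (@complex.Re R).
Local Notation Im := (@complex.Im R).

Lemma cReD z w : Re (z + w) = Re z + Re w. Proof. by case: z; case: w. Qed.
Lemma cImD z w : Im (z + w) = Im z + Im w. Proof. by case: z; case: w. Qed.
Lemma cReM z w : Re (z * w) = Re z * Re w - Im z * Im w.
Proof. by case: z; case: w. Qed.
Lemma cImM z w : Im (z * w) = Re z * Im w + Im z * Re w.
Proof. by case: z; case: w. Qed.
Lemma cReJ z : Re (z^*)%R = Re z. Proof. by case: z. Qed.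
Lemma cImJ z : Im (z^*)%R = - Im z. Proof. by case: z. Qed.

Lemma complex_eq z w : Re z = Re w -> Im z = Im w -> z = w.
Proof. by case: z w => [a b] [c d] /= -> ->. Qed.

(** A complex-valued function of a real variable is differentiated through its real
    and imaginary parts, so that the real mean value theorem remains usable. *)
Definition cderiv (u : R -> R[i]) (t : R) (du : R[i]) :=
  is_derive t (1 : R) (Re \o u) (Re du) /\ is_derive t (1 : R) (Im \o u) (Im du).

Lemma cderiv_ext u v t du : u =1 v -> cderiv u t du -> cderiv v t du.
Proof. by move=> /funext ->. Qed.

Lemma cderiv_cst (c : R[i]) t : cderiv (fun=> c) t 0.
Proof. by split; apply: is_derive_cst. Qed.

Lemma cderivD u v t du dv : cderiv u t du -> cderiv v t dv ->
  cderiv (fun s => u s + v s) t (du + dv).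
Proof.
move=> [ru iu] [rv iv]; split.
  rewrite (_ : _ \o _ = (Re \o u) + (Re \o v)); last by apply/funext => s /=; rewrite cReD.
  by rewrite cReD; apply: is_deriveD.
rewrite (_ : _ \o _ = (Im \o u) + (Im \o v)); last by apply/funext => s /=; rewrite cImD.
by rewrite cImD; apply: is_deriveD.
Qed.

Lemma cderivM u v t du dv : cderiv u t du -> cderiv v t dv ->
  cderiv (fun s => u s * v s) t (du * v t + u t * dv).
Proof.
move=> [ru iu] [rv iv]; split.
  rewrite (_ : _ \o _ = (Re \o u) * (Re \o v) - (Im \o u) * (Im \o v)); last first.
    by apply/funext => s /=; rewrite cReM.
  apply: is_derive_eq (is_deriveB (is_deriveM ru rv) (is_deriveM iu iv)) _.
  by rewrite /= cReD !cReM /GRing.scale /=; ring.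
rewrite (_ : _ \o _ = (Re \o u) * (Im \o v) + (Im \o u) * (Re \o v)); last first.
  by apply/funext => s /=; rewrite cImM.
apply: is_derive_eq (is_deriveD (is_deriveM ru iv) (is_deriveM iu rv)) _.
by rewrite /= cImD !cImM /GRing.scale /=; ring.
Qed.

Lemma cderivJ u t du : cderiv u t du -> cderiv (fun s => (u s)^*) t (du^*).
Proof.
move=> [ru iu]; split.
  rewrite (_ : _ \o _ = (Re \o u)); last by apply/funext => s /=; rewrite cReJ.
  by rewrite cReJ.
rewrite (_ : _ \o _ = - (Im \o u)); last by apply/funext => s /=; rewrite cImJ.
by rewrite cImJ; apply: is_deriveN.
Qed.

Lemma cderiv_sum (I : Type) (r : seq I) (u : I -> R -> R[i]) t (du : I -> R[i]) :
  (forall i, cderiv (u i) t (du i)) ->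
  cderiv (fun s => \sum_(i <- r) u i s) t (\sum_(i <- r) du i).
Proof.
move=> hu; elim: r => [|i r IH].
  rewrite big_nil; apply: cderiv_ext (cderiv_cst 0 t) => s /=.
  by rewrite big_nil.
rewrite big_cons; apply: cderiv_ext (cderivD (hu i) IH) => s /=.
by rewrite big_cons.
Qed.

Lemma cderiv_cis (a t : R) :
  cderiv (fun s => Complex (cos (s * a)) (sin (s * a))) t
    (Complex 0 a * Complex (cos (t * a)) (sin (t * a))).
Proof.
have dl : is_derive t (1 : R) (fun s : R => s * a) a.
  rewrite (_ : (fun s : R => s * a) = (id : R -> R) * cst a) //.
  by apply: is_derive_eq; rewrite /= /GRing.scale /=; ring.
split => /=.
  rewrite (_ : _ \o _ = cos \o (fun s : R => s * a)) //.
  by apply: is_derive_eq; rewrite /GRing.scale /=; ring.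
rewrite (_ : _ \o _ = sin \o (fun s : R => s * a)) //.
by apply: is_derive_eq; rewrite /GRing.scale /=; ring.
Qed.

End ComplexParts.

Section UnitaryCurves.
Variables (R : realType) (n : nat).
Local Notation C := R[i].
Implicit Types (X W Q : 'M[C]_n) (th : 'I_n -> R).

Definition mderiv (u : R -> 'M[C]_n) t (du : 'M[C]_n) :=
  forall i j, cderiv (fun s => u s i j) t (du i j).

Lemma mderiv_cst (V : 'M[C]_n) t : mderiv (fun=> V) t 0.
Proof. by move=> i j; rewrite mxE; apply: cderiv_cst. Qed.

Lemma mderivM u v t du dv : mderiv u t du -> mderiv v t dv ->
  mderiv (fun s => u s *m v s) t (du *m v t + u t *m dv).
Proof.
move=> hu hv i j; rewrite !mxE -big_split /=.
have := @cderiv_sum R _ (index_enum 'I_n)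
  (fun k s => u s i k * v s k j) t _ (fun k => cderivM (hu i k) (hv k j)).
by apply: cderiv_ext => s; rewrite mxE.
Qed.

Lemma mderiv_adj u t du : mderiv u t du -> mderiv (fun s => (u s)^t*) t (du^t*).
Proof.
move=> hu i j; rewrite !mxE; apply: cderiv_ext (cderivJ (hu j i)) => s.
by rewrite !mxE.
Qed.

(** The eigenvalues e ^ (i t theta) of a one-parameter unitary group, and those of its
    generator; the exponential of a matrix is only needed in diagonal form. *)
Definition cis_row th t : 'rV[C]_n := \row_k Complex (cos (t * th k)) (sin (t * th k)).

Definition cis_gen th : 'rV[C]_n := \row_k Complex 0 (th k).

Lemma mderiv_cis_curve Q th t : Q \is unitarymx ->
  mderiv (fun s => udiag Q (cis_row th s)) t (udiag Q (cis_gen th) *m udiag Q (cis_row th t)).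
Proof.
move=> hQ; rewrite udiagM //.
have hD : mderiv (fun s => diag_mx (cis_row th s)) t
    (diag_mx (\row_k (cis_gen th 0 k * cis_row th t 0 k))).
  move=> i j; rewrite !mxE; case: (altP (i =P j)) => [<-|nij].
    rewrite mulr1n; apply: cderiv_ext (cderiv_cis (th i) t) => s.
    by rewrite !mxE eqxx mulr1n.
  rewrite mulr0n; apply: cderiv_ext (cderiv_cst 0 t) => s.
  by rewrite !mxE (negPf nij) mulr0n.
have := mderivM (mderivM (mderiv_cst (Q^t*) t) hD) (mderiv_cst Q t).
by rewrite mul0mx add0r mulmx0 addr0.
Qed.

Lemma cis_norm (a : R) : `|Complex (cos a) (sin a)| = 1.
Proof. by rewrite normc_def /= cos2Dsin2 sqrtr1. Qed.

Lemma cis_curve_unitary Q th t : Q \is unitarymx -> udiag Q (cis_row th t) \is unitarymx.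
Proof. by move=> hQ; apply: udiag_unitary => // k; rewrite mxE cis_norm. Qed.

Lemma cis_curve0 Q th : Q \is unitarymx -> udiag Q (cis_row th 0) = 1%:M.
Proof.
move=> hQ; rewrite -(udiag_const hQ); congr udiag; apply/rowP => k.
by rewrite !mxE mul0r cos0 sin0.
Qed.

Lemma cis_gen_adj Q th : (udiag Q (cis_gen th))^t* = - udiag Q (cis_gen th).
Proof.
rewrite udiag_adj -udiagN; congr (udiag Q _); apply/rowP => k; rewrite !mxE.
by apply: complex_eq => /=; rewrite ?oppr0.
Qed.

(** Every antihermitian matrix generates such a group. *)
Lemma antiherm_cis X : X^t* = - X -> exists Q th,
  Q \is unitarymx /\ X = udiag Q (cis_gen th).
Proof.
move=> /antiherm_udiag[Q [d [uQ hd ->]]]; exists Q, (fun k => complex.Im (d 0 k)).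
split; [by []|congr (udiag Q _); apply/rowP => k]; rewrite mxE; have := hd k.
case: (d 0 k) => x y [] /= hx; apply: complex_eq => //=; lra.
Qed.

Lemma unit_circle_cis (z : C) : `|z| = 1 ->
  exists2 a : R, `|a| <= pi & z = Complex (cos a) (sin a).
Proof.
move=> z1; have h : complex.Re z ^+ 2 + complex.Im z ^+ 2 = 1.
  by have /(congr1 (@complex.Re R)) := add_Re2_Im2 z; rewrite z1 expr1n => h; exact: h.
case: z h {z1} => x y /= h.
have hx : -1 <= x <= 1.
  by apply/andP; split; nra.
have p0 := acos_ge0 hx; have ppi := acos_lepi hx.
case: (leP 0 y) => hy.
  exists (acos x); first by rewrite ger0_norm.
  apply: complex_eq; rewrite /= ?acosK // sin_acos //.
  rewrite (_ : 1 - x ^+ 2 = y ^+ 2) ?sqrtr_sqr ?ger0_norm //; lra.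
exists (- acos x); first by rewrite normrN ger0_norm.
apply: complex_eq; rewrite /= ?cosN ?acosK // sinN sin_acos //.
by rewrite (_ : 1 - x ^+ 2 = y ^+ 2) ?sqrtr_sqr ?ltr0_norm ?opprK //; lra.
Qed.

(** Every unitary matrix is reached at time 1 by a group whose generator has entries
    bounded independently of the matrix; used to bound oscillations on the orbit. *)
Lemma unitary_cis V : V \is unitarymx -> exists Q th, [/\ Q \is unitarymx,
   forall k, `|th k| <= pi & V = udiag Q (cis_row th 1)].
Proof.
move=> /unitary_udiag[Q [d [uQ hd ->]]].
have /(@choice _ _ (fun k a => `|a| <= pi /\ d 0 k = Complex (cos a) (sin a)))[th hth] k :
    exists a : R, `|a| <= pi /\ d 0 k = Complex (cos a) (sin a).
  by have [a ? ?] := unit_circle_cis (hd k); exists a.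
exists Q, th; split => [|k|]; [by []|by have [] := hth k|].
by congr (udiag Q _); apply/rowP => k; rewrite mxE mul1r; have [] := hth k.
Qed.

(** Links the formal derivation to analysis: der X p is the derivative of p along the
    flow of X. *)
Lemma cderiv_ev p X (g : R -> 'M[C]_n) W t : X^t* = - X ->
  mderiv g t (X *m g t) ->
  cderiv (fun s => ev p (g s *m W *m (g s)^t*)) t
     (ev (der X p) (g t *m W *m (g t)^t*)).
Proof.
move=> hX hg; elim: p => [a|Y|p IHp q IHq|p IHp q IHq] /=.
- exact: cderiv_cst.
- have hG := mderivM (mderiv_cst Y t) (mderivM (mderivM hg (mderiv_cst W t)) (mderiv_adj hg)).
  have := @cderiv_sum R _ (index_enum 'I_n) _ t _ (fun i => hG i i).
  by rewrite mul0mx add0r mulmx0 addr0 -(trace_orbit_der _ _ _ hX).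
- exact: cderivD.
- exact: cderivM.
Qed.

End UnitaryCurves.

(** * The Casimir operator and the carre du champ *)

Section Casimir.
Variables (C : numClosedFieldType) (n : nat).
Implicit Types (X Y Z W : 'M[C]_n) (p q h : polyfun C n).
Local Notation E i j := (delta_mx i j : 'M[C]_n).

Definition herm W := W^t* = W.
(** Expressions are compared as functions on Hermitian matrices, where the orbit
    lives. *)
Definition eq_herm p q := forall W, herm W -> ev p W = ev q W.

Fixpoint line_poly p W Y : {poly C} :=
  match p with
  | Cst c => c%:P
  | Lin Z => (\tr (Z *m W))%:P + \tr (Z *m Y) *: 'X
  | Add p q => line_poly p W Y + line_poly q W Y
  | Mul p q => line_poly p W Y * line_poly q W Y
  end.

Lemma line_horner p W Y t : (line_poly p W Y).[t] = ev p (W + t *: Y).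
Proof.
elim: p => [c|Z|p IHp q IHq|p IHp q IHq] /=; rewrite !hornerE ?IHp ?IHq //.
by rewrite mulmxDr raddfD /= -scalemxAr mxtraceZ mulrC.
Qed.

Lemma line_deriv p W X :
  (line_poly p W (X *m W - W *m X))^`().[0] = ev (der X p) W.
Proof.
have l0 q : (line_poly q W (X *m W - W *m X)).[0] = ev q W.
  by rewrite line_horner scale0r addr0.
elim: p => [c|Z|p IHp q IHq|p IHp q IHq] /=.
- by rewrite derivC horner0.
- rewrite derivD derivC derivZ derivX !hornerE mulmxBr mulmxBl !raddfB /=.
  rewrite !mulmxA [\tr (X *m Z *m W)]mxtrace_mulC mulmxA.
  by rewrite [\tr (Z *m W *m X)]mxtrace_mulC mulmxA [\tr (X *m Z *m W)]mxtrace_mulC mulmxA.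
- by rewrite derivD hornerD IHp IHq.
- by rewrite derivM hornerD !hornerM IHp IHq !l0.
Qed.

Lemma poly_eq_nat (P Q : {poly C}) : (forall k : nat, P.[k%:R] = Q.[k%:R]) -> P = Q.
Proof.
move=> PQ; apply/eqP; rewrite -subr_eq0; apply/negPn/negP => nz.
have := max_poly_roots nz (rs := [seq k%:R | k <- iota 0 (size (P - Q))]).
rewrite size_map size_iota ltnn => H; suff: false by []; apply: H.
  by apply/allP => _ /mapP[k _ ->]; rewrite /root hornerD hornerN PQ subrr.
rewrite map_inj_uniq ?iota_uniq // => i j /eqP.
by rewrite eqr_nat => /eqP.
Qed.

Lemma trmxCD m k (X Y : 'M[C]_(m, k)) : (X + Y)^t* = X^t* + Y^t*.
Proof. by rewrite linearD /= map_mxD. Qed.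

Lemma trmxCZ m k (a : C) (X : 'M[C]_(m, k)) : (a *: X)^t* = a^* *: X^t*.
Proof. by rewrite linearZ /= map_mxZ. Qed.

Lemma antiherm_split X : exists Y Z, [/\ Y^t* = - Y, Z^t* = - Z & X = Y + 'i *: Z].
Proof.
exists (2^-1 *: (X - X^t*)), ((2 * 'i)^-1 *: (X + X^t*)); split.
- by rewrite trmxCZ trmxCB trmxCK rmorphV ?unitfE ?pnatr_eq0 // rmorph_nat -scalerN opprB.
- rewrite trmxCZ trmxCD trmxCK rmorphV ?unitfE ?mulf_neq0 ?pnatr_eq0 ?neq0Ci //.
  by rewrite rmorphM rmorph_nat /= conjCi mulrN invrN scaleNr addrC.
rewrite scalerA (_ : 'i * (2 * 'i)^-1 = 2^-1); last first.
  by rewrite invfM mulrCA divff ?neq0Ci ?mulr1.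
rewrite -scalerDr addrACA addNr addr0 scalerDr -scalerDl.
rewrite (_ : 2^-1 + 2^-1 = 1) ?scale1r //.
by rewrite [RHS]splitr div1r.
Qed.

(** Derivations act on functions, not merely on expressions: for antihermitian X the
    direction X W - W X is Hermitian, so expressions that agree on Hermitian matrices
    agree on a line in that direction; the general case follows as every matrix is a
    complex combination of two antihermitian ones. *)
Lemma der_congH p q X : eq_herm p q -> eq_herm (der X p) (der X q).
Proof.
move=> pq; suff anti Y : Y^t* = - Y -> eq_herm (der Y p) (der Y q).
  move=> W hW; have [Y [Z [hY hZ ->]]] := antiherm_split X.
  by rewrite !ev_derD !ev_derZ anti // anti.
move=> hY W hW; rewrite -!line_deriv; congr (_^`().[0]).
apply: poly_eq_nat => k; rewrite !line_horner pq // /herm.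
rewrite trmxCD trmxCZ trmxCB !trmxC_mul rmorph_nat hY hW mulmxN mulNmx.
by rewrite opprK [- _ + _]addrC.
Qed.

Lemma ev_der2D p X Y Z W : herm W ->
  ev (der X (der (Y + Z) p)) W = ev (der X (der Y p)) W + ev (der X (der Z p)) W.
Proof.
have h : eq_herm (der (Y + Z) p) (Add (der Y p) (der Z p)).
  by move=> V _; rewrite ev_derD.
by move=> hW; rewrite (der_congH X h).
Qed.

Lemma ev_der2Z p X Y a W : herm W ->
  ev (der X (der (a *: Y) p)) W = a * ev (der X (der Y p)) W.
Proof.
have h : eq_herm (der (a *: Y) p) (Scale a (der Y p)).
  by move=> V _; rewrite ev_derZ.
by move=> hW; rewrite (der_congH X h) // ev_der_Scale.
Qed.

Lemma ev_der2_sum (I : Type) (r : seq I) p X (F : I -> 'M[C]_n) W : herm W ->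
  ev (der X (der (\sum_(i <- r) F i) p)) W = \sum_(i <- r) ev (der X (der (F i) p)) W.
Proof.
move=> hW; apply: (big_morph (fun Y => ev (der X (der Y p)) W)) => [Y Z|].
  exact: ev_der2D.
by have := ev_der2Z p X 0 0 hW; rewrite scale0r mul0r.
Qed.

Lemma delta_mulmx i j X : E i j *m X = \sum_k X j k *: E i k.
Proof.
apply/matrixP => a b; rewrite mxE summxE (bigD1 j) //= big1 => [|k kj]; last first.
  by rewrite mxE (negPf kj) andbF mul0r.
rewrite mxE eqxx andbT addr0 (bigD1 b) //= big1 => [|k kb]; last first.
  by rewrite !mxE [b == k]eq_sym (negPf kb) andbF mulr0.
by rewrite !mxE eqxx andbT addr0 mulrC.
Qed.

Lemma mulmx_delta i j X : X *m E i j = \sum_k X k i *: E k j.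
Proof.
apply/matrixP => a b; rewrite mxE summxE (bigD1 i) //= big1 => [|k ki]; last first.
  by rewrite mxE (negPf ki) mulr0.
rewrite mxE eqxx addr0 (bigD1 a) //= big1 => [|k ka]; last first.
  by rewrite !mxE [a == k]eq_sym (negPf ka) mulr0.
by rewrite !mxE eqxx addr0.
Qed.

(** The Casimir element of gl_n acting by derivations. It is a positive multiple
    of minus the Laplacian of the orbit, as ev_casimir_squares shows. *)
Definition casimir p := Sum (index_enum 'I_n) (fun i => Sum (index_enum 'I_n)
  (fun j => der (E i j) (der (E j i) p))).

Lemma ev_casimir p W : ev (casimir p) W = \sum_i \sum_j ev (der (E i j) (der (E j i) p)) W.
Proof. by rewrite ev_Sum; apply: eq_bigr => i _; rewrite ev_Sum. Qed.

Lemma ev_der_casimir p X W : ev (der X (casimir p)) W =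
  \sum_i \sum_j ev (der X (der (E i j) (der (E j i) p))) W.
Proof.
rewrite der_Sum ev_Sum; apply: eq_bigr => i _.
by rewrite der_Sum ev_Sum.
Qed.

Lemma ev_derB p X Y W : ev (der (X - Y) p) W = ev (der X p) W - ev (der Y p) W.
Proof. by rewrite ev_derD ev_derN. Qed.

Lemma ev_der2B p X Y Z W : herm W ->
  ev (der X (der (Y - Z) p)) W = ev (der X (der Y p)) W - ev (der X (der Z p)) W.
Proof. by move=> hW; rewrite ev_der2D // -scaleN1r ev_der2Z // mulN1r. Qed.

(** The Casimir element is central. *)
Lemma ev_casimir_comm p X W : herm W -> ev (der X (casimir p)) W = ev (casimir (der X p)) W.
Proof.
move=> hW; apply/eqP; rewrite -subr_eq0 ev_der_casimir ev_casimir -sumrB.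
pose b i j k l := ev (der (E i j) (der (E k l) p)) W.
transitivity (0 == 0 :> C); last by rewrite eqxx.
congr (_ == _).
transitivity (\sum_i \sum_j ((\sum_k X i k * b i j j k - \sum_k X k j * b i j k i)
   + (\sum_k X j k * b i k j i - \sum_k X k i * b k j j i))).
  apply: eq_bigr => i _; rewrite -sumrB; apply: eq_bigr => j _.
  have e1 : ev (der X (der (E i j) (der (E j i) p))) W
      = ev (der (E i j) (der X (der (E j i) p))) W
        + ev (der (E i j *m X - X *m E i j) (der (E j i) p)) W.
    by rewrite -ev_der_comm addrC subrK.
  have e2 : ev (der (E i j) (der X (der (E j i) p))) W
      = ev (der (E i j) (der (E j i) (der X p))) W
        + ev (der (E i j) (der (E j i *m X - X *m E j i) p)) W.
    have h : eq_herm (der X (der (E j i) p))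
       (Add (der (E j i) (der X p)) (der (E j i *m X - X *m E j i) p)).
      by move=> V _ /=; rewrite -ev_der_comm addrC subrK.
    by rewrite (der_congH _ h).
  have r1 : ev (der (E i j) (der (E j i *m X) p)) W = \sum_k X i k * b i j j k.
    by rewrite delta_mulmx ev_der2_sum //; apply: eq_bigr => k _; rewrite ev_der2Z.
  have r2 : ev (der (E i j) (der (X *m E j i) p)) W = \sum_k X k j * b i j k i.
    by rewrite mulmx_delta ev_der2_sum //; apply: eq_bigr => k _; rewrite ev_der2Z.
  have r3 : ev (der (E i j *m X) (der (E j i) p)) W = \sum_k X j k * b i k j i.
    by rewrite delta_mulmx ev_der_sum //; apply: eq_bigr => k _; rewrite ev_derZ.
  have r4 : ev (der (X *m E i j) (der (E j i) p)) W = \sum_k X k i * b k j j i.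
    by rewrite mulmx_delta ev_der_sum //; apply: eq_bigr => k _; rewrite ev_derZ.
  by rewrite e1 e2 ev_derB ev_der2B // r1 r2 r3 r4; ring.
under eq_bigr do rewrite big_split /= !sumrB.
rewrite big_split /= !sumrB.
set S1 := \sum_i \sum_j \sum_k X i k * _; set S2 := \sum_i \sum_j \sum_k X k j * _.
have -> : \sum_i \sum_j \sum_k X j k * b i k j i = S2.
  by apply: eq_bigr => i _; rewrite exchange_big.
have -> : \sum_i \sum_j \sum_k X k i * b k j j i = S1.
  rewrite exchange_big /= [RHS]exchange_big /=; apply: eq_bigr => j _.
  by rewrite exchange_big.
by ring.
Qed.

(** The carre du champ of the Casimir operator; for real p, carre p p is the squared
    norm of the gradient of p (see ev_carre_norm). *)
Definition carre p q := Scale (- 1) (Sum (index_enum 'I_n) (fun i => Sum (index_enum 'I_n)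
  (fun j => Mul (der (E i j) p) (der (E j i) q)))).

Lemma ev_carre p q W : ev (carre p q) W =
  - \sum_i \sum_j ev (der (E i j) p) W * ev (der (E j i) q) W.
Proof.
rewrite /= ev_Sum mulN1r; congr (- _); apply: eq_bigr => i _.
by rewrite ev_Sum.
Qed.

Lemma ev_gamC p q W : ev (carre p q) W = ev (carre q p) W.
Proof.
rewrite !ev_carre exchange_big /=; congr (- _); apply: eq_bigr => i _.
by apply: eq_bigr => j _; rewrite mulrC.
Qed.

(** The Leibniz rule for a second-order operator; it identifies carre as its
    carre du champ. *)
Lemma ev_casimir_mul p q W : ev (casimir (Mul p q)) W =
  ev (casimir p) W * ev q W + ev p W * ev (casimir q) W - 2 * ev (carre p q) W.
Proof.
rewrite mulrDl mul1r opprD {2}ev_gamC !ev_carre !opprK !ev_casimir.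
rewrite mulr_suml mulr_sumr -!big_split /=; apply: eq_bigr => i _.
rewrite mulr_suml mulr_sumr -!big_split /=; apply: eq_bigr => j _.
by ring.
Qed.

Lemma ev_casimir_add p q W : ev (casimir (Add p q)) W = ev (casimir p) W + ev (casimir q) W.
Proof.
rewrite !ev_casimir -!big_split /=; apply: eq_bigr => i _.
by rewrite -!big_split.
Qed.

Lemma ev_casimir_cst c W : ev (casimir (Cst n c)) W = 0.
Proof. by rewrite ev_casimir /= big1 // => i _; rewrite big1. Qed.

Lemma ev_carre_cst c q W : ev (carre (Cst n c) q) W = 0.
Proof.
by rewrite ev_carre big1 ?oppr0 // => i _; rewrite big1 // => j _; rewrite /= mul0r.
Qed.

Lemma ev_casimir_scale c p W : ev (casimir (Scale c p)) W = c * ev (casimir p) W.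
Proof. by rewrite ev_casimir_mul ev_casimir_cst ev_carre_cst /= mulr0 mul0r add0r subr0. Qed.

Lemma ev_casimir_Sum (I : Type) (r : seq I) (F : I -> polyfun C n) W :
  ev (casimir (Sum r F)) W = \sum_(i <- r) ev (casimir (F i)) W.
Proof.
rewrite /Sum; elim: r => [|i r IH]; first by rewrite !big_nil ev_casimir_cst.
by rewrite !big_cons -IH -ev_casimir_add.
Qed.

End Casimir.

(** * Bochner formula and curvature bound *)

Section Bochner.
Variables (C : numClosedFieldType) (n : nat).
Implicit Types (X Y Z W : 'M[C]_n) (p q h : polyfun C n).
Local Notation E i j := (delta_mx i j : 'M[C]_n).

Definition real_on_herm p := forall W, herm W -> (ev p W)^* = ev p W.

Lemma real_bar p : real_on_herm p -> eq_herm (bar p) p.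
Proof. by move=> rp W hW; rewrite ev_bar // rp. Qed.

Lemma conj_der p X W : real_on_herm p -> herm W ->
  (ev (der X p) W)^* = - ev (der (X^t*) p) W.
Proof.
move=> rp hW; rewrite -(der_congH (X^t*) (real_bar rp)) // ev_der_bar //.
by rewrite trmxCK opprK.
Qed.

Lemma conj_der2 p X Y W : real_on_herm p -> herm W ->
  (ev (der X (der Y p)) W)^* = ev (der (X^t*) (der (Y^t*) p)) W.
Proof.
move=> rp hW.
rewrite -(der_congH (X^t*) (der_congH (Y^t*) (real_bar rp))) // ev_der_der_bar //.
by rewrite !trmxCK.
Qed.

Lemma delta_adj i j : (E i j)^t* = E j i.
Proof.
apply/matrixP => a b; rewrite !mxE andbC.
by case: (_ && _); rewrite ?rmorph1 ?rmorph0.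
Qed.

Lemma ev_carre_norm p W : real_on_herm p -> herm W ->
  ev (carre p p) W = \sum_i \sum_j `|ev (der (E i j) p) W| ^+ 2.
Proof.
move=> rp hW; rewrite ev_carre -sumrN; apply: eq_bigr => i _.
rewrite -sumrN; apply: eq_bigr => j _.
by rewrite normCK conj_der // delta_adj mulrN.
Qed.

(** Squared norm of all second derivatives of h. *)
Definition hessian_sqr h W : C :=
  \sum_i \sum_j \sum_k \sum_l `|ev (der (E k l) (der (E i j) h)) W| ^+ 2.

(** As the Casimir element is central, no first-order curvature term appears when it is
    moved past a derivation. *)
Lemma bochner h W : real_on_herm h -> herm W ->
  ev (casimir (carre h h)) W = 2 * ev (carre h (casimir h)) W - 2 * hessian_sqr h W.
Proof.
move=> rh hW; rewrite ev_casimir_scale ev_casimir_Sum mulN1r.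
transitivity (- (\sum_i \sum_j ev (der (E i j) (casimir h)) W * ev (der (E j i) h) W
  + \sum_i \sum_j ev (der (E i j) h) W * ev (der (E j i) (casimir h)) W
  + 2 * hessian_sqr h W)); last first.
  rewrite ev_carre [X in - (X + _ + _)]exchange_big /=.
  set a := \sum_i _; set b := \sum_i _.
  have -> : a = b by apply: eq_bigr => i _; apply: eq_bigr => j _; rewrite mulrC.
  by ring.
congr (- _); rewrite mulr_sumr -!big_split /=; apply: eq_bigr => i _.
rewrite ev_casimir_Sum mulr_sumr -!big_split /=; apply: eq_bigr => j _.
rewrite ev_casimir_mul -!ev_casimir_comm // ev_carre mulrN opprK; congr (_ + _ * _).
apply: eq_bigr => k _; apply: eq_bigr => l _.
by rewrite normCK conj_der2 // !delta_adj.
Qed.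

Lemma normB_sqr_le (a b : C) : `|a - b| ^+ 2 <= 2 * (`|a| ^+ 2 + `|b| ^+ 2).
Proof.
rewrite -subr_ge0 (_ : _ - _ = `|a + b| ^+ 2) ?exprn_ge0 //.
by rewrite !normCK !(rmorphD, rmorphB, rmorphN) /=; ring.
Qed.

Lemma sum_delta (j : 'I_n) (F : 'I_n -> C) : \sum_k (j == k)%:R * F k = F j.
Proof.
rewrite (bigD1 j) //= eqxx mul1r big1 ?addr0 // => k kj.
by rewrite eq_sym (negPf kj) mul0r.
Qed.

Lemma sum_delta' (j : 'I_n) (F : 'I_n -> C) : \sum_k (k == j)%:R * F k = F j.
Proof. by rewrite -[RHS]sum_delta; apply: eq_bigr => k _; rewrite eq_sym. Qed.

(** The adjoint action of gl_n on the traceless family g has a nonzero constant as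
    Casimir eigenvalue, namely 2 n. *)
Lemma bracket_norm (g : 'I_n -> 'I_n -> C) : \sum_i g i i = 0 ->
  \sum_i \sum_j \sum_k \sum_l `|(j == k)%:R * g i l - (l == i)%:R * g k j| ^+ 2
  = 2 * n%:R * \sum_i \sum_j `|g i j| ^+ 2.
Proof.
move=> g0.
(* Squaring the indicators lets the norm be expanded as a polynomial in them. *)
have sq (b : bool) : b%:R * b%:R = b%:R :> C by case: b; rewrite ?mulr1 ?mulr0.
transitivity (\sum_i \sum_j \sum_k \sum_l ((j == k)%:R * (g i l * (g i l)^*)
   + (l == i)%:R * (g k j * (g k j)^*)
   - (l == i)%:R * ((j == k)%:R * (g i l * (g k j)^*))
   - (l == i)%:R * ((j == k)%:R * ((g i l)^* * g k j)))).
  do 4![apply: eq_bigr => ? _].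
  rewrite normCK rmorphB !rmorphM !rmorph_nat /=.
  by rewrite -[X in X * (g _ _ * (g _ _)^*) + _]sq -[X in _ + X * _ - _ - _]sq; ring.
under eq_bigr do under eq_bigr do under eq_bigr do
  rewrite !sumrB big_split /= !sum_delta' -mulr_sumr.
under eq_bigr do under eq_bigr do rewrite !sumrB big_split /= !sum_delta.
under eq_bigr do rewrite !sumrB big_split /=.
rewrite !sumrB big_split /=.
have -> : \sum_i \sum_j g i i * (g j j)^* = 0.
  under eq_bigr do rewrite -mulr_sumr.
  by rewrite -mulr_suml g0 mul0r.
have -> : \sum_i \sum_j (g i i)^* * g j j = 0.
  under eq_bigr do rewrite -mulr_sumr g0 mulr0.
  by rewrite big1.
rewrite !subr0 -mulrA mulrDl mul1r; congr (_ + _).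
  rewrite mulr_sumr; apply: eq_bigr => i _; rewrite sumr_const card_ord mulr_natl.
  by congr (_ *+ _); apply: eq_bigr => l _; rewrite normCK.
rewrite sumr_const card_ord mulr_natl; congr (_ *+ _).
rewrite exchange_big /=; apply: eq_bigr => i _; apply: eq_bigr => j _.
by rewrite normCK.
Qed.

Lemma sum_delta_mx : \sum_i E i i = 1%:M.
Proof.
apply/matrixP => a b; rewrite summxE (bigD1 a) //= big1 => [|k ka].
  by rewrite !mxE eqxx addr0 eq_sym.
by rewrite !mxE [a == k]eq_sym (negPf ka).
Qed.

(** The antisymmetric part of the matrix of second derivatives consists of derivatives
    along commutators, so it is controlled from below by the gradient. This plays the
    role of a Ricci curvature bound of order n. *)
Lemma hessian_ge h W : real_on_herm h -> herm W -> n%:R * ev (carre h h) W <= 2 * hessian_sqr h W.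
Proof.
move=> rh hW; rewrite ev_carre_norm //.
set g := fun i j => ev (der (E i j) h) W.
have g0 : \sum_i g i i = 0.
  by rewrite /g -ev_der_sum sum_delta_mx ev_der1.
(* |T - T'| ^ 2 <= 2 (|T| ^ 2 + |T'| ^ 2), with T' the derivatives in the other order. *)
have B := bracket_norm g0; set T := fun i j k l => ev (der (E k l) (der (E i j) h)) W.
suff : 2 * n%:R * \sum_i \sum_j `|g i j| ^+ 2 <= 2 * (2 * hessian_sqr h W).
  by rewrite -mulrA ler_pM2l.
rewrite -B.
have -> : 2 * (2 * hessian_sqr h W) =
    \sum_i \sum_j \sum_k \sum_l 2 * (`|T i j k l| ^+ 2 + `|T k l i j| ^+ 2).
  have e : hessian_sqr h W = \sum_i \sum_j \sum_k \sum_l `|T k l i j| ^+ 2.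
    rewrite /hessian_sqr pair_bigA [RHS]pair_bigA /=.
    under eq_bigr do rewrite pair_bigA /=.
    under [RHS]eq_bigr do rewrite pair_bigA /=.
    exact: exchange_big.
  have dbl : 2 * hessian_sqr h W = hessian_sqr h W + \sum_i \sum_j \sum_k \sum_l `|T k l i j| ^+ 2.
    by rewrite mulrDl !mul1r {2}e.
  rewrite dbl /hessian_sqr.
  rewrite -big_split mulr_sumr /=; apply: eq_bigr => i _.
  rewrite -big_split mulr_sumr /=; apply: eq_bigr => j _.
  rewrite -big_split mulr_sumr /=; apply: eq_bigr => k _.
  by rewrite -big_split mulr_sumr /=.
apply: ler_sum => i _; apply: ler_sum => j _; apply: ler_sum => k _; apply: ler_sum => l _.
rewrite (_ : _ - _ = T i j k l - T k l i j) ?normB_sqr_le //.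
rewrite /T ev_der_comm ev_derB !mul_delta_mx_cond /g.
by case: (j == k); case: (l == i); rewrite ?mulr1n ?mulr0n ?ev_der0 ?mul1r ?mul0r.
Qed.

(** Up to a negative factor the Casimir operator is a sum of squares of derivations
    along antihermitian, hence actual, directions. *)
Lemma ev_casimir_squares p W : herm W -> - 4 * ev (casimir p) W =
  \sum_i \sum_j (ev (der (E i j - E j i) (der (E i j - E j i) p)) W
    + ev (der ('i *: (E i j + E j i)) (der ('i *: (E i j + E j i)) p)) W).
Proof.
move=> hW; pose b i j := ev (der (E i j) (der (E j i) p)) W.
transitivity (\sum_i \sum_j (- 2 * b i j - 2 * b j i)).
  rewrite ev_casimir -/b.
  under [RHS]eq_bigr do rewrite sumrB -!mulr_sumr.
  rewrite sumrB -!mulr_sumr [X in _ - _ * X]exchange_big /=.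
  by ring.
apply: eq_bigr => i _; apply: eq_bigr => j _; rewrite /b.
rewrite ev_derZ ev_der2Z // mulrA -expr2 sqrCi.
rewrite !ev_derD ev_derN !ev_der2B // !ev_der2D //.
by ring.
Qed.

Lemma ev_carre_sub a p q W :
  ev (carre (Add (Scale a p) (Scale (-1) q)) (Add (Scale a p) (Scale (-1) q))) W
  = a ^+ 2 * ev (carre p p) W - 2 * a * ev (carre p q) W + ev (carre q q) W.
Proof.
rewrite (_ : 2 * a * ev (carre p q) W = a * ev (carre p q) W + a * ev (carre q p) W); last first.
  by rewrite (ev_gamC q p); ring.
rewrite !ev_carre !mulrN !opprD !opprK !mulr_sumr -!sumrN -!big_split /=.
apply: eq_bigr => i _; rewrite !mulr_sumr -!sumrN -!big_split /=.
apply: eq_bigr => j _; rewrite !mul0r !add0r.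
by ring.
Qed.

Lemma real_scale a p : a^* = a -> real_on_herm p -> real_on_herm (Scale a p).
Proof. by move=> ha rp W hW; rewrite /= rmorphM /= ha rp. Qed.

Lemma real_add p q : real_on_herm p -> real_on_herm q -> real_on_herm (Add p q).
Proof. by move=> rp rq W hW; rewrite /= rmorphD /= rp // rq. Qed.

Lemma ev_carre_ge0 p W : real_on_herm p -> herm W -> 0 <= ev (carre p p) W.
Proof.
move=> rp hW; rewrite ev_carre_norm // sumr_ge0 // => i _.
by rewrite sumr_ge0 // => j _; rewrite exprn_ge0.
Qed.

Lemma ev_carre_casimir h f a W : herm W -> eq_herm (casimir h) (Add f (Scale (- a) h)) ->
  ev (carre h (casimir h)) W = ev (carre h f) W - a * ev (carre h h) W.
Proof.
move=> hW eqc; rewrite !ev_carre.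
have -> : \sum_i \sum_j ev (der (E i j) h) W * ev (der (E j i) (casimir h)) W =
    \sum_i \sum_j ev (der (E i j) h) W * ev (der (E j i) f) W
    - a * \sum_i \sum_j ev (der (E i j) h) W * ev (der (E j i) h) W.
  rewrite mulr_sumr -sumrB; apply: eq_bigr => i _; rewrite mulr_sumr -sumrB.
  by apply: eq_bigr => j _; rewrite (der_congH _ eqc) // /= mul0r add0r; ring.
by ring.
Qed.

Lemma unitary_entry_le1 (U : 'M[C]_n) i j : U \is unitarymx -> `|U i j| <= 1.
Proof.
move=> /unitarymxP/matrixP/(_ i i); rewrite !mxE eqxx mulr1n => e.
rewrite -(@expr_le1 _ 2) // -e (bigD1 j) //= !mxE -normCK lerDl sumr_ge0 // => k _.
by rewrite !mxE -normCK exprn_ge0.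
Qed.

Lemma udiag_entry_le (Q : 'M[C]_n) (d : 'rV[C]_n) i j : Q \is unitarymx ->
  `|udiag Q d i j| <= \sum_k `|d 0 k|.
Proof.
move=> uQ; rewrite /udiag -mulmxA mxE (le_trans (ler_norm_sum _ _ _)) //.
apply: ler_sum => k _; rewrite mul_diag_mx !mxE !normrM norm_conjC.
rewrite -[leRHS]mul1r ler_pM ?mulr_ge0 ?unitary_entry_le1 //.
by rewrite -[leRHS]mulr1 ler_wpM2l ?unitary_entry_le1.
Qed.

Lemma ev_bounded p (A : 'M[C]_n) : exists B : C,
  forall U, U \is unitarymx -> `|ev p (U *m A *m U^t*)| <= B.
Proof.
elim: p => [c|Y|p [B1 hp] q [B2 hq]|p [B1 hp] q [B2 hq]] /=.
- by exists `|c|.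
- exists (\sum_i \sum_j `|Y i j| * \sum_k \sum_l `|A l k|) => U uU.
  rewrite (le_trans (ler_norm_sum _ _ _)) //; apply: ler_sum => i _.
  rewrite mxE (le_trans (ler_norm_sum _ _ _)) //; apply: ler_sum => j _.
  rewrite normrM ler_wpM2l // mxE (le_trans (ler_norm_sum _ _ _)) //.
  apply: ler_sum => k _; rewrite normrM !mxE norm_conjC -[leRHS]mulr1.
  rewrite ler_pM ?unitary_entry_le1 // (le_trans (ler_norm_sum _ _ _)) //.
  apply: ler_sum => l _; rewrite normrM -[leRHS]mul1r.
  by rewrite ler_wpM2r ?unitary_entry_le1.
- exists (B1 + B2) => U uU; rewrite (le_trans (ler_normD _ _)) //.
  by rewrite lerD ?hp ?hq.
- by exists (B1 * B2) => U uU; rewrite normrM ler_pM ?hp ?hq.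
Qed.

End Bochner.

(** * Solving the resolvent equation *)

Section Resolvent.
Variables (C : numClosedFieldType) (n : nat).
Implicit Types (X Y Z W A U : 'M[C]_n) (p q h : polyfun C n).
Local Notation E i j := (delta_mx i j : 'M[C]_n).

(** The characteristic polynomial of M has finitely many roots. *)
Lemma small_regular_shift m (M : 'M[C]_m) (e : C) : 0 < e ->
  exists s : C, [/\ 0 < s, s < e & M + s%:M \in unitmx].
Proof.
move=> e0; set P := char_poly M.
have P0 : P != 0 by rewrite monic_neq0 // char_poly_monic.
pose F (k : nat) : C := - (e / k.+2%:R).
have Finj : injective F.
  move=> i j /oppr_inj/(mulfI (lt0r_neq0 e0))/invr_inj/eqP.
  by rewrite eqr_nat => /eqP[].
have : ~~ all (root P) [seq F k | k <- iota 0 (size P)].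
  apply/negP => aP; have := max_poly_roots P0 aP.
  by rewrite map_inj_uniq ?iota_uniq // size_map size_iota ltnn => /(_ isT).
move=> /allPn[_ /mapP[k _ ->] nr]; exists (e / k.+2%:R); split.
- by rewrite divr_gt0 // ltr0n.
- by rewrite ltr_pdivrMr ?ltr0n // ltr_pMr // ltr1n.
rewrite -row_free_unit -kermx_eq0; apply: contraR nr => nk.
by rewrite -eigenvalue_root_char /eigenvalue /eigenspace raddfN /= opprK.
Qed.

(** (casimir + s) h = p is a linear system on a finite-dimensional space, solvable for
    all but finitely many s. Perturbing by a small s > 0 avoids having to know that
    the kernel of the Casimir operator consists of constants. *)
Lemma resolvent p (e : C) : 0 < e -> exists s h, [/\ 0 < s, s < e &
  eq_herm (casimir h) (Add p (Scale (- s) h))].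
Proof.
move=> e0; have [I [f [D [c [pE fD]]]]] := closed_family p.
(* M is the matrix of the Casimir operator in the closed family f. *)
pose M : 'M[C]_#|I| := \matrix_(a, b) \sum_i \sum_j \sum_u
  D (E j i) (enum_val a) u * D (E i j) u (enum_val b).
have [s [s0 se Mu]] := small_regular_shift M e0.
pose v : 'rV[C]_#|I| := (\row_a c (enum_val a)) *m invmx (M + s%:M).
have vM : v *m (M + s%:M) = \row_a c (enum_val a) by rewrite mulmxKV.
exists s, (Sum (index_enum 'I_#|I|) (fun a => Scale (v 0 a) (f (enum_val a)))).
split=> // W hW.
have casf a : ev (casimir (f (enum_val a))) W = \sum_b M a b * ev (f (enum_val b)) W.
  transitivity (\sum_i \sum_j \sum_u D (E j i) (enum_val a) u *
      \sum_l D (E i j) u l * ev (f l) W).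
    rewrite ev_casimir; apply: eq_bigr => i _; apply: eq_bigr => j _.
    have h : eq_herm (der (E j i) (f (enum_val a)))
       (Sum (index_enum I) (fun u => Scale (D (E j i) (enum_val a) u) (f u))).
      by move=> V _; rewrite ev_Sum fD.
    rewrite (der_congH _ h) // der_Sum ev_Sum; apply: eq_bigr => u _.
    by rewrite ev_der_Scale fD.
  transitivity (\sum_l
    (\sum_i \sum_j \sum_u D (E j i) (enum_val a) u * D (E i j) u l) * ev (f l) W).
    under [RHS]eq_bigr do rewrite mulr_suml.
    rewrite [RHS]exchange_big /=; apply: eq_bigr => i _.
    under [RHS]eq_bigr do rewrite mulr_suml.
    rewrite [RHS]exchange_big /=; apply: eq_bigr => j _.
    under [RHS]eq_bigr do rewrite mulr_suml.
    rewrite [RHS]exchange_big /=; apply: eq_bigr => u _.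
    by rewrite mulr_sumr; apply: eq_bigr => l _; rewrite mulrA.
  rewrite (reindex_onto enum_val enum_rank) => [|l _]; last by rewrite enum_rankK.
  by apply: eq_big => [b|b _]; rewrite ?enum_valK ?eqxx // mxE.
rewrite ev_casimir_Sum /= ev_Sum.
transitivity (\sum_b (v *m M) 0 b * ev (f (enum_val b)) W).
  under eq_bigr do rewrite ev_casimir_scale casf mulr_sumr.
  rewrite exchange_big /=; apply: eq_bigr => b _.
  by rewrite mxE mulr_suml; apply: eq_bigr => a _; rewrite mulrA.
have -> : v *m M = (\row_a c (enum_val a)) - s *: v.
  by rewrite -vM mulmxDr mul_mx_scalar addrK.
rewrite pE mulNr mulr_sumr -sumrN.
rewrite [X in _ = X + _](reindex_onto enum_val enum_rank) => [|l _]; last by rewrite enum_rankK.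
under [X in _ = X + _]eq_bigl do rewrite enum_valK eqxx.
by rewrite -big_split; apply: eq_bigr => b _ /=; rewrite !mxE; ring.
Qed.

(** The Casimir operator is real, so the real part of a solution is a solution. *)
Lemma real_resolvent p (e : C) : real_on_herm p -> 0 < e -> exists s h, [/\ 0 < s, s < e,
  real_on_herm h & eq_herm (casimir h) (Add p (Scale (- s) h))].
Proof.
move=> rp e0; have [s [h [s0 se eh]]] := resolvent p e0.
have h2 : (2^-1 : C)^* = 2^-1 by rewrite fmorphV rmorph_nat.
exists s, (Scale 2^-1 (Add h (bar h))); split => //.
  by move=> W hW /=; rewrite ev_bar // rmorphM rmorphD /= conjCK h2 addrC.
move=> W hW; rewrite ev_casimir_scale ev_casimir_add.
have -> : ev (casimir (bar h)) W = (ev (casimir h) W)^*.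
  rewrite !ev_casimir [LHS]exchange_big rmorph_sum /=; apply: eq_bigr => i _.
  rewrite rmorph_sum; apply: eq_bigr => j _.
  by rewrite ev_der_der_bar // !delta_adj.
rewrite eh //= rmorphD rmorphM rmorphN /= rp // ev_bar //.
rewrite (CrealP _) ?gtr0_real //.
rewrite [LHS](_ : _ = (2^-1 + 2^-1) * ev p W + - s * (2^-1 * (ev h W + (ev h W)^*))).
  by rewrite -[2^-1]div1r -splitr mul1r.
by ring.
Qed.

(** The orbit of A under the unitary group. *)
Definition orb A W := exists2 U, U \is unitarymx & W = U *m A *m U^t*.

Lemma orb_herm A W : herm A -> orb A W -> herm W.
Proof. by move=> hA [U _ ->]; rewrite /herm !trmxC_mul trmxCK hA mulmxA. Qed.

Lemma orb_conj A W V : V \is unitarymx -> orb A W -> orb A (V *m W *m V^t*).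
Proof.
move=> uV [U uU ->]; exists (V *m U); first exact: mul_unitarymx.
by rewrite trmxC_mul !mulmxA.
Qed.

Lemma adjoint_action1 W : 1%:M *m W *m (1%:M)^t* = W.
Proof. by rewrite trmx1 map_mx1 mul1mx mulmx1. Qed.

Lemma orb_refl A : orb A A.
Proof.
exists 1%:M; last by rewrite trmx1 map_mx1 mul1mx mulmx1.
by apply/unitarymxP; rewrite trmx1 map_mx1 mulmx1.
Qed.

Lemma orb_bounded p A : exists B : C, forall W, orb A W -> `|ev p W| <= B.
Proof. by have [B hB] := ev_bounded p A; exists B => W [U uU ->]; apply: hB. Qed.

Lemma minus_antiherm i j : (E i j - E j i)^t* = - (E i j - E j i).
Proof. by rewrite trmxCB !delta_adj opprB. Qed.

Lemma plus_antiherm i j : ('i *: (E i j + E j i))^t* = - ('i *: (E i j + E j i)).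
Proof. by rewrite trmxCZ trmxCD !delta_adj conjCi scaleNr addrC. Qed.

Fixpoint Pow p k := if k is k'.+1 then Mul p (Pow p k') else Cst n 1.

Lemma ev_pow p k W : ev (Pow p k) W = ev p W ^+ k.
Proof. by elim: k => [|k IH] /=; rewrite ?expr0 // exprS IH. Qed.

Lemma ev_der_pow p k X W : ev (der X (Pow p k.+1)) W = k.+1%:R * ev p W ^+ k * ev (der X p) W.
Proof.
elim: k => [|k IH]; first by rewrite /= expr0; ring.
transitivity (ev (der X p) W * ev (Pow p k.+1) W + ev p W * ev (der X (Pow p k.+1)) W).
  by [].
by rewrite IH ev_pow [k.+2%:R]mulrS !exprS; ring.
Qed.

Lemma ev_carre_pow p q k W : ev (carre (Pow p k.+1) q) W = k.+1%:R * ev p W ^+ k * ev (carre p q) W.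
Proof.
rewrite !ev_carre mulrN mulr_sumr; congr (- _); apply: eq_bigr => i _.
rewrite mulr_sumr; apply: eq_bigr => j _.
by rewrite ev_der_pow mulrA.
Qed.

Lemma real_pow p k : real_on_herm p -> real_on_herm (Pow p k).
Proof. by move=> rp W hW; rewrite ev_pow rmorphXn /= rp. Qed.

End Resolvent.

(** * Traces of polynomials in W + B *)

Section TracePolynomials.
Variables (C : numClosedFieldType) (n : nat).
Implicit Types (X W M N B Q V : 'M[C]_n) (P : {poly C}) (d : 'rV[C]_n).
Local Notation E i j := (delta_mx i j : 'M[C]_n).

Definition mpow M k := iter k (mulmx^~ M) (1%:M : 'M[C]_n).

Lemma mpowS M k : mpow M k.+1 = mpow M k *m M. Proof. by []. Qed.

Lemma mpowD M k l : mpow M (k + l) = mpow M k *m mpow M l.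
Proof.
elim: l => [|l IH]; first by rewrite addn0 mulmx1.
by rewrite addnS !mpowS IH mulmxA.
Qed.

(** The (i, j) entry of (W + B) ^ k. *)
Fixpoint entry_pow B k (i j : 'I_n) : polyfun C n :=
  if k is k'.+1 then Sum (index_enum 'I_n) (fun l =>
    Mul (entry_pow B k' i l) (Add (Lin (E j l)) (Cst n (B l j))))
  else Cst n (i == j)%:R.

Lemma mxtrace_delta i j X : \tr (E i j *m X) = X j i.
Proof.
rewrite /mxtrace (bigD1 i) //= mxE (bigD1 j) //= !mxE !eqxx mul1r.
rewrite !big1 ?addr0 // => [k ki|k kj]; last by rewrite mxE (negPf kj) andbF mul0r.
by rewrite mxE big1 // => l _; rewrite mxE (negPf ki) mul0r.
Qed.

Lemma ev_entry_pow B k i j W : ev (entry_pow B k i j) W = mpow (W + B) k i j.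
Proof.
elim: k i j => [|k IH] i j; first by rewrite /= mxE.
rewrite mpowS mxE [LHS]ev_Sum; apply: eq_bigr => l _ /=.
by rewrite IH mxtrace_delta mxE.
Qed.

Lemma ev_der_entry_pow X B k i j W : ev (der X (entry_pow B k.+1 i j)) W =
  (\matrix_(i, j) ev (der X (entry_pow B k i j)) W *m (W + B)
   + mpow (W + B) k *m (X *m W - W *m X)) i j.
Proof.
have e l : \tr ((E j l *m X - X *m E j l) *m W) = (X *m W - W *m X) l j.
  rewrite mulmxBl raddfB /= -mulmxA mxtrace_delta -mulmxA mxtrace_mulC -mulmxA.
  by rewrite mxtrace_delta [RHS]mxE; congr (_ + _); rewrite [RHS]mxE.
rewrite [der _ _]der_Sum ev_Sum mxE mxE [X in _ + X]mxE -big_split; apply: eq_bigr => l _.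
by rewrite /= mxE ev_entry_pow addr0 mxtrace_delta e [X in _ = _ * X + _]mxE.
Qed.

Lemma tr_der_entry_pow X B k a W :
  \tr (\matrix_(i, j) ev (der X (entry_pow B k i j)) W *m mpow (W + B) a)
  = k%:R * \tr (mpow (W + B) (k.-1 + a) *m (X *m W - W *m X)).
Proof.
set M := W + B; elim: k a => [|k IH] a.
  rewrite mul0r (_ : \matrix_(i, j) _ = 0) ?mul0mx ?mxtrace0 //.
  by apply/matrixP => i j; rewrite !mxE.
have -> : \matrix_(i, j) ev (der X (entry_pow B k.+1 i j)) W =
    \matrix_(i, j) ev (der X (entry_pow B k i j)) W *m M
    + mpow M k *m (X *m W - W *m X).
  by apply/matrixP => i j; rewrite mxE ev_der_entry_pow.
rewrite mulmxDl raddfD /= -mulmxA.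
have -> : M *m mpow M a = mpow M a.+1.
  by rewrite -[a.+1]add1n mpowD /mpow /= mul1mx.
rewrite IH [\tr ((_ *m _) *m mpow M a)]mxtrace_mulC mulmxA -mpowD -natr1 mulrDl mul1r.
rewrite [(a + k)%N]addnC; congr (_ + _); case: k {IH} => [|k]; first by rewrite !mul0r.
by rewrite addnS.
Qed.

Definition mxeval P M := \sum_(k < size P) P`_k *: mpow M k.

(** Represents W |-> tr P(W + B). *)
Definition trace_poly B P : polyfun C n := Sum (index_enum 'I_(size P))
  (fun k => Scale P`_k (Sum (index_enum 'I_n) (fun i => entry_pow B k i i))).

Lemma ev_trace_poly B P W : ev (trace_poly B P) W = \tr (mxeval P (W + B)).
Proof.
rewrite ev_Sum /mxeval raddf_sum; apply: eq_bigr => k _ /=.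
by rewrite mxtraceZ ev_Sum; congr (_ * _); apply: eq_bigr => i _; rewrite ev_entry_pow.
Qed.

Definition mxeval_deriv P M := \sum_(k < size P) (P`_k * k%:R) *: mpow M k.-1.

(** By cyclicity of the trace, noncommutativity is invisible to first order. *)
Lemma ev_der_trace_poly B P X W : ev (der X (trace_poly B P)) W =
  \tr (mxeval_deriv P (W + B) *m (X *m W - W *m X)).
Proof.
rewrite der_Sum ev_Sum /mxeval_deriv mulmx_suml raddf_sum; apply: eq_bigr => k _.
rewrite ev_der_Scale der_Sum ev_Sum -scalemxAl [RHS]mxtraceZ -mulrA; congr (_ * _).
have e := tr_der_entry_pow X B k 0 W; rewrite addn0 mulmx1 in e; rewrite -e.
by apply: eq_bigr => i _; rewrite mxE.
Qed.

Lemma mpow_udiag Q d k : Q \is unitarymx -> mpow (udiag Q d) k = udiag Q (\row_i d 0 i ^+ k).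
Proof.
move=> uQ; elim: k => [|k IH].
  rewrite /= -(udiag_const uQ); congr (udiag Q _); apply/rowP => i.
  by rewrite !mxE expr0.
rewrite mpowS IH udiagM //; congr (udiag Q _); apply/rowP => i.
by rewrite !mxE exprSr.
Qed.

Lemma udiag_sum (I : Type) (r : seq I) Q (F : I -> 'rV[C]_n) :
  udiag Q (\sum_(i <- r) F i) = \sum_(i <- r) udiag Q (F i).
Proof. by rewrite /udiag raddf_sum mulmx_sumr mulmx_suml. Qed.

Lemma udiagZ Q a d : udiag Q (a *: d) = a *: udiag Q d.
Proof. by rewrite /udiag linearZ /= -scalemxAr -scalemxAl. Qed.

Lemma mxeval_udiag P Q d : Q \is unitarymx ->
  mxeval P (udiag Q d) = udiag Q (\row_i P.[d 0 i]).
Proof.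
move=> uQ; have -> : \row_i P.[d 0 i] = \sum_(k < size P) P`_k *: \row_i d 0 i ^+ k.
  apply/rowP => i; rewrite mxE horner_coef summxE; apply: eq_bigr => k _.
  by rewrite !mxE.
by rewrite udiag_sum; apply: eq_bigr => k _; rewrite udiagZ mpow_udiag.
Qed.

Lemma horner_deriv_coef P x : P^`().[x] = \sum_(k < size P) P`_k * k%:R * x ^+ k.-1.
Proof.
rewrite -{1}[P]coefK poly_def raddf_sum horner_sum; apply: eq_bigr => k _.
by rewrite /= derivZ derivXn hornerZ hornerMn hornerXn -mulr_natl mulrA.
Qed.

Lemma mxeval_deriv_udiag P Q d : Q \is unitarymx ->
  mxeval_deriv P (udiag Q d) = udiag Q (\row_i P^`().[d 0 i]).
Proof.
move=> uQ; have -> : \row_i P^`().[d 0 i] =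
    \sum_(k < size P) (P`_k * k%:R) *: \row_i d 0 i ^+ k.-1.
  apply/rowP => i; rewrite mxE horner_deriv_coef summxE; apply: eq_bigr => k _.
  by rewrite !mxE.
by rewrite udiag_sum; apply: eq_bigr => k _; rewrite udiagZ mpow_udiag.
Qed.

Lemma mxtrace_udiag Q d : Q \is unitarymx -> \tr (udiag Q d) = \sum_i d 0 i.
Proof.
by move=> /unitarymxP uQ; rewrite /udiag mxtrace_mulC mulmxA uQ mul1mx mxtrace_diag.
Qed.

(** Squared Frobenius norm. *)
Definition frob2 X := \sum_i \sum_j `|X i j| ^+ 2.

Lemma frob2E X : frob2 X = \tr (X *m X^t*).
Proof.
apply: eq_bigr => i _; rewrite mxE; apply: eq_bigr => j _.
by rewrite !mxE normCK.
Qed.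

Lemma frob2_adj X : frob2 (X^t*) = frob2 X.
Proof. by rewrite !frob2E trmxCK mxtrace_mulC. Qed.

Lemma frob2_unitaryl V X : V \is unitarymx -> frob2 (V *m X) = frob2 X.
Proof.
move=> uV; rewrite !frob2E trmxC_mul mxtrace_mulC -!mulmxA [V^t* *m _]mulmxA.
by rewrite unitarymx_adjM // mul1mx mxtrace_mulC.
Qed.

Lemma frob2_unitaryr V X : V \is unitarymx -> frob2 (X *m V) = frob2 X.
Proof.
by move=> uV; rewrite -frob2_adj trmxC_mul frob2_unitaryl ?trmxC_unitary // frob2_adj.
Qed.

Lemma frob2_udiag Q d : Q \is unitarymx -> frob2 (udiag Q d) = \sum_i `|d 0 i| ^+ 2.
Proof.
move=> uQ; rewrite /udiag frob2_unitaryr // frob2_unitaryl ?trmxC_unitary //.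
apply: eq_bigr => i _; rewrite (bigD1 i) //= big1 ?addr0 => [|j ji].
  by rewrite mxE eqxx mulr1n.
by rewrite mxE eq_sym (negPf ji) mulr0n normr0 expr0n.
Qed.

Lemma frob2_udiag_mul Q d X (l : C) : Q \is unitarymx -> (forall k, `|d 0 k| <= l) ->
  frob2 (udiag Q d *m X) <= l ^+ 2 * frob2 X.
Proof.
move=> uQ hd; rewrite /udiag -!mulmxA frob2_unitaryl ?trmxC_unitary // -(frob2_unitaryl X uQ).
rewrite /frob2 mulr_sumr; apply: ler_sum => i _; rewrite mulr_sumr; apply: ler_sum => j _.
rewrite mul_diag_mx !mxE normrM exprMn ler_wpM2r ?exprn_ge0 //.
by rewrite lerXn2r ?nnegrE ?(le_trans _ (hd i)).
Qed.

Lemma frob2_sub X N : frob2 (X - N) <= 2 * (frob2 X + frob2 N).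
Proof.
rewrite /frob2 -big_split mulr_sumr; apply: ler_sum => i _ /=.
rewrite -big_split mulr_sumr; apply: ler_sum => j _ /=.
by rewrite !mxE normB_sqr_le.
Qed.

Lemma frob2_comm Q d N (l : C) : Q \is unitarymx -> herm (udiag Q d) ->
  (forall k, `|d 0 k| <= l) ->
  frob2 (udiag Q d *m N - N *m udiag Q d) <= 4 * l ^+ 2 * frob2 N.
Proof.
move=> uQ hW hd; apply: le_trans (frob2_sub _ _) _.
have h1 := frob2_udiag_mul N uQ hd.
have h2 : frob2 (N *m udiag Q d) <= l ^+ 2 * frob2 N.
  by rewrite -frob2_adj trmxC_mul hW -[X in _ <= _ * X]frob2_adj; exact: frob2_udiag_mul.
rewrite (_ : 4 * l ^+ 2 * frob2 N = 2 * (l ^+ 2 * frob2 N + l ^+ 2 * frob2 N)); last by ring.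
by rewrite ler_pM2l // lerD.
Qed.

(** A Rayleigh quotient is an average of eigenvalues; used to bound the eigenvalues of a
    sum of two matrices. *)
Lemma diag_entry_le (Q V : 'M[C]_n) d (l : C) k : Q \is unitarymx -> V \is unitarymx ->
  (forall k, `|d 0 k| <= l) -> `|(V *m udiag Q d *m V^t*) k k| <= l.
Proof.
move=> uQ uV hd; pose G := V *m Q^t*.
have uG : G \is unitarymx by rewrite mul_unitarymx // trmxC_unitary.
have -> : V *m udiag Q d *m V^t* = G *m diag_mx d *m G^t*.
  by rewrite /G /udiag trmxC_mul trmxCK !mulmxA.
have e : \sum_j `|G k j| ^+ 2 = 1.
  have /unitarymxP/matrixP/(_ k k) := uG; rewrite !mxE eqxx mulr1n => <-.
  by apply: eq_bigr => j _; rewrite !mxE normCK.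
rewrite mxE (le_trans (ler_norm_sum _ _ _)) // -[leRHS]mulr1 -e mulr_sumr.
apply: ler_sum => j _; rewrite mul_mx_diag !mxE !normrM norm_conjC.
by rewrite mulrAC -expr2 mulrC ler_wpM2r ?exprn_ge0.
Qed.

Lemma udiag_diag Q d k : Q \is unitarymx -> (Q *m udiag Q d *m Q^t*) k k = d 0 k.
Proof.
move=> /unitarymxP uQ; rewrite /udiag !mulmxA uQ mul1mx -mulmxA uQ mulmx1.
by rewrite mxE eqxx mulr1n.
Qed.

Lemma orb_udiag A W Q d : orb A W -> Q \is unitarymx -> A = udiag Q d ->
  exists2 V, V \is unitarymx & W = udiag V d.
Proof.
move=> [U uU ->] uQ ->; exists (Q *m U^t*); first by rewrite mul_unitarymx // trmxC_unitary.
by rewrite /udiag trmxC_mul trmxCK !mulmxA.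
Qed.

(** The gradient of tr P(W + B) is the commutator of W and P'(W + B). The operator norm
    of the former is at most l, the squared Frobenius norm of the latter at most n. *)
Lemma carre_trace_poly_le B P W V d Q e (l : C) :
  V \is unitarymx -> W = udiag V d -> herm W -> (forall k, `|d 0 k| <= l) ->
  Q \is unitarymx -> W + B = udiag Q e -> 0 <= l -> (forall k, `|P^`().[e 0 k]| <= 1) ->
  \sum_i \sum_j `|ev (der (E i j) (trace_poly B P)) W| ^+ 2 <= 4 * l ^+ 2 * n%:R.
Proof.
move=> uV eW hW hd uQ eM l0 hP; pose N := mxeval_deriv P (W + B).
have -> : \sum_i \sum_j `|ev (der (E i j) (trace_poly B P)) W| ^+ 2 = frob2 (W *m N - N *m W).
  rewrite /frob2 exchange_big /=; apply: eq_bigr => i _; apply: eq_bigr => j _.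
  congr (`|_| ^+ 2); rewrite ev_der_trace_poly -/N mulmxBr raddfB /= !mulmxA.
  rewrite [\tr (N *m _ *m W)]mxtrace_mulC mulmxA [\tr (W *m N *m _)]mxtrace_mulC mxtrace_delta.
  rewrite [\tr (N *m W *m _)]mxtrace_mulC mxtrace_delta.
  by rewrite !mxE.
rewrite {1 2}eW; apply: le_trans (frob2_comm _ uV _ hd) _; first by rewrite -eW.
rewrite ler_wpM2l //.
  by rewrite mulr_ge0 // exprn_ge0.
rewrite /N eM mxeval_deriv_udiag // frob2_udiag // -[n in n%:R]card_ord -sumr_const.
by apply: ler_sum => k _; rewrite mxE expr_le1.
Qed.

End TracePolynomials.

Local Open Scope classical_set_scope.

(** * Gradient bound for the resolvent *)

Section OneVariable.
Variable R : realType.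
Implicit Types f df : R -> R.

Lemma is_derive_continuous f df (a b : R) :
  (forall t, is_derive t (1 : R) f (df t)) -> {within `[a, b]%classic, continuous f}.
Proof.
by move=> hf; apply: derivable_within_continuous => t _; apply: ex_derive.
Qed.

(** Taylor expansion with a one-sided bound on the remainder; the constants 1/2 and,
    below, 1/6 are not pursued. *)
Lemma taylor1_lower f0 f1 f2 (B t : R) : 0 <= B ->
  (forall t, is_derive t (1 : R) f0 (f1 t)) ->
  (forall t, is_derive t (1 : R) f1 (f2 t)) ->
  (forall t, - B <= f2 t) -> 0 <= t ->
  f0 0 + f1 0 * t - B * t ^+ 2 <= f0 t.
Proof.
move=> B0 d0 d1 hB t0.
have low1 s : 0 <= s -> f1 0 - B * s <= f1 s.
  move=> s0; have [c _] := @MVT_segment R f1 f2 0 s s0 (fun x _ => d1 x)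
    (@is_derive_continuous f1 f2 0 s d1).
  by rewrite subr0 => e; have := hB c; nra.
have [c] := @MVT_segment R f0 f1 0 t t0 (fun x _ => d0 x) (@is_derive_continuous f0 f1 0 t d0).
rewrite in_itv /= subr0 => /andP[c0 ct] e.
have Bct : B * c <= B * t by rewrite ler_wpM2l.
have l : f1 0 - B * t <= f1 c by apply: le_trans (low1 c c0); rewrite lerD2l lerN2.
have := ler_wpM2r t0 l; rewrite -e; lra.
Qed.

Lemma taylor2_lower f0 f1 f2 f3 (B t : R) : 0 <= B ->
  (forall t, is_derive t (1 : R) f0 (f1 t)) ->
  (forall t, is_derive t (1 : R) f1 (f2 t)) ->
  (forall t, is_derive t (1 : R) f2 (f3 t)) ->
  (forall t, - B <= f3 t) -> 0 <= t ->
  f0 0 + f1 0 * t + f2 0 * t ^+ 2 / 2 - B * t ^+ 3 <= f0 t.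
Proof.
move=> B0 d0 d1 d2 hB t0.
have low1 s : 0 <= s -> f1 0 + f2 0 * s - B * s ^+ 2 <= f1 s.
  by move=> s0; apply: (@taylor1_lower f1 f2 f3).
pose g s := f0 s - f2 0 * s ^+ 2 / 2.
pose dg s := f1 s - f2 0 * s.
have hg s : is_derive s (1 : R) g (dg s).
  have hid : is_derive s (1 : R) (id : R -> R) 1 by exact: is_derive_id.
  have hq := is_deriveM (is_derive_cst (f2 0 / 2) s (1 : R)) (is_deriveM hid hid).
  rewrite (_ : g = f0 - cst (f2 0 / 2) * (id * id)); last first.
    by apply/funext => x; rewrite /g -mulrAC expr2.
  apply: is_derive_eq (is_deriveB (d0 s) hq) _.
  by rewrite /dg /GRing.scale /=; lra.
have [c] := @MVT_segment R g dg 0 t t0 (fun x _ => hg x) (@is_derive_continuous g dg 0 t hg).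
rewrite in_itv /= subr0 /g => /andP[c0 ct] e.
have := low1 c c0; rewrite /dg in e => l.
have c2 : c ^+ 2 <= t ^+ 2 by rewrite ler_sqr.
have : (f1 c - f2 0 * c - f1 0 + B * t ^+ 2) * t >= 0.
  rewrite mulr_ge0 //; have := ler_wpM2l B0 c2; lra.
by move=> h; rewrite [t ^+ 3]exprS; lra.
Qed.

End OneVariable.

Section GradientBound.
Variables (R : realType) (n : nat) (A : 'M[R[i]]_n).
Hypothesis hA : herm A.
Local Notation C := R[i].
Implicit Types (X W : 'M[C]_n) (p q h f : polyfun C n) (s t e : R).
Local Notation E i j := (delta_mx i j : 'M[C]_n).

(** Polynomial functions that are real on Hermitian matrices are handled through their
    real part, so that order and suprema are those of R. *)
Definition reval p W : R := complex.Re (ev p W).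

Lemma ler_Re (x y : C) : x <= y -> complex.Re x <= complex.Re y.
Proof. by rewrite lecE => /andP[]. Qed.

Lemma norm_Re (x : C) (b : C) : `|x| <= b -> `|complex.Re x| <= complex.Re b.
Proof. by move=> xb; have := le_trans (normc_ge_Re x) xb => /ler_Re. Qed.

Lemma reval_bounded p : exists2 B : R, 0 <= B & forall W, orb A W -> `|reval p W| <= B.
Proof.
have [B hB] := orb_bounded p A; exists (complex.Re B) => [|W oW].
  exact: le_trans (normr_ge0 _) (norm_Re (hB _ (orb_refl A))).
exact: norm_Re (hB _ oW).
Qed.

Lemma real_reval p W : real_on_herm p -> herm W -> ev p W = (reval p W)%:C%C.
Proof.
move=> rp hW; have := rp W hW; rewrite /reval; case: (ev p W) => x y [] hy.
by apply: complex_eq => //=; lra.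
Qed.

Lemma orbit_curve X W : X^t* = - X -> orb A W -> exists g : R -> 'M[C]_n,
  [/\ g 0 = W, forall t, orb A (g t) &
   forall p t, is_derive t (1 : R) (reval p \o g) (reval (der X p) (g t))].
Proof.
move=> hX oW; have [Q [th [uQ eX]]] := antiherm_cis hX.
pose g t := udiag Q (cis_row th t) *m W *m (udiag Q (cis_row th t))^t*; exists g; split.
- by rewrite /g cis_curve0 // trmx1 map_mx1 mul1mx mulmx1.
- by move=> t; apply: orb_conj; [exact: cis_curve_unitary|exact: oW].
- move=> p t; have hg := mderiv_cis_curve th t uQ; rewrite -eX in hg.
  by have [] := cderiv_ev p W hX hg.
Qed.

Lemma reval_derN p X W : reval (der (- X) p) W = - reval (der X p) W.
Proof. by rewrite /reval ev_derN; case: (ev _ _). Qed.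

(** An approximate maximum principle. Moving by t in the directions X and - X and
    adding the two expansions eliminates the first derivative; the second one is
    bounded by the distance to the maximum over t ^ 2, plus a remainder of order t. *)
Lemma second_derivative_near_max p X t0 : X^t* = - X -> 0 < t0 ->
  exists2 e, 0 < e & forall W s, orb A W -> (forall V, orb A V -> reval p V <= s) ->
    s - e <= reval p W -> reval (der X (der X p)) W <= t0.
Proof.
move=> hX t00; have hNX : (- X)^t* = - - X by rewrite linearN /= map_mxN hX.
have [B1 B10 hB1] := reval_bounded (der X (der X (der X p))).
have [B2 B20 hB2] := reval_bounded (der (- X) (der (- X) (der (- X) p))).
pose B := B1 + B2; have B0 : 0 <= B by rewrite addr_ge0.
pose t := t0 / (4 * (B + 1)).
have t_gt0 : 0 < t by clear - B0 t00; rewrite divr_gt0 // mulr_gt0 //; lra.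
have tB : t * (B + 1) = t0 / 4 by clear - B0; rewrite /t; field; lra.
exists (t0 * t ^+ 2 / 4); first by rewrite divr_gt0 // mulr_gt0 // exprn_gt0.
move=> W s oW hs hW.
have hh : herm W := orb_herm hA oW.
have lower Y : Y^t* = - Y -> (forall V, orb A V -> - B <= reval (der Y (der Y (der Y p))) V) ->
    reval p W + reval (der Y p) W * t + reval (der Y (der Y p)) W * t ^+ 2 / 2 - B * t ^+ 3 <= s.
  move=> hY hB; have [g [g0 og dg]] := orbit_curve hY oW.
  have := @taylor2_lower R (reval p \o g) (reval (der Y p) \o g) (reval (der Y (der Y p)) \o g)
    (reval (der Y (der Y (der Y p))) \o g) B t B0 (dg _) (dg _) (dg _)
    (fun u => hB _ (og u)) (ltW t_gt0).
  by rewrite /= g0 => /le_trans; apply; apply: hs.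
have l1 : reval p W + reval (der X p) W * t +
    reval (der X (der X p)) W * t ^+ 2 / 2 - B * t ^+ 3 <= s.
  apply: lower => // V oV; have := hB1 V oV; rewrite ler_norml => /andP[h _].
  by apply: le_trans h; rewrite lerN2 lerDl.
have l2 : reval p W - reval (der X p) W * t +
    reval (der X (der X p)) W * t ^+ 2 / 2 - B * t ^+ 3 <= s.
  have -> : reval (der X (der X p)) W = reval (der (- X) (der (- X) p)) W.
    rewrite reval_derN /reval -(scaleN1r X) ev_der2Z // mulN1r.
    by case: (ev _ _) => x y /=; rewrite opprK.
  have -> : - (reval (der X p) W * t) = reval (der (- X) p) W * t.
    by rewrite reval_derN mulNr.
  apply: lower => // V oV; have := hB2 V oV; rewrite ler_norml => /andP[h _].
  by apply: le_trans h; rewrite lerN2 lerDr.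
have t2 : 0 < t ^+ 2 by rewrite exprn_gt0.
rewrite -(ler_pM2r t2).
have e3 : B * t ^+ 3 <= t0 / 4 * t ^+ 2.
  rewrite -tB (_ : B * t ^+ 3 = t * B * t ^+ 2); last by ring.
  by clear - t_gt0 t2; rewrite ler_pM2r // ler_pM2l //; lra.
by clear - l1 l2 e3 hW; lra.
Qed.

Lemma uniform_pos (I : finType) (P : I -> R -> Prop) :
  (forall i e e', P i e -> e' <= e -> P i e') ->
  (forall i, exists2 e, 0 < e & P i e) -> exists2 e, 0 < e & forall i, P i e.
Proof.
move=> mono hP.
have /choice[f hf] i : exists e, 0 < e /\ P i e by have [e ? ?] := hP i; exists e.
exists (\big[Num.min/1]_i f i).
  by apply: lt_bigmin => // i _; have [] := hf i.
move=> i; have [_ h] := hf i; apply: mono h _; exact: bigmin_le.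
Qed.

(** Minus the Laplacian is almost nonnegative where a function is almost maximal. An
    almost maximal point is used, so that compactness of the orbit is not needed. *)
Lemma casimir_near_max p t0 : 0 < t0 ->
  exists2 e, 0 < e & forall W s, orb A W -> (forall V, orb A V -> reval p V <= s) ->
    s - e <= reval p W -> - t0 <= reval (casimir p) W.
Proof.
move=> t00; pose d := t0 / (n * n).+1%:R.
have d0 : 0 < d by rewrite divr_gt0 // ltr0n.
pose Xb (b : bool) (k : 'I_n * 'I_n) : 'M[C]_n :=
  if b then E k.1 k.2 - E k.2 k.1 else 'i *: (E k.1 k.2 + E k.2 k.1).
have hXb b k : (Xb b k)^t* = - Xb b k.
  by case: b; [exact: minus_antiherm|exact: plus_antiherm].
have [e e0 he] := @uniform_pos (bool * ('I_n * 'I_n))%type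
  (fun k e => forall W s, orb A W -> (forall V, orb A V -> reval p V <= s) ->
    s - e <= reval p W -> reval (der (Xb k.1 k.2) (der (Xb k.1 k.2) p)) W <= d)
  (fun k e e' k0 ee' W s oW hs hW => k0 W s oW hs (le_trans (lerB (lexx s) ee') hW))
  (fun k => second_derivative_near_max p (hXb k.1 k.2) d0).
exists e => // W s oW hs hW.
have hh : herm W := orb_herm hA oW.
have /(congr1 (@complex.Re R)) := ev_casimir_squares p hh.
have -> : complex.Re (- 4 * ev (casimir p) W) = - 4 * reval (casimir p) W.
  by rewrite cReM /= /reval; clear; lra.
have ReSum (I : finType) (F : I -> C) :
    complex.Re (\sum_i F i) = \sum_i complex.Re (F i).
  by apply: (big_morph (@complex.Re R)) => // x y; exact: cReD.
rewrite ReSum; under eq_bigr do rewrite ReSum.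
set S := \sum_i _ => eS.
have : S <= \sum_(i < n) \sum_(j < n) (2 * d).
  apply: ler_sum => i _; apply: ler_sum => j _; rewrite cReD.
  have h1 := he (true, (i, j)) W s oW hs hW.
  have h2 := he (false, (i, j)) W s oW hs hW.
  by rewrite /= /reval in h1 h2; clear - h1 h2; lra.
rewrite !sumr_const !card_ord -mulrnA -mulr_natl.
have dn : d * (n * n).+1%:R = t0 by rewrite /d divfK // pnatr_eq0.
rewrite -natr1 mulrDr mulr1 in dn.
by move=> hS; clear - eS hS dn d0 t00; lra.
Qed.

Hypothesis n_gt0 : (0 < n)%N.

Lemma cReZ (a : R) (z : C) : complex.Re (a%:C%C * z) = a * complex.Re z.
Proof. by case: z => x y /=; rewrite mul0r subr0. Qed.

Lemma reval_carre_ge0 p W : real_on_herm p -> herm W -> 0 <= reval (carre p p) W.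
Proof. by move=> rp hW; have /ler_Re := ev_carre_ge0 rp hW. Qed.

(** Expand carre (a h - f) (a h - f) >= 0 with a = n / 2. *)
Lemma carre_young h f W : real_on_herm h -> real_on_herm f -> herm W ->
  reval (carre h f) W <= n%:R / 4 * reval (carre h h) W + n%:R^-1 * reval (carre f f) W.
Proof.
move=> rh rf hW; have n0 : (0 : R) < n%:R by rewrite ltr0n.
pose a : C := (n%:R / 2)%:C%C.
have ra : a^* = a by exact: conjc_real.
have rm : (-1 : C)^* = -1 by rewrite rmorphN rmorph1.
have := reval_carre_ge0 (real_add (real_scale ra rh) (real_scale rm rf)) hW.
rewrite /reval ev_carre_sub.
have -> : a ^+ 2 = (n%:R ^+ 2 / 4)%:C%C.
  by rewrite -rmorphXn /=; congr (_%:C%C); field.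
have -> : 2 * a = (n%:R : R)%:C%C.
  rewrite (_ : 2 = (2 : R)%:C%C); last by rewrite rmorph_nat.
  by rewrite -rmorphM /=; congr (_%:C%C); field.
have ReN (z : C) : complex.Re (- z) = - complex.Re z by case: z.
rewrite !cReD ReN !cReZ -!/(reval _ _) => gy.
rewrite -(ler_pM2l n0) mulrDr mulrA [_ * (_ * reval (carre f f) W)]mulrA divff ?gt_eqF //.
rewrite mul1r; move: gy; rewrite /reval.
set x := complex.Re _; set y := complex.Re _; set z := complex.Re _.
move=> gy; have -> : n%:R * (n%:R / 4) * x = n%:R ^+ 2 / 4 * x by field.
move: gy; clear; lra.
Qed.

(** Where carre h h is almost maximal its Casimir image is almost nonnegative. Combined
    with the Bochner formula and the curvature bound this gives, up to a small error,
    n / 2 carre h h <= carre h f <= n / 4 carre h h + carre f f / n, the last step by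
    carre_young. The bound does not depend on s. *)
Theorem gradient_bound h f s v : 0 <= s -> real_on_herm h -> real_on_herm f ->
  eq_herm (casimir h) (Add f (Scale (- s%:C%C) h)) ->
  (forall W, orb A W -> reval (carre f f) W <= v) ->
  forall W, orb A W -> reval (carre h h) W <= 4 * v / n%:R ^+ 2.
Proof.
move=> s0 rh rf eh hv; have n0 : (0 : R) < n%:R by rewrite ltr0n.
pose F := [set reval (carre h h) W | W in orb A].
have supF : has_sup F.
  split; first by exists (reval (carre h h) A), A => //; exact: orb_refl.
  have [B _ hB] := reval_bounded (carre h h); exists B => _ [W oW <-].
  exact: le_trans (ler_norm _) (hB _ oW).
have leF W : orb A W -> reval (carre h h) W <= sup F.
  by move=> oW; apply: sup_upper_bound => //; exists W.
suff supv : sup F <= 4 * v / n%:R ^+ 2.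
  by move=> W oW; exact: le_trans (leF W oW) supv.
apply/ler_addgt0Pr => e e0.
have d0 : 0 < e * n%:R / 4 by rewrite divr_gt0 // mulr_gt0.
have [e1 e10 he1] := casimir_near_max (carre h h) d0.
pose e2 := Num.min e1 (e / 2).
have e20 : 0 < e2 by rewrite lt_min e10 divr_gt0.
have [_ [W oW <-] hW] := sup_adherent e20 supF.
have e2e1 : e2 <= e1 by rewrite ge_min lexx.
have e2e : e2 <= e / 2 by rewrite ge_min lexx orbT.
have hh := orb_herm hA oW.
have := he1 W (sup F) oW leF; have hW1 : sup F - e1 <= reval (carre h h) W by clear - hW e2e1; lra.
move=> /(_ hW1).
have := bochner rh hh; rewrite (ev_carre_casimir hh eh).
move=> /(congr1 (@complex.Re R)).
have ReN (z : C) : complex.Re (- z) = - complex.Re z by case: z.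
rewrite (_ : 2 = (2 : R)%:C%C); last by rewrite rmorph_nat.
rewrite cReD ReN !cReZ cReD ReN cReZ -!/(reval _ _) => eB hcas.
have := ler_Re (hessian_ge rh hh).
rewrite (_ : 2 = (2 : R)%:C%C); last by rewrite rmorph_nat.
rewrite (_ : n%:R = (n%:R : R)%:C%C); last by rewrite rmorph_nat.
rewrite !cReZ -!/(reval _ _) => hH.
have yg := carre_young rh rf hh.
have hvW : n%:R^-1 * reval (carre f f) W <= n%:R^-1 * v by rewrite ler_pM2l ?invr_gt0 // hv.
have sg : 0 <= s * reval (carre h h) W by rewrite mulr_ge0 // reval_carre_ge0.
have key : n%:R / 4 * reval (carre h h) W <= n%:R^-1 * v + e * n%:R / 8.
  by clear - hvW sg yg hH eB hcas; lra.
have key2 : reval (carre h h) W <= 4 * v / n%:R ^+ 2 + e / 2.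
  have n4 : 0 < n%:R / 4 :> R by rewrite divr_gt0.
  rewrite -(ler_pM2l n4); apply: le_trans key _.
  by rewrite le_eqVlt; apply/orP; left; apply/eqP; field; exact: lt0r_neq0.
by clear - key2 hW e2e; lra.
Qed.

End GradientBound.

(** * Moments under an invariant mean *)

Section DerNorm.
Variables (C : numClosedFieldType) (n : nat).
Implicit Types (X W : 'M[C]_n) (h : polyfun C n).

Lemma norm_le_sqr (x : C) : `|x| <= 1 + `|x| ^+ 2.
Proof.
rewrite -subr_ge0 (_ : _ - _ = (`|x| - 2^-1) ^+ 2 + 3 / 4); last by field.
by rewrite addr_ge0 ?divr_ge0 // real_exprn_even_ge0 // rpredB ?normr_real.
Qed.

(** The bound by 1 + carre h h instead of its square root is crude, but only uniformity
    in h matters. *)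
Lemma der_norm_le h X W (B : C) : real_on_herm h -> herm W -> (forall i j, `|X i j| <= B) ->
  `|ev (der X h) W| <= \sum_(i < n) \sum_(j < n) B * (1 + ev (carre h h) W).
Proof.
move=> rh hW hB; rewrite {1}(matrix_sum_delta X) ev_der_sum.
rewrite (le_trans (ler_norm_sum _ _ _)) //; apply: ler_sum => i _.
rewrite ev_der_sum (le_trans (ler_norm_sum _ _ _)) //; apply: ler_sum => j _.
rewrite ev_derZ normrM ler_pM //.
rewrite (le_trans (norm_le_sqr _)) // lerD2l ev_carre_norm //.
rewrite (bigD1 i) //= (bigD1 j) //= -addrA lerDl addr_ge0 ?sumr_ge0 // => k _.
by rewrite sumr_ge0 // => l _; rewrite exprn_ge0.
Qed.

End DerNorm.

Section Moments.
Variables (R : realType) (n : nat) (A : 'M[R[i]]_n).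
Hypothesis hA : herm A.
Hypothesis n_gt0 : (0 < n)%N.
Local Notation C := R[i].
Implicit Types (X W : 'M[C]_n) (p q h f : polyfun C n).

(** Join a point of the orbit to A by a one-parameter group and apply the mean value
    theorem. The constant depends on n, which is harmless: the bound is only used to
    let the resolvent parameter s tend to 0. *)
Lemma oscillation : exists2 K : R, 0 <= K & forall h v, real_on_herm h ->
  (forall W, orb A W -> reval (carre h h) W <= v) ->
  forall W, orb A W -> `|reval h W - reval h A| <= K * (1 + v).
Proof.
pose B : R := n%:R * pi; have B0 : 0 <= B by rewrite mulr_ge0 // pi_ge0.
exists (n%:R * (n%:R * B)) => [|h v rh hv W [V uV ->]].
  by apply: mulr_ge0; [exact: ler0n|apply: mulr_ge0; [exact: ler0n|exact: B0]].
have [Q [th [uQ hth eV]]] := unitary_cis uV.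
pose X := udiag Q (cis_gen th).
have hX : X^t* = - X := cis_gen_adj Q th.
pose g t := udiag Q (cis_row th t) *m A *m (udiag Q (cis_row th t))^t*.
have og t : orb A (g t) by exists (udiag Q (cis_row th t)); [exact: cis_curve_unitary|].
have g0 : g 0 = A by rewrite /g cis_curve0 // trmx1 map_mx1 mul1mx mulmx1.
have dg t : is_derive t (1 : R) (reval h \o g) (reval (der X h) (g t)).
  by have [] := cderiv_ev h A hX (mderiv_cis_curve th t uQ).
have [c _] := @MVT_segment R (reval h \o g) (reval (der X h) \o g) 0 1 ler01
  (fun t _ => dg t) (@is_derive_continuous R _ (reval (der X h) \o g) 0 1 dg).
rewrite subr0 mulr1 /= g0 {1}/g -eV => ->.
have hXij i j : `|X i j| <= B%:C%C.
  apply: le_trans (udiag_entry_le _ _ _ uQ) _.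
  apply: (@le_trans _ _ (\sum_(k < n) (pi : R)%:C%C)).
    apply: ler_sum => k _; rewrite mxE normc_def /= expr0n /= add0r sqrtr_sqr.
    by rewrite lecR.
  by rewrite sumr_const card_ord -rmorphMn /= lecR /B mulr_natl.
have hh := orb_herm hA (og c).
have := norm_Re (der_norm_le rh hh hXij); rewrite -/(reval _ _) => /le_trans; apply.
have sc (z : C) : \sum_(i < n) z = (n%:R : R)%:C%C * z.
  by rewrite sumr_const card_ord rmorph_nat mulr_natl.
rewrite !sc !cReZ cReD /=.
rewrite -/(reval (carre h h) (g c)) -!mulrA.
do 2![apply: ler_wpM2l; first exact: ler0n].
by rewrite !ler_wpM2l ?ler0n ?pi_ge0 ?lerD2l ?hv.
Qed.

(** The properties of integration over the orbit used below: a positive normalized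
    real-linear functional that kills derivatives. *)
Record invariant_state (Ex : polyfun C n -> R) : Prop := InvariantState {
  state1 : Ex (Cst n 1) = 1;
  stateD : forall p q, Ex (Add p q) = Ex p + Ex q;
  stateZ : forall (a : R) p, Ex (Scale a%:C%C p) = a * Ex p;
  state_le : forall p q, (forall W, orb A W -> reval p W <= reval q W) -> Ex p <= Ex q;
  state_der : forall X p, X^t* = - X -> Ex (der X p) = 0
}.

Variable Ex : polyfun C n -> R.
Hypothesis sE : invariant_state Ex.

Lemma state_eq p q : (forall W, orb A W -> reval p W = reval q W) -> Ex p = Ex q.
Proof.
move=> pq; apply/eqP; rewrite eq_le !(state_le sE) // => W oW; by rewrite pq.
Qed.

Lemma state_eqH p q : eq_herm p q -> Ex p = Ex q.
Proof. by move=> pq; apply: state_eq => W /(orb_herm hA) hW; rewrite /reval pq. Qed.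

Lemma state_cst (a : R) : Ex (Cst n a%:C%C) = a.
Proof.
rewrite -[RHS]mulr1 -(state1 sE) -(stateZ sE); apply: state_eq => W _.
by congr (complex.Re _); exact: (esym (mulr1 _)).
Qed.

Lemma state_der_any X p : Ex (der X p) = 0.
Proof.
have [Y [Z [hY hZ ->]]] := antiherm_split X.
rewrite -[RHS]addr0 -{1}(state_der sE p hY) -(state_der sE (Scale 'i p) hZ).
rewrite -(stateD sE); apply: state_eqH => W _.
by rewrite ev_derD ev_derZ [ev (Add _ _) W]/= mul0r add0r.
Qed.

Lemma state_Sum (I : Type) (r : seq I) (F : I -> polyfun C n) :
  Ex (Sum r F) = \sum_(i <- r) Ex (F i).
Proof.
rewrite /Sum; elim: r => [|i r IH]; first by rewrite !big_nil -[0]/(0 : R)%:C%C state_cst.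
by rewrite !big_cons (stateD sE) IH.
Qed.

(** Integration by parts: the difference is a sum of derivatives. *)
Lemma state_parts p q : Ex (Mul p (casimir q)) = Ex (carre p q).
Proof.
pose G := Sum (index_enum 'I_n) (fun i => Sum (index_enum 'I_n)
  (fun j => der (delta_mx i j) (Mul p (der (delta_mx j i) q)))).
have G0 : Ex G = 0.
  by rewrite /G state_Sum big1 // => i _; rewrite state_Sum big1 // => j _; exact: state_der_any.
rewrite -[LHS]subr0 -G0 -mulN1r -(stateZ sE) -(stateD sE); apply: state_eqH => W _.
rewrite [LHS]/= -/(ev (casimir q) W) -/(ev G W) ev_casimir /G ev_Sum ev_carre.
rewrite (_ : (-1 : R)%:C%C = -1); last by rewrite rmorphN1.
rewrite mulN1r mulr_sumr -!sumrN -big_split; apply: eq_bigr => i _ /=.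
by rewrite ev_Sum mulr_sumr -!sumrN -big_split; apply: eq_bigr => j _ /=; ring.
Qed.

Lemma reval_mul p q W : real_on_herm p -> herm W -> reval (Mul p q) W = reval p W * reval q W.
Proof. by move=> rp hW; rewrite {1}/reval /= (real_reval rp hW) cReZ. Qed.

Lemma reval_pow p k W : real_on_herm p -> herm W -> reval (Pow p k) W = reval p W ^+ k.
Proof.
move=> rp hW; elim: k => [|k IH]; first by [].
by rewrite exprS -IH -reval_mul.
Qed.

(** Write f = casimir h + s h, with h from the resolvent equation. Integration by parts
    gives Ex (f ^ (2k+1) casimir h) = (2k+1) Ex (f ^ (2k) carre f h), and carre f h is at most
    2 v / n by the gradient bound. The term with s h is arbitrarily small since h is
    bounded uniformly in s. *)
Lemma moment_step f v k : real_on_herm f -> Ex f = 0 ->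
  (forall W, orb A W -> reval (carre f f) W <= v) ->
  Ex (Pow f k.+1.*2) <= k.*2.+1%:R * (2 * v / n%:R) * Ex (Pow f k.*2).
Proof.
move=> rf f0 hv; set m := k.*2.
have n0 : (0 : R) < n%:R by rewrite ltr0n.
apply/ler_addgt0Pr => d d0.
have [K K0 hK] := oscillation.
have [F F0 hF] := reval_bounded A f.
have v0 : 0 <= v by apply: le_trans (hv A (orb_refl A)); exact: reval_carre_ge0 rf hA.
pose D := K * (1 + 4 * v / n%:R ^+ 2).
have D0 : 0 <= D.
  by rewrite mulr_ge0 // addr_ge0 // divr_ge0 ?mulr_ge0 // exprn_ge0 // ltW.
(* chosen so that s < e makes s Ex (f ^ (2k+1) h) at most d *)
pose e := d / (F ^+ m.+1 * (2 * D) + 1).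
have Fe : 0 < F ^+ m.+1 * (2 * D) + 1 by rewrite ltr_wpDl // mulr_ge0 ?exprn_ge0 // mulr_ge0.
have e0 : 0 < e by rewrite divr_gt0.
have e0C : 0 < e%:C%C by rewrite ltcR.
have [sc [h [s0 se rh eh]]] := real_resolvent rf e0C.
have [s es] : exists s : R, sc = s%:C%C.
  by exists (complex.Re sc); rewrite RRe_real // gtr0_real.
rewrite es in s0 se eh; rewrite !ltcR in s0 se; clear sc es.
have gb := gradient_bound hA n_gt0 (ltW s0) rh rf eh hv.
have osc := hK h _ rh gb; rewrite -/D in osc.
have ecas : Ex (casimir h) = 0.
  have := state_parts (Cst n 1) h.
  have -> : Ex (Mul (Cst n 1) (casimir h)) = Ex (casimir h).
    by apply: state_eqH => W _ /=; rewrite mul1r.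
  move=> ->; rewrite -[RHS](state_cst 0); apply: state_eqH => W _.
  by rewrite ev_carre_cst.
have Eh : Ex h = 0.
  have := ecas; rewrite (state_eqH eh) (stateD sE) f0 add0r.
  rewrite -rmorphN (stateZ sE) => /eqP; rewrite mulf_eq0 oppr_eq0 gt_eqF //=.
  by move/eqP.
(* Ex h = 0, so the value of h at A is at most its oscillation. *)
have hA0 : `|reval h A| <= D.
  have bound (a : R) : (forall W, orb A W -> a * reval h W <= a * reval h A + D) ->
      0 <= a * reval h A + D.
    move=> ha; rewrite -(state_cst (a * reval h A + D)) -[X in X <= _](mulr0 a) -Eh -(stateZ sE).
    by apply: (state_le sE) => W oW; rewrite /reval /= cReZ; exact: ha.
  rewrite ler_norml; apply/andP; split.
    rewrite -subr_ge0 opprK -[reval h A]mul1r; apply: bound => W oW; rewrite !mul1r -lerBlDl.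
    exact: le_trans (ler_norm _) (osc W oW).
  rewrite -subr_ge0 addrC -mulN1r; apply: bound => W oW; rewrite !mulN1r -lerBlDl opprK addrC.
  by apply: le_trans (osc W oW); rewrite distrC ler_norm.
have hh W : orb A W -> `|reval h W| <= 2 * D.
  move=> oW; rewrite -[reval h W](subrK (reval h A)).
  apply: le_trans (ler_normD _ _) _; rewrite mulrDl mul1r lerD //; exact: osc.
have -> : Ex (Pow f k.+1.*2) = Ex (Mul (Pow f m.+1) (casimir h)) + s * Ex (Mul (Pow f m.+1) h).
  rewrite -(stateZ sE) -(stateD sE); apply: state_eqH => W hW.
  rewrite doubleS -/m; transitivity (ev f W * ev (Pow f m.+1) W); first by [].
  transitivity (ev (Pow f m.+1) W * ev (casimir h) W +
    s%:C%C * (ev (Pow f m.+1) W * ev h W)); last by [].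
  have -> : ev (casimir h) W = ev f W + - s%:C%C * ev h W by rewrite eh.
  by move: (ev (Pow _ _) W) (ev f W) (ev h W) => x y z; ring.
have E2 : s * Ex (Mul (Pow f m.+1) h) <= d.
  have b : Ex (Mul (Pow f m.+1) h) <= F ^+ m.+1 * (2 * D).
    rewrite -[leRHS]state_cst; apply: (state_le sE) => W oW.
    have hW := orb_herm hA oW.
    rewrite reval_mul ?reval_pow //; last exact: real_pow.
    rewrite /reval /=; apply: le_trans (ler_norm _) _.
    by rewrite normrM normrX ler_pM ?exprn_ge0 ?normr_ge0 ?lerXn2r ?nnegrE ?hF ?hh.
  apply: (@le_trans _ _ (s * (F ^+ m.+1 * (2 * D) + 1))).
    by rewrite ler_pM2l // (le_trans b) // lerDl.
  by rewrite -ler_pdivlMr //; exact: ltW.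
apply: lerD E2.
rewrite state_parts -(stateZ sE); apply: (state_le sE) => W oW.
have hW := orb_herm hA oW.
have -> : reval (Scale (m.+1%:R * (2 * v / n%:R))%:C%C (Pow f m)) W =
    m.+1%:R * (2 * v / n%:R) * reval f W ^+ m.
  by rewrite -reval_pow // {1}/reval -cReZ.
rewrite {1}/reval ev_carre_pow (real_reval rf hW) -rmorphXn.
rewrite (_ : (m.+1)%:R = (m.+1%:R : R)%:C%C); last by rewrite rmorph_nat.
rewrite -mulrA !cReZ.
have P0 : 0 <= reval f W ^+ m by rewrite /m -muln2 exprM exprn_even_ge0.
rewrite -mulrA ler_pM2l ?ltr0n // mulrC ler_wpM2r //.
rewrite ev_gamC -/(reval (carre h f) W).
apply: le_trans (carre_young n_gt0 rh rf hW) _.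
have g1 := gb W oW; have g2 := hv W oW.
apply: (@le_trans _ _ (n%:R / 4 * (4 * v / n%:R ^+ 2) + n%:R^-1 * v)).
  by rewrite lerD // ler_wpM2l // ?divr_ge0 ?invr_ge0 // ler0n.
by rewrite le_eqVlt; apply/orP; left; apply/eqP; field; exact: lt0r_neq0.
Qed.

(** Gaussian-type moment growth: iterate moment_step, bounding each factor 2j + 1 by
    2k. The exponent k is tuned to the size of the union bound later. *)
Theorem moment_bound f v k : real_on_herm f -> Ex f = 0 ->
  (forall W, orb A W -> reval (carre f f) W <= v) ->
  Ex (Pow f k.*2) <= (k.*2%:R * (2 * v / n%:R)) ^+ k.
Proof.
move=> rf f0 hv; have n0 : (0 : R) < n%:R by rewrite ltr0n.
have v0 : 0 <= v by apply: le_trans (hv A (orb_refl A)); exact: reval_carre_ge0 rf hA.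
have b0 : 0 <= 2 * v / n%:R by rewrite divr_ge0 ?mulr_ge0 // ltW.
suff H j : (j <= k)%N -> Ex (Pow f j.*2) <= (k.*2%:R * (2 * v / n%:R)) ^+ j by exact: H.
elim: j => [|j IH] jk; first by rewrite expr0 (state1 sE).
apply: le_trans (moment_step _ rf f0 hv) _; rewrite exprS.
have pos : 0 <= Ex (Pow f j.*2).
  rewrite -(state_cst 0); apply: (state_le sE) => W oW.
  rewrite (reval_pow _ rf (orb_herm hA oW)) /reval /= -muln2 exprM.
  by rewrite exprn_even_ge0.
apply: ler_pM => //; first by rewrite mulr_ge0.
  by rewrite ler_wpM2r // ler_nat ltn_double.
exact: IH (ltnW jk).
Qed.

End Moments.

(** * Linear statistics of the eigenvalues *)

Section LinearStatistics.
Variables (R : realType) (n : nat) (L : R) (A B : 'M[R[i]]_n).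
Hypotheses (hA : herm A) (hB : herm B) (L_ge0 : 0 <= L).
Hypotheses (sA : spectrum_within L A) (sB : spectrum_within L B).
Local Notation C := R[i].
Implicit Types (X W : 'M[C]_n) (P : {poly R}).

Definition eigs X (i : 'I_n) : R := complex.Re (spectral_diag X 0 i).

Lemma herm_udiag_real X : herm X -> exists2 Q, Q \is unitarymx &
  X = udiag Q (\row_i (eigs X i)%:C%C) /\ forall i, spectral_diag X 0 i = (eigs X i)%:C%C.
Proof.
move=> hX; have hs : X \is hermsymmx by apply/hermsymmxP.
exists (spectralmx X); first exact: spectral_unitarymx.
have /mxOverP re := hermitian_spectral_diag_real hs.
have e i : spectral_diag X 0 i = (eigs X i)%:C%C by rewrite RRe_real.
split=> //; rewrite {1}(normal_udiag (hermitian_normalmx hs)).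
by congr (udiag _ _); apply/rowP => i; rewrite mxE e.
Qed.

Lemma udiag_eigenvalue (Q : 'M[C]_n) d k : Q \is unitarymx -> eigenvalue (udiag Q d) (d 0 k).
Proof.
move=> uQ; apply/eigenvalueP; exists (row k Q).
  rewrite /udiag !mulmxA -row_mul (unitarymxP uQ) row1 -rowE -row_mul mul_diag_mx.
  by apply/rowP => j; rewrite !mxE.
apply/eqP => r0; have /unitarymxP/matrixP/(_ k k) := uQ.
rewrite !mxE eqxx mulr1n big1 => [/eqP|j _]; first by rewrite eq_sym oner_eq0.
by move/rowP: r0 => /(_ j); rewrite !mxE => ->; rewrite mul0r.
Qed.

Lemma eigs_within X i : herm X -> spectrum_within L X -> `|eigs X i| <= L.
Proof.
move=> hX sX; have [Q uQ [eX _]] := herm_udiag_real hX.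
have := @udiag_eigenvalue Q (\row_i (eigs X i)%:C%C) i uQ; rewrite -eX mxE => /sX.
by rewrite -rmorphN /= !lecR -ler_norml.
Qed.

Lemma norm_real (x : R) : `|x%:C%C : C| = `|x|%:C%C.
Proof. by rewrite normc_def /= expr0n addr0 sqrtr_sqr. Qed.

Lemma herm_add X W : herm X -> herm W -> herm (X + W).
Proof. by move=> hX hW; rewrite /herm trmxCD hX hW. Qed.

Lemma eigs_sum W i : orb A W -> `|eigs (W + B) i| <= 2 * L.
Proof.
move=> oW; have hW := orb_herm hA oW.
have [QA uA [eA _]] := herm_udiag_real hA.
have [QB uB [eB _]] := herm_udiag_real hB.
have [V uV eW] := orb_udiag oW uA eA.
have [Q uQ [eM _]] := herm_udiag_real (herm_add hW hB).
rewrite -lecR -norm_real.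
have := udiag_diag (\row_i (eigs (W + B) i)%:C%C) i uQ; rewrite -eM [RHS]mxE => <-.
rewrite mulmxDr mulmxDl mxE (le_trans (ler_normD _ _)) // mulrDl mul1r rmorphD /=.
rewrite {1}eW {1}eB; apply: lerD; apply: diag_entry_le => // k; rewrite mxE norm_real lecR.
  exact: eigs_within.
exact: eigs_within.
Qed.

Definition complexify P : {poly C} := map_poly (real_complex R) P.

Lemma toC_horner P (x : R) : (complexify P).[x%:C%C] = (P.[x])%:C%C.
Proof. by rewrite /complexify horner_map. Qed.

Lemma ev_trace_poly_real P W : herm W ->
  ev (trace_poly B (complexify P)) W = (\sum_i P.[eigs (W + B) i])%:C%C.
Proof.
move=> hW; have [Q uQ [eM _]] := herm_udiag_real (herm_add hW hB).
rewrite ev_trace_poly {1}eM mxeval_udiag // mxtrace_udiag // rmorph_sum; apply: eq_bigr => i _.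
by rewrite !mxE toC_horner.
Qed.

(** The normalized trace of P(W + B), recentred by m. *)
Definition linstat P (m : R) : polyfun C n :=
  Add (Scale (n%:R^-1)%:C%C (trace_poly B (complexify P))) (Cst n (- m)%:C%C).

Lemma reval_linstat P m W : orb A W ->
  reval (linstat P m) W = n%:R^-1 * (\sum_i P.[eigs (W + B) i]) - m.
Proof.
move=> /(orb_herm hA) hW; rewrite /reval.
have -> : ev (linstat P m) W = (n%:R^-1 * (\sum_i P.[eigs (W + B) i]) - m)%:C%C.
  by rewrite rmorphD rmorphM /= -(ev_trace_poly_real _ hW).
by [].
Qed.

Lemma real_trace_poly P : real_on_herm (trace_poly B (complexify P)).
Proof. by move=> W hW; rewrite ev_trace_poly_real //; exact: conjc_real. Qed.

Lemma real_linstat P m : real_on_herm (linstat P m).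
Proof.
apply: real_add; first by apply: real_scale (@real_trace_poly P); exact: conjc_real.
by move=> W _; exact: conjc_real.
Qed.

Lemma carre_linstat P m W : (0 < n)%N ->
  (forall x, `|x| <= 2 * L -> `|P^`().[x]| <= 1) -> orb A W ->
  reval (carre (linstat P m) (linstat P m)) W <= 4 * L ^+ 2 / n%:R.
Proof.
move=> n0 hP oW; have hW := orb_herm hA oW.
have n0R : (0 : R) < n%:R by rewrite ltr0n.
have [QA uA [eA _]] := herm_udiag_real hA.
have [V uV eW] := orb_udiag oW uA eA.
have [Q uQ [eM _]] := herm_udiag_real (herm_add hW hB).
have LC : 0 <= L%:C%C by rewrite lecR.
have h1 k : `|(\row_i (eigs A i)%:C%C : 'rV[C]_n) 0 k| <= L%:C%C.
  by rewrite mxE norm_real lecR; exact: eigs_within.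
have h2 k : `|(complexify P)^`().[(\row_i (eigs (W + B) i)%:C%C : 'rV[C]_n) 0 k]| <= 1.
  by rewrite mxE deriv_map horner_map norm_real lecR hP // eigs_sum.
have := carre_trace_poly_le uV eW hW h1 uQ eM LC h2.
rewrite -(ev_carre_norm (@real_trace_poly P) hW) => /ler_Re.
have -> : complex.Re (4 * L%:C%C ^+ 2 * n%:R) = 4 * L ^+ 2 * n%:R :> R.
  rewrite -[4](rmorph_nat (real_complex R)) -[n%:R](rmorph_nat (real_complex R)).
  by rewrite -rmorphXn -!rmorphM.
rewrite -/(reval _ _) => h.
have -> : reval (carre (linstat P m) (linstat P m)) W =
    n%:R^-1 ^+ 2 * reval (carre (trace_poly B (complexify P)) (trace_poly B (complexify P))) W.
  rewrite /reval -cReZ; congr complex.Re; rewrite !ev_carre mulrN rmorphXn; congr (- _).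
  rewrite mulr_sumr; apply: eq_bigr => i _; rewrite mulr_sumr; apply: eq_bigr => j _.
  have e X : ev (der X (linstat P m)) W =
      (n%:R^-1)%:C%C * ev (der X (trace_poly B (complexify P))) W.
    by rewrite /linstat /= mul0r add0r addr0.
  by rewrite !e; ring.
apply: (@le_trans _ _ (n%:R^-1 ^+ 2 * (4 * L ^+ 2 * n%:R))).
  by apply: ler_wpM2l h; rewrite exprn_ge0 // invr_ge0 ler0n.
by rewrite le_eqVlt; apply/orP; left; apply/eqP; field; exact: lt0r_neq0.
Qed.

(** The gradient of a linear statistic of a 1-Lipschitz function has squared norm at most
    4 L ^ 2 / n, so its fluctuations are of order L / n; the eigenvalues repel and
    fluctuate far less than n independent points would. *)
Theorem linstat_moment (Ex : polyfun C n -> R) P k : (0 < n)%N ->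
  invariant_state A Ex -> (forall x, `|x| <= 2 * L -> `|P^`().[x]| <= 1) ->
  Ex (Pow (linstat P (Ex (linstat P 0))) k.*2) <= (k.*2%:R * (8 * L ^+ 2 / n%:R ^+ 2)) ^+ k.
Proof.
move=> n0 sE hP; set m := Ex (linstat P 0).
have n0R : (0 : R) < n%:R by rewrite ltr0n.
have E0 : Ex (linstat P m) = 0.
  have : Ex (linstat P m) = Ex (linstat P 0) - m.
    rewrite (stateD sE) (state_cst sE); congr (_ - _).
    by rewrite /linstat (stateD sE) (state_cst sE) oppr0 addr0.
  by rewrite -/m subrr.
apply: le_trans (moment_bound hA n0 sE k (real_linstat P m) E0
   (fun W oW => carre_linstat m n0 hP oW)) _.
rewrite le_eqVlt; apply/orP; left; apply/eqP; congr (_ ^+ _).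
by field; exact: lt0r_neq0.
Qed.

End LinearStatistics.

(** * Haar integration of polynomial functions *)

Section BorelMatrices.
Variables (R : realType) (n : nat).

Lemma Re_continuous : continuous (fun z : R[i]^o => complex.Re z : R).
Proof.
move=> z S /nbhs_ballP[e /= e0 eS]; exists (e%:C)%C; first by rewrite /= ltcR.
move=> w /= zw; apply: eS; rewrite /ball /= -ltcR; apply: le_lt_trans zw.
by have := normc_ge_Re (z - w); case: z w => [a b] [c d].
Qed.

Lemma normc_ge_Im (x : R[i]) : `|complex.Im x|%:C%C <= `|x|.
Proof.
have := normc_ge_Re (x * 'i%C).
have -> : `|x * 'i%C| = `|x|.
  by rewrite normrM [ `|'i%C| ]normc_def /= expr0n /= add0r expr1n sqrtr1 mulr1.
by case: x => a b /=; rewrite mulr0 mulr1 add0r normrN.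
Qed.

Lemma Im_continuous : continuous (fun z : R[i]^o => complex.Im z : R).
Proof.
move=> z S /nbhs_ballP[e /= e0 eS]; exists (e%:C)%C; first by rewrite /= ltcR.
move=> w /= zw; apply: eS; rewrite /ball /= -ltcR; apply: le_lt_trans zw.
by have := normc_ge_Im (z - w); case: z w => [a b] [c d].
Qed.

Lemma continuous_borelmx (f : 'M[R[i]^o]_n -> R) : continuous f ->
  measurable_fun [set: borelmx R n] (f : borelmx R n -> R).
Proof.
move=> cf mD; apply: (measurability _ (RGenOInfty.measurableE R)) => //.
move=> _ [_ [x ->] <-]; rewrite setTI; apply: sub_sigma_algebra.
by apply: open_comp => //; exact: itv_open_ends_open.
Qed.

Lemma Re_entry_measurable i j :
  measurable_fun [set: borelmx R n] (fun X : borelmx R n => complex.Re ((X : 'M[R[i]]_n) i j)).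
Proof.
apply: continuous_borelmx => X; apply: (@continuous_comp _ _ _
  (fun X : 'M[R[i]^o]_n => X i j : R[i]^o) (fun z : R[i]^o => complex.Re z : R)).
  exact: coord_continuous.
exact: Re_continuous.
Qed.

Lemma Im_entry_measurable i j :
  measurable_fun [set: borelmx R n] (fun X : borelmx R n => complex.Im ((X : 'M[R[i]]_n) i j)).
Proof.
apply: continuous_borelmx => X; apply: (@continuous_comp _ _ _
  (fun X : 'M[R[i]^o]_n => X i j : R[i]^o) (fun z : R[i]^o => complex.Im z : R)).
  exact: coord_continuous.
exact: Im_continuous.
Qed.

End BorelMatrices.

Section ComplexMeasurable.
Context d (T : measurableType d) (R : realType) (n : nat).
Local Notation C := R[i].

Definition cmeas (u : T -> C) :=
  measurable_fun setT (fun t => complex.Re (u t)) /\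
  measurable_fun setT (fun t => complex.Im (u t)).

Lemma cmeas_cst c : cmeas (fun=> c). Proof. by split; exact: measurable_cst. Qed.

Lemma cmeasD u v : cmeas u -> cmeas v -> cmeas (fun t => u t + v t).
Proof.
move=> [r1 i1] [r2 i2]; split.
  by under eq_fun do rewrite cReD; exact: measurable_funD.
by under eq_fun do rewrite cImD; exact: measurable_funD.
Qed.

Lemma cmeasM u v : cmeas u -> cmeas v -> cmeas (fun t => u t * v t).
Proof.
move=> [r1 i1] [r2 i2]; split.
  by under eq_fun do rewrite cReM; apply: measurable_funB; exact: measurable_funM.
by under eq_fun do rewrite cImM; apply: measurable_funD; exact: measurable_funM.
Qed.

Lemma cmeasJ u : cmeas u -> cmeas (fun t => (u t)^*).
Proof.
move=> [r1 i1]; split.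
  by under eq_fun do rewrite cReJ.
by under eq_fun do rewrite cImJ; exact: measurableT_comp.
Qed.

Lemma cmeas_sum (I : Type) (r : seq I) (F : I -> T -> C) :
  (forall i, cmeas (F i)) -> cmeas (fun t => \sum_(i <- r) F i t).
Proof.
move=> hF; elim: r => [|i r IH].
  by under eq_fun do rewrite big_nil; exact: cmeas_cst.
by under eq_fun do rewrite big_cons; exact: cmeasD.
Qed.

Definition mmeas (M : T -> 'M[C]_n) := forall i j, cmeas (fun t => M t i j).

Lemma mmeas_cst A : mmeas (fun=> A). Proof. by move=> i j; exact: cmeas_cst. Qed.

Lemma mmeasM M N : mmeas M -> mmeas N -> mmeas (fun t => M t *m N t).
Proof.
move=> hM hN i j; under eq_fun do rewrite mxE.
by apply: cmeas_sum => k; exact: cmeasM.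
Qed.

Lemma mmeas_adj M : mmeas M -> mmeas (fun t => (M t)^t*).
Proof. by move=> hM i j; under eq_fun do rewrite !mxE; exact: cmeasJ. Qed.

Lemma cmeas_ev (p : polyfun C n) M : mmeas M -> cmeas (fun t => ev p (M t)).
Proof.
move=> hM; elim: p => [c|Y|p IHp q IHq|p IHp q IHq] /=.
- exact: cmeas_cst.
- by apply: cmeas_sum => k; exact: (mmeasM (@mmeas_cst Y) hM).
- exact: cmeasD.
- exact: cmeasM.
Qed.

End ComplexMeasurable.

Lemma same_law_integral d (T : measurableType d) (R : realType) (P : probability T R)
    (f1 f2 : T -> R) (mf1 : measurable_fun setT f1) (mf2 : measurable_fun setT f2) :
  P.-integrable setT (EFin \o f1) -> P.-integrable setT (EFin \o f2) ->
  (forall S, measurable S -> pushforward P f1 S = pushforward P f2 S) ->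
  (\int[P]_t (f1 t)%:E = \int[P]_t (f2 t)%:E)%E.
Proof.
move=> if1 if2 push.
have mE : measurable_fun setT (@EFin R) by exact: EFin_measurable.
have e1 : (\int[pushforward P f1]_y y%:E = \int[P]_t (f1 t)%:E)%E.
  exact: (@integral_pushforward _ _ T R R f1 mf1 P setT EFin mE if1 measurableT).
have e2 : (\int[pushforward P f2]_y y%:E = \int[P]_t (f2 t)%:E)%E.
  exact: (@integral_pushforward _ _ T R R f2 mf2 P setT EFin mE if2 measurableT).
rewrite -e1 -e2.
pose M1 := isMeasurableFun.Build _ _ _ _ _ mf1.
pose M2 := isMeasurableFun.Build _ _ _ _ _ mf2.
pose g1 : {mfun T >-> R} := HB.pack f1 M1.
pose g2 : {mfun T >-> R} := HB.pack f2 M2.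
apply: (@eq_measure_integral _ _ _ setT (pushforward P g2) (pushforward P g1)) => S mS _.
exact: push.
Qed.

Section HaarState.
Context d (T : measurableType d) (R : realType) (P : probability T R) (n : nat).
Variables (U : {RV P >-> borelmx R n}) (A : 'M[R[i]]_n).
Hypothesis haar : haar_distributed U.
Local Notation C := R[i].

Definition UAU (t : T) : 'M[C]_n := (U t : 'M[C]_n) *m A *m (U t : 'M[C]_n)^t*.

Lemma mmeas_U : @mmeas d T R n (fun t => U t : 'M[C]_n).
Proof.
move=> i j; split.
  exact: (measurableT_comp (@Re_entry_measurable R n i j) (@measurable_funPT _ _ _ _ U)).
exact: (measurableT_comp (@Im_entry_measurable R n i j) (@measurable_funPT _ _ _ _ U)).
Qed.

Lemma mmeas_UAU : @mmeas d T R n UAU.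
Proof.
have := mmeasM (mmeasM mmeas_U (mmeas_cst T A)) (mmeas_adj mmeas_U).
by [].
Qed.

Lemma orb_UAU t : orb A (UAU t).
Proof. by have [uU _] := haar; exists (U t : 'M[C]_n). Qed.

Lemma bounded_integrable (f : T -> R) (B : R) : measurable_fun setT f ->
  (forall t, `|f t| <= B) -> P.-integrable setT (EFin \o f).
Proof.
move=> mf fB; apply: measurable_bounded_integrable => //.
  exact: le_lt_trans (probability_le1 P measurableT) (ltry 1).
exists B; split; first exact: num_real.
by move=> x Bx t _; apply: le_trans (fB t) (ltW Bx).
Qed.

Lemma reval_integrable (M : T -> 'M[C]_n) p : @mmeas d T R n M -> (forall t, orb A (M t)) ->
  P.-integrable setT (EFin \o (fun t => reval p (M t))).
Proof.
move=> mM oM; have [B _ hB] := reval_bounded A p.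
by apply: (@bounded_integrable _ B) => [|t]; [have [] := cmeas_ev p mM|exact: hB].
Qed.

Lemma UAU_integrable p : P.-integrable setT (EFin \o (fun t => reval p (UAU t))).
Proof. exact: reval_integrable mmeas_UAU orb_UAU. Qed.

Definition haar_mean (p : polyfun C n) : R := \int[P]_t reval p (UAU t).

(** Left invariance of the Haar measure. *)
Lemma haar_mean_conj p V : V \is unitarymx ->
  \int[P]_t reval p (V *m UAU t *m V^t*) = haar_mean p.
Proof.
move=> uV; have [uU inv] := haar.
pose F (X : borelmx R n) : R := reval p ((X : 'M[C]_n) *m A *m (X : 'M[C]_n)^t*).
have mF : measurable_fun setT F.
  have mid : @mmeas _ (borelmx R n) R n (fun X : borelmx R n => X : 'M[C]_n).
    by move=> i j; split; [exact: Re_entry_measurable|exact: Im_entry_measurable].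
  by have [] := cmeas_ev p (mmeasM (mmeasM mid (mmeas_cst (borelmx R n) A)) (mmeas_adj mid)).
pose f1 t := reval p (V *m UAU t *m V^t*); pose f2 t := reval p (UAU t).
have mVU : @mmeas d T R n (fun t => V *m UAU t *m V^t*).
  exact: mmeasM (mmeasM (mmeas_cst T V) mmeas_UAU) (mmeas_cst T (V^t*)).
have oVU t : orb A (V *m UAU t *m V^t*) by apply: orb_conj uV _; exact: orb_UAU.
have mf1 : measurable_fun setT f1 by have [] := cmeas_ev p mVU.
have mf2 : measurable_fun setT f2 by have [] := cmeas_ev p mmeas_UAU.
have if1 := reval_integrable p mVU oVU.
have if2 := reval_integrable p mmeas_UAU orb_UAU.
have push S : measurable S -> pushforward P f1 S = pushforward P f2 S.
  move=> mS; rewrite /pushforward.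
  have mFS : measurable (F @^-1` S) by rewrite -[X in measurable X]setTI; exact: mF.
  have uVt : V^t* \is unitarymx by rewrite trmxC_unitary.
  have e := inv (V^t*) (F @^-1` S) uVt mFS; rewrite /distribution /pushforward in e.
  apply: etrans e; congr (P _); apply/seteqP; split => t /=.
    rewrite /f1 => St; exists (V *m (U t : 'M[C]_n)).
      by rewrite /F /= trmxC_mul !mulmxA; rewrite /UAU !mulmxA in St.
    by rewrite mulmxA unitarymx_adjM // mul1mx.
  move=> [X SX eX]; rewrite /f1 /UAU -eX; move: SX; rewrite /F /=.
  rewrite trmxC_mul trmxCK !mulmxA (unitarymxP uV) mul1mx.
  by rewrite -[in X in _ -> X]mulmxA (unitarymxP uV) mulmx1.
exact: (congr1 fine (same_law_integral mf1 mf2 if1 if2 push)).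
Qed.

Lemma haar_meanD p q : haar_mean (Add p q) = haar_mean p + haar_mean q.
Proof.
rewrite -(RintegralD measurableT (UAU_integrable p) (UAU_integrable q)).
by apply: eq_Rintegral => t _; rewrite /reval cReD.
Qed.

Lemma haar_meanZ (a : R) p : haar_mean (Scale a%:C%C p) = a * haar_mean p.
Proof.
rewrite -(RintegralZl a measurableT (UAU_integrable p)).
by apply: eq_Rintegral => t _; rewrite /reval cReZ.
Qed.

Lemma haar_mean_cst (a : R) : haar_mean (Cst n a%:C%C) = a.
Proof.
have e := Rintegral_cst P measurableT a.
have P1 : fine (P setT) = 1 by rewrite (@probability_setT _ _ _ P).
rewrite P1 mulr1 in e.
by rewrite -[RHS]e; apply: eq_Rintegral.
Qed.

(** By invariance the mean of p is unchanged along the flow of X; a first-order lower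
    bound with uniform remainder B s ^ 2 then leaves no room for a positive derivative.
    This replaces differentiation under the integral sign. *)
Lemma haar_mean_der_le0 p X : X^t* = - X -> haar_mean (der X p) <= 0.
Proof.
move=> hX; have [Q [th [uQ eX]]] := antiherm_cis hX.
have [B B0 hB] := reval_bounded A (der X (der X p)).
apply/ler_addgt0Pr => e e0; rewrite add0r.
pose s := e / (B + 1); have B1 : 0 < B + 1 by rewrite ltr_wpDl.
have s0 : 0 < s by rewrite divr_gt0.
pose g t := udiag Q (cis_row th t).
have ug t : g t \is unitarymx by exact: cis_curve_unitary.
have low t : reval p (UAU t) + s * reval (der X p) (UAU t) - B * s ^+ 2
     <= reval p (g s *m UAU t *m (g s)^t*).
  pose h q u := reval q (g u *m UAU t *m (g u)^t*).
  have dh q u : is_derive u (1 : R) (h q) (h (der X q) u).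
    have hg := mderiv_cis_curve th u uQ; rewrite -eX in hg.
    by have [] := cderiv_ev q (UAU t) hX hg.
  have h0 q : h q 0 = reval q (UAU t).
    by rewrite /h /g (cis_curve0 th uQ) adjoint_action1.
  have hlow u : - B <= h (der X (der X p)) u.
    have ou : orb A (g u *m UAU t *m (g u)^t*) by apply: orb_conj (ug u) (orb_UAU t).
    by have := hB _ ou; rewrite ler_norml => /andP[].
  have := taylor1_lower B0 (dh p) (dh (der X p)) hlow (ltW s0).
  by rewrite !h0 mulrC.
have mg : @mmeas d T R n (fun t => g s *m UAU t *m (g s)^t*).
  exact: mmeasM (mmeasM (mmeas_cst T (g s)) mmeas_UAU) (mmeas_cst T ((g s)^t*)).
have og t : orb A (g s *m UAU t *m (g s)^t*) by apply: orb_conj (ug s) (orb_UAU t).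
pose q := Add (Add p (Scale s%:C%C (der X p))) (Cst n (- (B * s ^+ 2))%:C%C).
have qE W : reval q W = reval p W + s * reval (der X p) W - B * s ^+ 2.
  by rewrite /reval [ev q W]/(_ + _ + _) !cReD cReZ.
have le1 : haar_mean q <= haar_mean p.
  rewrite -(haar_mean_conj p (ug s)); apply: le_Rintegral => // [||t _].
  - exact: reval_integrable mmeas_UAU orb_UAU.
  - exact: reval_integrable mg og.
  - by rewrite qE; exact: low.
rewrite !haar_meanD haar_meanZ haar_mean_cst -addrA gerDl in le1.
have : s * (haar_mean (der X p) - B * s) <= 0 by rewrite mulrBr [s * (B * s)]mulrCA -expr2.
rewrite pmulr_rle0 // subr_le0 => /le_trans; apply.
by rewrite /s mulrA ler_pdivrMr // mulrDr mulr1 mulrC lerDl ltW.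
Qed.

(** The derivative vanishes since its mean is nonpositive both for X and for - X. *)
Theorem haar_state : invariant_state A haar_mean.
Proof.
split.
- exact: (haar_mean_cst 1).
- exact: haar_meanD.
- exact: haar_meanZ.
- move=> p q pq; apply: le_Rintegral => // [||t _]; try exact: UAU_integrable.
  by apply: pq; exact: orb_UAU.
- move=> X p hX; apply/eqP; rewrite eq_le haar_mean_der_le0 //=.
  have hNX : (- X)^t* = - - X by rewrite linearN /= map_mxN hX.
  have := haar_mean_der_le0 p hNX.
  have -> : haar_mean (der (- X) p) = - haar_mean (der X p).
    rewrite -[RHS]mulN1r -haar_meanZ; apply: eq_Rintegral => t _.
    by rewrite reval_derN /reval cReZ mulN1r.
  by rewrite oppr_le0.
Qed.

End HaarState.

(** * Quantile functions *)

Section Tails.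
Variable R : realType.
Implicit Types (mu nu : probability R R) (x s : R).

Lemma tail_determines (mu nu : {measure set R -> \bar R}) :
  (forall x, (mu `]x, +oo[ < +oo)%E) -> (forall x : R, mu `]x, +oo[ = nu `]x, +oo[) ->
  forall S : set R, measurable S -> mu S = nu S.
Proof.
move=> fin e S mS.
apply: (@measure_unique _ _ _ (@RGenOInfty.G R) (fun n : nat => `](- n%:R)%R, +oo[)) => //.
- exact: RGenOInfty.measurableE.
- move=> _ _ [x ->] [y ->]; exists (Num.max x y).
  by apply/seteqP; split => z /=; rewrite !in_itv /= !andbT gt_max => /andP.
- by move=> n; exists (- n%:R).
- apply/seteqP; split => // z _; exists (Num.truncn `|z|).+1 => //=.
  rewrite in_itv /= andbT ltrNl; apply: le_lt_trans (truncnS_gt `|z|).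
  by rewrite -normrN ler_norm.
- by move=> _ [x ->]; exact: e.
Qed.

Definition tail mu x : R := fine (mu `]x, +oo[).

Lemma tail_EFin mu x : mu `]x, +oo[ = (tail mu x)%:E.
Proof. by rewrite /tail fineK // fin_num_measure. Qed.

Lemma tail01 mu x : 0 <= tail mu x <= 1.
Proof.
by rewrite -!lee_fin -tail_EFin measure_ge0 probability_le1.
Qed.

Lemma tail_anti mu x y : x <= y -> tail mu y <= tail mu x.
Proof.
move=> xy; rewrite -lee_fin -!tail_EFin le_measure ?inE //.
by apply: subset_itvr; rewrite bnd_simp.
Qed.

Lemma tail_right_cont mu s x : (forall y, x < y -> tail mu y <= s) -> tail mu x <= s.
Proof.
move=> h; pose F (n : nat) := `]x + n.+1%:R^-1, +oo[%classic : set R.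
have e : `]x, +oo[%classic = \bigcup_n F n.
  apply/seteqP; split => z /=; rewrite in_itv /= andbT.
    move=> xz; exists (Num.truncn (z - x)^-1) => //.
    rewrite /F /= in_itv /= andbT -ltrBrDl -[ltRHS]invrK.
    rewrite ltf_pV2 ?posrE ?invr_gt0 ?subr_gt0 ?ltr0n //.
    exact: truncnS_gt.
  by move=> [n _]; rewrite /F /= in_itv /= andbT; apply: lt_trans; rewrite ltrDl.
have ndF : nondecreasing_seq F.
  move=> m n mn; apply/subsetPset => z; rewrite /F /= !in_itv /= !andbT; apply: le_lt_trans.
  by rewrite lerD2l lef_pV2 ?posrE ?ltr0n // ler_nat.
have mF n : measurable (F n) by exact: measurable_itv.
have c := @nondecreasing_cvg_mu _ R _ mu F mF (bigcup_measurable (fun n _ => mF n)) ndF.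
rewrite -e in c; rewrite -lee_fin -tail_EFin.
apply: (cvge_le _ c); apply: nearW => n.
by rewrite /= tail_EFin lee_fin; apply: h; rewrite ltrDl invr_gt0 ltr0n.
Qed.

Section Quantile.
Variables (mu : probability R R) (r : R).
Hypotheses (r_ge0 : 0 <= r) (lo : forall x, x < - r -> tail mu x = 1) (hi : tail mu r = 0).

(** The upper half-line is used instead of a distribution function. The values outside
    ]0, 1] keep the function monotone and bounded on the whole line; the uniform law
    does not see them. *)
Definition quantile s : R :=
  if s <= 0 then - r else if s <= 1 then inf [set x | s <= 1 - tail mu x] else r.

Let E s := [set x | s <= 1 - tail mu x].

Lemma quantile_set s : 0 < s -> s <= 1 -> has_inf (E s) /\ lbound (E s) (- r).
Proof.
move=> s0 s1; have lb : lbound (E s) (- r).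
  move=> x; rewrite /E /= => sx; rewrite leNgt; apply/negP => /lo e.
  by rewrite e subrr in sx; rewrite (lt_geF s0) in sx.
split=> //; split; last by exists (- r).
by exists r; rewrite /E /= hi subr0.
Qed.

Lemma quantile_le s x : 0 < s -> s <= 1 -> (quantile s <= x) = (s <= 1 - tail mu x).
Proof.
move=> s0 s1; have [hE lb] := quantile_set s0 s1.
rewrite /quantile (lt_geF s0) s1; apply/idP/idP => h; last first.
  by apply: ge_inf => //; case: hE.
rewrite lerBrDr -lerBrDl; apply: tail_right_cont => y xy.
have [z zE zy] := inf_lt hE.1 (le_lt_trans h xy).
by have := tail_anti mu (ltW zy); rewrite /E /= in zE; lra.
Qed.

Lemma quantile_bounds s : - r <= quantile s <= r.
Proof.
rewrite /quantile; case: (leP s 0) => s0; first by rewrite lexx /= ge0_cp.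
case: (leP s 1) => s1; last by rewrite lexx andbT ge0_cp.
have [hE lb] := quantile_set s0 s1; apply/andP; split.
  by apply: lb_le_inf => //; case: hE.
by apply: ge_inf; [case: hE|rewrite /= hi subr0].
Qed.

Lemma quantile_nd : nondecreasing_fun quantile.
Proof.
move=> s t st; case: (leP s 0) => s0.
  by rewrite {1}/quantile s0; have /andP[] := quantile_bounds t.
case: (leP t 1) => t1; last first.
  have -> : quantile t = r by rewrite /quantile (lt_geF (lt_le_trans s0 st)) (lt_geF t1).
  by have /andP[] := quantile_bounds s.
have s1 := le_trans st t1; rewrite (quantile_le _ s0 s1); apply: (le_trans st).
by rewrite -(quantile_le _ (lt_le_trans s0 st) t1).
Qed.

Lemma quantile_measurable : measurable_fun setT quantile.
Proof. exact: nondecreasing_measurable measurableT quantile_nd. Qed.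

Lemma quantile_gt s x : 0 < s -> s <= 1 -> (x < quantile s) = (1 - tail mu x < s).
Proof. by move=> s0 s1; rewrite !ltNge quantile_le. Qed.

End Quantile.

Lemma uniform_itv (a b : R) : 0 <= a -> a <= b -> b <= 1 ->
  uniform_prob (@ltr01 R) `]a, b] = (b - a)%:E.
Proof.
move=> a0 ab b1; rewrite /uniform_prob.
rewrite (eq_integral (fun=> 1%E)); last first.
  move=> x; rewrite inE /= in_itv /= => /andP[ax xb].
  by rewrite /uniform_pdf (le_trans a0 (ltW ax)) (le_trans xb b1) /= subr0 invr1.
rewrite integral_cst //= mul1e lebesgue_measure_itv /= lte_fin.
by case: ltgtP ab => // -> _; rewrite subrr.
Qed.

(** Inverse transform sampling. *)
Lemma quantile_law (mu : probability R R) r (x : R) : 0 <= r ->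
  (forall x, x < - r -> tail mu x = 1) -> tail mu r = 0 ->
  uniform_prob (@ltr01 R) (quantile mu r @^-1` `]x, +oo[) = mu `]x, +oo[.
Proof.
move=> r0 lo hi; have /andP[t0 t1] := tail01 mu x.
set U := quantile mu r @^-1` _.
have mU : measurable U.
  by rewrite -[U]setTI; apply: quantile_measurable => //; exact: measurable_itv.
have b0 : 0 <= 1 - tail mu x by rewrite subr_ge0.
have := @uniform_itv (1 - tail mu x) 1 b0; rewrite lerBlDr lerDl t0 => /(_ isT (lexx _)).
rewrite subKr -tail_EFin => <-.
case: (ltP x (- r)) => [xr|rx].
  have -> : U = setT.
    apply/seteqP; split => // s _; rewrite /U /= in_itv /= andbT.
    by apply: lt_le_trans xr _; have /andP[] := quantile_bounds r0 lo hi s.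
  rewrite (lo _ xr) subrr probability_setT.
  have := @uniform_itv 0 1 (lexx _) ler01 (lexx _); rewrite subr0 => ->.
  by [].
rewrite /uniform_prob [LHS]integral_uniform_pdf [RHS]integral_uniform_pdf.
congr (integral _ _ _); apply/seteqP; split => s /=; rewrite /U /= !in_itv /= ?andbT.
  move=> [qs /andP[s0 s1]]; rewrite s0 s1 andbT; split => //.
  case: (ltP 0 s) => [s0'|]; first by rewrite -(quantile_gt lo hi).
  by move=> s0'; move: qs; rewrite /quantile s0' => /lt_le_trans/(_ rx); rewrite ltxx.
move=> [/andP[s0 _] /andP[_ s1]]; have s0' := le_lt_trans b0 s0.
by rewrite (quantile_gt lo hi) // s1 (ltW s0').
Qed.

End Tails.

(** * Discretization of an interval *)

Section Ramps.
Variables (R : realType) (r w : R) (m : nat).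
Hypotheses (w_ge0 : 0 <= w) (entry_pow : m%:R * w = 2 * r).

Definition node (j : nat) : R := - r + j%:R * w.
(** The length of the part of the cell [node j, node j.+1] that lies below x. It is a
    continuous stand-in for w times the indicator of node j < x. *)
Definition ramp (j : nat) (x : R) : R := Num.max (x - node j) 0 - Num.max (x - node j.+1) 0.

Lemma nodeS j : node j.+1 = node j + w.
Proof. by rewrite /node -natr1; ring. Qed.

Lemma ramp_sum x : \sum_(j < m) ramp j x = Num.max (x + r) 0 - Num.max (x - r) 0.
Proof.
rewrite -(big_mkord xpredT (fun j => ramp j x)) /ramp.
rewrite (telescope_sumr_eq (fun j => - Num.max (x - node j) 0)) //; last first.
  by move=> j _; rewrite opprK addrC.
rewrite opprK /node mul0r addr0 opprK entry_pow addrC; congr (_ - Num.max _ _); ring.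
Qed.

Lemma ramp_le j x : ramp j x <= w * (node j < x)%R%:R.
Proof.
rewrite /ramp nodeS; case: (ltP (node j) x) => h /=; rewrite ?mulr1 ?mulr0.
  by case: (leP (x - node j) 0) => ?; case: (leP (x - (node j + w)) 0) => ?; lra.
by case: (leP (x - node j) 0) => ?; case: (leP (x - (node j + w)) 0) => ?; lra.
Qed.

Lemma ramp_ge j x : w * (node j.+1 < x)%R%:R <= ramp j x.
Proof.
rewrite /ramp nodeS; case: (ltP (node j + w) x) => h /=; rewrite ?mulr1 ?mulr0.
  by case: (leP (x - node j) 0) => ?; case: (leP (x - (node j + w)) 0) => ?; lra.
by case: (leP (x - node j) 0) => ?; case: (leP (x - (node j + w)) 0) => ?; lra.
Qed.

Lemma ramp_mono j x y : x <= y -> ramp j x <= ramp j y.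
Proof.
have w0 := w_ge0; move=> xy; rewrite /ramp nodeS.
case: (leP (x - node j) 0) => ?; case: (leP (x - (node j + w)) 0) => ?;
  case: (leP (y - node j) 0) => ?; case: (leP (y - (node j + w)) 0) => ?; lra.
Qed.

(** The ramps of different cells vary on disjoint cells, so coefficients in [-1, 1] do
    not destroy the Lipschitz constant 1. *)
Lemma sign_ramp_lipschitz (a : 'I_m -> R) x y : (forall j, `|a j| <= 1) ->
  `|\sum_(j < m) a j * ramp j x - \sum_(j < m) a j * ramp j y| <= `|x - y|.
Proof.
move=> ha; wlog xy : x y / y <= x.
  move=> H; case: (leP y x) => [|/ltW]; first exact: H.
  by move=> /H; rewrite distrC [X in _ <= X -> _]distrC.
rewrite -sumrB (le_trans (ler_norm_sum _ _ _)) //.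
apply: (@le_trans _ _ (\sum_(j < m) (ramp j x - ramp j y))).
  apply: ler_sum => j _; rewrite -mulrBr normrM -[leRHS]mul1r.
  have d0 : 0 <= ramp j x - ramp j y by rewrite subr_ge0 ramp_mono.
  by rewrite (ger0_norm d0) ler_wpM2r.
rewrite sumrB !ramp_sum ger0_norm ?subr_ge0 //.
have r0 : 0 <= r.
  by rewrite -(pmulr_rge0 _ (ltr0Sn R 1)) -entry_pow mulr_ge0.
case: (leP (x + r) 0) => ?; case: (leP (x - r) 0) => ?;
  case: (leP (y + r) 0) => ?; case: (leP (y - r) 0) => ?; lra.
Qed.

(** x + r is within w of w times the number of nodes below x. *)
Lemma step_approx x y : `|x| <= r -> `|y| <= r ->
  `|x - y| <= w + \sum_(j < m) w * `|(node j < x)%R%:R - (node j < y)%R%:R|.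
Proof.
have S1 u : `|u| <= r -> u + r <= \sum_(j < m) w * (node j < u)%R%:R <= u + r + w.
  rewrite ler_norml => /andP[u1 u2].
  have e : u + r = \sum_(j < m) ramp j u.
    by rewrite ramp_sum; case: (leP (u + r) 0) => ?; case: (leP (u - r) 0) => ?; lra.
  rewrite e; apply/andP; split; first by apply: ler_sum => j _; exact: ramp_le.
  case: m entry_pow e => [|k] _ _; first by rewrite !big_ord0 add0r.
  rewrite big_ord_recl [X in _ <= X + _]big_ord_recr /=.
  have h1 : \sum_(i < k) w * (node (bump 0 i) < u)%R%:R <= \sum_(i < k) ramp i u.
    by apply: ler_sum => i _; rewrite /bump leq0n add1n; exact: ramp_ge.
  have h2 : w * (node 0 < u)%R%:R <= w by case: (_ < _); rewrite ?mulr1 ?mulr0.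
  have h3 : 0 <= ramp k u by apply: le_trans (ramp_ge _ _); rewrite mulr_ge0.
  lra.
move=> /S1/andP[x1 x2] /S1/andP[y1 y2].
have t : `|\sum_(j < m) w * (node j < x)%R%:R - \sum_(j < m) w * (node j < y)%R%:R|
    <= \sum_(j < m) w * `|(node j < x)%R%:R - (node j < y)%R%:R|.
  rewrite -sumrB (le_trans (ler_norm_sum _ _ _)) //; apply: ler_sum => j _.
  by rewrite -mulrBr normrM (ger0_norm w_ge0).
move: t; set s1 := \sum_(j < m) _ in x1 x2 *; set s2 := \sum_(j < m) _ in y1 y2 *.
set s3 := \sum_(j < m) _; rewrite !ler_norml => /andP[t1 t2].
by apply/andP; split; lra.
Qed.

(** F j lies between w G j.+1 and w G j; the total of these gaps telescopes to at most w
    for each of the two families. *)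
Lemma grid_compare (G1 G2 F1 F2 : nat -> R) :
  (forall j, w * G1 j.+1 <= F1 j <= w * G1 j) ->
  (forall j, w * G2 j.+1 <= F2 j <= w * G2 j) ->
  (forall j, 0 <= G1 j <= 1) -> (forall j, 0 <= G2 j <= 1) ->
  \sum_(j < m) w * `|G1 j - G2 j| <= 2 * w + \sum_(j < m) `|F1 j - F2 j|.
Proof.
move=> h1 h2 b1 b2.
have tele (G : nat -> R) : (forall j, 0 <= G j <= 1) ->
    \sum_(j < m) (w * G j - w * G j.+1) <= w.
  move=> b; rewrite -(big_mkord xpredT (fun j => w * G j - w * G j.+1)).
  rewrite (telescope_sumr_eq (fun j => - (w * G j))) //; last by move=> j _; rewrite opprK addrC.
  rewrite opprK; have /andP[g0 _] := b m; have /andP[_ g1] := b 0%N.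
  have := mulr_ge0 w_ge0 g0; have := ler_wpM2l w_ge0 g1; rewrite mulr1; lra.
apply: (@le_trans _ _ (\sum_(j < m) (`|F1 j - F2 j| + (w * G1 j - w * G1 j.+1)
    + (w * G2 j - w * G2 j.+1)))); last first.
  by rewrite big_split /= big_split /=; have := tele _ b1; have := tele _ b2; lra.
apply: ler_sum => j _; rewrite -{1}(ger0_norm w_ge0) -normrM mulrBr.
have /andP[p1 p2] := h1 j; have /andP[q1 q2] := h2 j.
have := ler_norm (F1 j - F2 j); have := ler_norm (- (F1 j - F2 j)); rewrite normrN.
by move=> n1 n2; rewrite ler_norml; apply/andP; split; lra.
Qed.

End Ramps.

(** * Wasserstein distance on a bounded interval *)

Section QuantileCoupling.
Variables (R : realType) (mu nu : probability R R) (r w : R) (m : nat).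
Hypotheses (r_ge0 : 0 <= r) (w_ge0 : 0 <= w) (entry_pow : m%:R * w = 2 * r).
Hypotheses (mu_lo : forall x, x < - r -> tail mu x = 1) (mu_hi : tail mu r = 0).
Hypotheses (nu_lo : forall x, x < - r -> tail nu x = 1) (nu_hi : tail nu r = 0).

Local Notation unif := (uniform_prob (@ltr01 R)).

Lemma quantile_distribution (la : probability R R) (S : set R) :
  (forall x, x < - r -> tail la x = 1) -> tail la r = 0 -> measurable S ->
  unif (quantile la r @^-1` S) = la S.
Proof.
move=> lo hi mS.
pose M := isMeasurableFun.Build _ _ (measurableTypeR R) R _ (quantile_measurable r_ge0 lo hi).
pose q : {mfun measurableTypeR R >-> R} := HB.pack (quantile la r) M.
have H := @tail_determines R (distribution unif q) la.
apply: (H _ _ S mS) => x; last exact: quantile_law.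
exact: le_lt_trans (probability_le1 (distribution unif q) (measurable_itv _)) (ltry 1).
Qed.

Let qpair (s : R) : (R * R)%type := (quantile mu r s, quantile nu r s).

Let mqpair : measurable_fun setT qpair.
Proof.
by apply: measurable_fun_pair; exact: quantile_measurable.
Qed.

Lemma step_integral (a b : R) : 0 <= a <= 1 -> 0 <= b <= 1 ->
  unif `]Num.min a b, Num.max a b] = `|a - b|%:E.
Proof.
move=> /andP[a0 a1] /andP[b0 b1]; rewrite uniform_itv ?le_min ?ge_max ?a0 ?b0 ?a1 ?b1 //.
  by case: (leP a b) => h; [rewrite distrC ger0_norm ?subr_ge0|rewrite gtr0_norm ?subr_gt0].
by rewrite ge_min le_max lexx.
Qed.

(** The quantile coupling under the uniform law. Its cost is the integral of the
    difference of the tails; step_approx discretizes it, since for fixed x the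
    indicators of x < quantile mu r s and x < quantile nu r s differ exactly on an
    interval of values s of length |tail mu x - tail nu x|. *)
Theorem wasserstein_grid (f g : set R -> \bar R) :
  (forall S, measurable S -> f S = mu S) -> (forall S, measurable S -> g S = nu S) ->
  (wasserstein1 f g <= (w + \sum_(j < m)
    w * `|tail mu (node r w j) - tail nu (node r w j)|)%:E)%E.
Proof.
move=> fmu gnu.
pose M := isMeasurableFun.Build _ _ (measurableTypeR R) (R * R)%type _ mqpair.
pose Z : {mfun measurableTypeR R >-> (R * R)%type} := HB.pack qpair M.
apply: (@le_trans _ _ (\int[distribution unif Z]_z `|z.1 - z.2|%:E)%E).
  apply: ereal_inf_lbound; exists (distribution unif Z) => // S mS; split.
    by rewrite fmu // -(quantile_distribution mu_lo mu_hi mS).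
  by rewrite gnu // -(quantile_distribution nu_lo nu_hi mS).
rewrite ge0_integral_distribution; last 2 first.
- apply/measurable_EFinP; apply: measurableT_comp => //.
  by apply: measurable_funB; [exact: measurable_fst|exact: measurable_snd].
- by move=> y; rewrite lee_fin.
pose a j := 1 - tail mu (node r w j); pose b j := 1 - tail nu (node r w j).
have a01 j : 0 <= a j <= 1.
  by have /andP[h1 h2] := tail01 mu (node r w j); rewrite /a; apply/andP; split; lra.
have b01 j : 0 <= b j <= 1.
  by have /andP[h1 h2] := tail01 nu (node r w j); rewrite /b; apply/andP; split; lra.
pose I j : set R := `]Num.min (a j) (b j), Num.max (a j) (b j)]%classic.
have mI j : measurable (I j) by exact: measurable_itv.
have mind j : measurable_fun setT (fun s : R => (w * \1_(I j) s)%:E).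
  by apply/measurable_EFinP; apply: measurable_funM => //; exact: measurable_indic.
have msum : measurable_fun setT (fun s : R => \sum_(j < m) (w * \1_(I j) s)%:E)%E.
  under eq_fun do rewrite sumEFin.
  apply/measurable_EFinP; apply: measurable_sum => j.
  by apply: measurable_funM => //; exact: measurable_indic.
apply: (@le_trans _ _ (\int[unif]_s (w%:E + \sum_(j < m) (w * \1_(I j) s)%:E))%E).
  apply: ge0_le_integral => //.
  - by move=> s _; rewrite /= lee_fin.
  - apply/measurable_EFinP; apply: measurableT_comp => //=.
    by apply: measurable_funB; exact: quantile_measurable.
  - by apply: emeasurable_funD => //; exact: msum.
  move=> s _ /=; rewrite sumEFin -EFinD lee_fin.
  have h1 : `|quantile mu r s| <= r by rewrite ler_norml; exact: quantile_bounds.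
  have h2 : `|quantile nu r s| <= r by rewrite ler_norml; exact: quantile_bounds.
  apply: le_trans (step_approx w_ge0 entry_pow h1 h2) _; rewrite lerD2l.
  apply: ler_sum => j _; rewrite ler_wpM2l //.
  case: (leP s 0) => s0.
    by rewrite /quantile s0 subrr normr0.
  case: (leP s 1) => s1; last first.
    by rewrite /quantile (lt_geF s0) (lt_geF s1) subrr normr0.
  rewrite !quantile_gt // -/(a j) -/(b j) indicE.
  case: (boolP (s \in I j)) => sI.
    by do 2![case: (_ < _)]; rewrite /= ?subr0 ?sub0r ?subrr ?normrN ?normr1 ?normr0 ?ler01.
  case: (ltP (a j) s) => sa; case: (ltP (b j) s) => sb; rewrite ?subrr ?normr0 //.
    by move: sI; rewrite notin_setE /I /= in_itv /= gt_min le_max sa sb orbT.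
  by move: sI; rewrite notin_setE /I /= in_itv /= gt_min le_max sa sb orbT.
rewrite ge0_integralD //; last first.
  by move=> s _; rewrite sume_ge0 // => j _; rewrite lee_fin mulr_ge0.
have u1 : unif setT = 1%E := @probability_setT _ _ _ unif.
rewrite integral_cst // [X in (w%:E * X)%E]u1 mule1 ge0_integral_sum; last 3 first.
- exact: measurableT.
- exact: mind.
- by move=> j s _; rewrite lee_fin mulr_ge0.
rewrite EFinD -sumEFin leeD2l //; apply: lee_sum => j _.
under eq_integral do rewrite EFinM.
have mi : measurable_fun setT (fun s : R => (\1_(I j) s : R)%:E).
  by apply/measurable_EFinP; exact: measurable_indic.
have e : (\int[unif]_s (\1_(I j) s : R)%:E = `|a j - b j|%:E)%E.
  have := @integral_indic _ _ R unif setT measurableT (I j) (mI j).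
  move=> ->; rewrite -(step_integral (a01 j) (b01 j)).
  exact: (congr1 (fun S : set R => unif S) (setIT (I j))).
rewrite ge0_integralZl; [|exact: measurableT|exact: mi|by move=> s _; rewrite lee_fin|by []].
have ab : a j - b j = tail nu (node r w j) - tail mu (node r w j) by rewrite /a /b; ring.
by rewrite e ab distrC EFinM.
Qed.

End QuantileCoupling.

(** * Empirical measures of random points *)

Section StepPolynomials.
Variable R : realType.

Lemma clamp_lipschitz (x c a b : R) : 0 <= c ->
  `|Num.min (Num.max (a - x) 0) c - Num.min (Num.max (b - x) 0) c| <= `|a - b|.
Proof.
move=> c0; wlog ab : a b / b <= a.
  move=> H; case: (leP b a) => [|/ltW]; first exact: H.
  by move=> /H; rewrite distrC [X in _ <= X -> _]distrC.
rewrite (@ger0_norm _ (a - b)) ?subr_ge0 // ler_norml.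
case: (leP (a - x) 0) => ?; case: (leP (b - x) 0) => ?;
  [case: (leP 0 c) => ?|case: (leP 0 c) => ?; case: (leP (b - x) c) => ?
  |case: (leP (a - x) c) => ?; case: (leP 0 c) => ?
  |case: (leP (a - x) c) => ?; case: (leP (b - x) c) => ?]; apply/andP; split; lra.
Qed.

Lemma cvg_sumr (I : Type) (s : seq I) (u : I -> nat -> R) (l : I -> R) :
  (forall i, u i k @[k --> \oo] --> l i) ->
  \sum_(i <- s) u i k @[k --> \oo] --> \sum_(i <- s) l i.
Proof.
move=> h; elim: s => [|i s IH].
  by rewrite big_nil; under eq_cvg do rewrite big_nil; exact: cvg_cst.
by rewrite big_cons; under eq_cvg do rewrite big_cons; exact: cvgD.
Qed.

(** Measurability is known for polynomial statistics only; indicators of half-lines are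
    pointwise limits of polynomials, through the clamped ramps
    (k + 1) min (max (l - x) 0) (1 / (k + 1)). *)
Lemma step_polynomials (r x : R) : 0 < r -> exists q : nat -> {poly R},
  forall l, `|l| <= r -> (q k).[l] @[k --> \oo] --> ((x < l)%R%:R : R).
Proof.
move=> r0; pose c (k : nat) : R := k.+1%:R^-1.
have c0 k : 0 < c k by rewrite invr_gt0 ltr0n.
have /choice[p hp] k : exists p : {poly R}, forall l, `|l| <= r ->
    `|p.[l] - Num.min (Num.max (l - x) 0) (c k)| <= c k ^+ 2.
  have [p [hp _]] := @lipschitz_polynomial R r (c k ^+ 2)
    (fun l => Num.min (Num.max (l - x) 0) (c k)) r0 (exprn_gt0 2 (c0 k))
    (fun a b => @clamp_lipschitz x (c k) a b (ltW (c0 k))).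
  by exists p.
exists (fun k => k.+1%:R *: p k) => l lr; apply/cvgrPdist_le => e e0.
have near_c d : 0 < d -> \forall k \near \oo, c k < d.
  by move=> d0; exact: (near_infty_natSinv_lt (PosNum d0)).
have ck k : k.+1%:R * c k = 1 by rewrite /c mulfV // pnatr_eq0.
have close k : `|k.+1%:R * Num.min (Num.max (l - x) 0) (c k) - (k.+1%:R *: p k).[l]| <= c k.
  rewrite hornerZ -mulrBr normrM ger0_norm // distrC.
  apply: (@le_trans _ _ (k.+1%:R * c k ^+ 2)); first by rewrite ler_wpM2l // hp.
  by rewrite expr2 mulrA ck mul1r.
case: (ltP x l) => xl /=.
  have lx : 0 < l - x by rewrite subr_gt0.
  near=> k.
  have h1 : c k < e by near: k; exact: near_c.
  have h2 : c k < l - x by near: k; exact: near_c.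
  apply: le_trans (ltW h1); apply: le_trans (close k).
  have -> : Num.min (Num.max (l - x) 0) (c k) = c k.
    by rewrite max_l ?(ltW lx) // min_r // ltW.
  by rewrite ck.
near=> k.
have h1 : c k < e by near: k; exact: near_c.
apply: le_trans (ltW h1); apply: le_trans (close k).
have -> : Num.min (Num.max (l - x) 0) (c k) = 0.
  by rewrite max_r ?subr_le0 // min_l // ltW.
by rewrite mulr0.
Unshelve. all: by end_near.
Qed.

End StepPolynomials.

Section EmpiricalMeasure.
Context d (T : measurableType d) (R : realType) (P : probability T R) (n : nat).
Variables (ei : T -> 'I_n -> R) (r : R).
Hypotheses (n_gt0 : (0 < n)%N) (r_gt0 : 0 < r) (bnd : forall t i, `|ei t i| <= r).
Hypothesis mpolyn : forall p : {poly R},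
  measurable_fun setT (fun t => \sum_i p.[ei t i]).

Definition empirical t (S : set R) : \bar R :=
  ((n%:R^-1)%:E * \sum_(i < n) \d_(ei t i) S)%E.

Definition empirical_mean (S : set R) : \bar R := (\int[P]_t empirical t S)%E.

Let i0 : 'I_n := Ordinal n_gt0.
Let invn_ge0 : 0 <= (n%:R^-1 : R). Proof. by rewrite invr_ge0 ler0n. Qed.
Let n_neq0 : (n%:R : R) != 0. Proof. by rewrite pnatr_eq0 -lt0n. Qed.

Definition empirical_count t (S : set R) : R := n%:R^-1 * \sum_(i < n) \1_S (ei t i).

Lemma empiricalE t S : empirical t S = (empirical_count t S)%:E.
Proof. by rewrite /empirical /empirical_count EFinM -sumEFin. Qed.

Lemma empirical_prob t : exists mu : probability R R, forall S, mu S = empirical t S.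
Proof.
pose m := mscale (NngNum invn_ge0)
  (msum (fun k => dirac (ei t (insubd i0 k)) : {measure set R -> \bar R}) n).
have mE S : m S = empirical t S.
  rewrite /m /mscale /msum /empirical /=; congr (_ * _)%E.
  by apply: eq_bigr => k _; rewrite valKd.
have m1 : m setT = 1%E.
  rewrite mE empiricalE /empirical_count; congr (_%:E).
  under eq_bigr do rewrite indicT.
  by rewrite sumr_const card_ord mulVf.
pose M := Measure_isProbability.Build _ _ R m m1.
pose mu : probability R R := HB.pack m M.
by exists mu.
Qed.

Lemma empirical_bigcup t (F : nat -> set R) : (forall k, measurable (F k)) ->
  trivIset setT F -> empirical t (\bigcup_k F k) = (\sum_(k <oo) empirical t (F k))%E.
Proof.
move=> mF tF; have [mu hmu] := empirical_prob t; rewrite -hmu; symmetry.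
under eq_eseriesr do rewrite -hmu.
by apply/cvg_lim => //; apply: measure_sigma_additive.
Qed.

Lemma empirical_tail_measurable x : measurable_fun setT (fun t => empirical t `]x, +oo[).
Proof.
have [q hq] := step_polynomials x r_gt0.
apply: (@emeasurable_fun_cvg _ _ _ _ (fun k t => (n%:R^-1 * \sum_i (q k).[ei t i])%:E)).
  move=> k; apply/measurable_EFinP; apply: measurable_funM => //.
move=> t _; rewrite empiricalE; apply: cvg_EFin; first by apply: nearW.
have h i : (q k).[ei t i] @[k --> \oo] --> (\1_(`]x, +oo[%classic : set R) (ei t i) : R).
  rewrite indicE (_ : (ei t i \in `]x, +oo[%classic) = (x < ei t i)).
    exact: hq.
  by rewrite mem_setE in_itv /= andbT.
have hs := @cvg_sumr R 'I_n (index_enum 'I_n) (fun i k => (q k).[ei t i]) _ h.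
exact: (@cvgM _ _ _ _ (fun=> n%:R^-1) _ _ _ (@cvg_cst _ _ _ _ _) hs).
Qed.

(** Extends from half-lines to Borel sets by a pi-lambda argument. This is what makes the
    mean of the random measure countably additive. *)
Lemma empirical_measurable S : measurable S -> measurable_fun setT (fun t => empirical t S).
Proof.
move=> mS; have gS : <<s (@RGenOInfty.G R) >> S.
  by rewrite -[X in X S]/((RGenOInfty.G (R:=R)).-sigma.-measurable%classic) -RGenOInfty.measurableE.
move: S gS {mS}; apply: (@dynkin_induction _ _ (@RGenOInfty.G R)
  (fun S => measurable_fun setT (fun t => empirical t S))).
- exact: RGenOInfty.measurableE.
- move=> _ _ [x ->] [y ->]; exists (Num.max x y).
  by apply/seteqP; split => z /=; rewrite !in_itv /= !andbT gt_max => /andP.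
- rewrite /= (_ : (fun t => _) = cst 1%E); first exact: measurable_cst.
  by apply/funext => t; have [mu <-] := empirical_prob t; rewrite probability_setT.
- by move=> _ [x ->]; exact: empirical_tail_measurable.
- move=> S mS /= hS; rewrite (_ : (fun t => _) = (fun t => 1 - empirical t S)%E).
    by apply: emeasurable_funB.
  by apply/funext => t; have [mu hmu] := empirical_prob t; rewrite -!hmu probability_setC.
- move=> F mF tF /= hF; rewrite (_ : (fun t => _) = (fun t => \sum_(k <oo) empirical t (F k))%E).
    apply: ge0_emeasurable_sum => // k t _ _.
    by have [mu <-] := empirical_prob t.
  by apply/funext => t; exact: empirical_bigcup.
Qed.

Lemma empirical_ge0 t S : (0 <= empirical t S)%E.
Proof. by have [mu <-] := empirical_prob t. Qed.

Lemma empirical_mean_prob : exists nu : probability R R, forall S, nu S = empirical_mean S.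
Proof.
have m0 : empirical_mean set0 = 0%E.
  rewrite /empirical_mean (eq_integral (cst 0%E)) ?integral0 // => t _.
  by have [mu <-] := empirical_prob t; rewrite measure0.
have mge0 S : (0 <= empirical_mean S)%E by apply: integral_ge0 => t _; exact: empirical_ge0.
have madd : semi_sigma_additive empirical_mean.
  move=> F mF tF mUF; rewrite /empirical_mean; apply: cvg_toP.
    by apply: is_cvg_nneseries => k _ _; exact: mge0.
  transitivity (\sum_(k <oo) \int[P]_t empirical t (F k))%E; first by [].
  rewrite -integral_nneseries //; last by move=> k t _; exact: empirical_ge0.
    by apply: eq_integral => t _; rewrite empirical_bigcup.
  by move=> k; exact: empirical_measurable.
pose M1 := isMeasure.Build _ R R empirical_mean m0 mge0 madd.
pose m : {measure set R -> \bar R} := HB.pack empirical_mean M1.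
have m1 : m setT = 1%E.
  rewrite /m /= /empirical_mean (eq_integral (cst 1%E)); last first.
    by move=> t _; have [mu <-] := empirical_prob t; rewrite probability_setT.
  by rewrite integral_cst // mul1e; exact: probability_setT.
pose M2 := Measure_isProbability.Build _ _ R m m1.
pose nu : probability R R := HB.pack empirical_mean M1 M2.
by exists nu.
Qed.

End EmpiricalMeasure.

(** * Distance from an empirical measure to its mean *)

Section EmpiricalDistance.
Context d (T : measurableType d) (R : realType) (P : probability T R) (n : nat).
Variables (ei : T -> 'I_n -> R) (r : R).
Hypotheses (n_gt0 : (0 < n)%N) (r_gt0 : 0 < r) (bnd : forall t i, `|ei t i| <= r).
Hypothesis mpolyn : forall p : {poly R},
  measurable_fun setT (fun t => \sum_i p.[ei t i]).

Let invn_ge0 : 0 <= (n%:R^-1 : R). Proof. by rewrite invr_ge0 ler0n. Qed.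
Let n_neq0 : (n%:R : R) != 0. Proof. by rewrite pnatr_eq0 -lt0n. Qed.

Definition avg (f : R -> R) t : R := n%:R^-1 * \sum_(i < n) f (ei t i).

Lemma avg_le f g t : (forall x, `|x| <= r -> f x <= g x) -> avg f t <= avg g t.
Proof. by move=> h; rewrite ler_wpM2l //; apply: ler_sum => i _; exact: h. Qed.

Lemma avgD f g t : avg (fun x => f x + g x) t = avg f t + avg g t.
Proof. by rewrite /avg big_split mulrDr. Qed.

Lemma avg_cst c t : avg (fun=> c) t = c.
Proof. by rewrite /avg sumr_const card_ord -[c *+ n]mulr_natl mulrA mulVf ?mul1r. Qed.

Lemma avg_norm f B t : (forall x, `|x| <= r -> `|f x| <= B) -> `|avg f t| <= B.
Proof.
move=> fB; rewrite ler_norml; apply/andP; split.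
  by rewrite -(avg_cst (- B) t); apply: avg_le => y /fB; rewrite ler_norml => /andP[].
by rewrite -[leRHS](avg_cst B t); apply: avg_le => y /fB; rewrite ler_norml => /andP[].
Qed.

Lemma avgZ c f t : avg (fun x => c * f x) t = c * avg f t.
Proof. by rewrite /avg -mulr_sumr mulrCA. Qed.

Lemma avg_sum (I : Type) (s : seq I) (f : I -> R -> R) t :
  avg (fun x => \sum_(j <- s) f j x) t = \sum_(j <- s) avg (f j) t.
Proof. by rewrite /avg exchange_big mulr_sumr. Qed.

Definition integrable_avg (f : R -> R) := P.-integrable setT (EFin \o avg f).

Lemma avg_integrable f B : measurable_fun setT (avg f) ->
  (forall x, `|x| <= r -> `|f x| <= B) -> integrable_avg f.
Proof.
by move=> mf fB; apply: (@bounded_integrable _ _ _ P _ B) => [|t]; [exact: mf|exact: avg_norm].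
Qed.

Lemma poly_bounded (p : {poly R}) : exists B, forall x, `|x| <= r -> `|p.[x]| <= B.
Proof.
exists (\sum_(i < size p) `|p`_i| * r ^+ i) => x xr.
rewrite horner_coef (le_trans (ler_norm_sum _ _ _)) //; apply: ler_sum => i _.
by rewrite normrM normrX ler_wpM2l // lerXn2r ?nnegrE ?normr_ge0 // ltW.
Qed.

Lemma integrable_avg_poly (p : {poly R}) : integrable_avg (horner p).
Proof.
have [B hB] := poly_bounded p; apply: (avg_integrable (B := B)) hB.
exact: measurable_funM.
Qed.

(** Measurability comes from uniform polynomial approximation. *)
Lemma integrable_avg_lipschitz f : (forall x y, `|f x - f y| <= `|x - y|) -> integrable_avg f.
Proof.
move=> hf; apply: (avg_integrable (B := `|f 0| + r)); last first.
  move=> x xr; have := hf x 0; rewrite subr0 => h.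
  have -> : f x = (f x - f 0) + f 0 by rewrite subrK.
  by rewrite (le_trans (ler_normD _ _)) // addrC lerD2l (le_trans h).
have /choice[p hp] k : exists p : {poly R}, forall l, `|l| <= r -> `|p.[l] - f l| <= k.+1%:R^-1.
  have k0 : 0 < (k.+1%:R^-1 : R) by rewrite invr_gt0 ltr0n.
  by have [p [hp _]] := lipschitz_polynomial r_gt0 k0 hf; exists p.
apply: (@measurable_fun_cvg _ _ _ _ (fun k => avg (horner (p k)))).
  by move=> k; exact: measurable_funM.
move=> t _; apply/cvgrPdist_le => e e0; near=> k.
have ke : k.+1%:R^-1 < e by near: k; exact: (near_infty_natSinv_lt (PosNum e0)).
rewrite (_ : avg f t - _ = avg (fun x => f x - (p k).[x]) t); last first.
  by rewrite /avg sumrB mulrBr.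
by apply: avg_norm => x /(hp k) h; rewrite distrC (le_trans h) // ltW.
Unshelve. all: by end_near.
Qed.

Definition mean f : R := \int[P]_t avg f t.

Lemma mean_le f g : integrable_avg f -> integrable_avg g ->
  (forall x, `|x| <= r -> f x <= g x) -> mean f <= mean g.
Proof. by move=> gf gg h; apply: le_Rintegral => // t _; exact: avg_le. Qed.

Lemma meanD f g : integrable_avg f -> integrable_avg g ->
  mean (fun x => f x + g x) = mean f + mean g.
Proof.
move=> gf gg; rewrite -(RintegralD measurableT gf gg).
by apply: eq_Rintegral => t _; rewrite avgD.
Qed.

Lemma meanZ c f : integrable_avg f -> mean (fun x => c * f x) = c * mean f.
Proof.
move=> gf; rewrite -(RintegralZl c measurableT gf).
by apply: eq_Rintegral => t _; rewrite avgZ.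
Qed.

Lemma mean_cst c : mean (fun=> c) = c.
Proof.
have e := Rintegral_cst P measurableT c.
have P1 : fine (P setT) = 1 by rewrite (@probability_setT _ _ _ P).
rewrite P1 mulr1 in e.
by rewrite -[RHS]e; apply: eq_Rintegral => t _; rewrite avg_cst.
Qed.

Lemma integrable_avg_sum (I : Type) (s : seq I) (f : I -> R -> R) (c : I -> R) :
  (forall j, integrable_avg (f j)) -> integrable_avg (fun x => \sum_(j <- s) c j * f j x) /\
  mean (fun x => \sum_(j <- s) c j * f j x) = \sum_(j <- s) c j * mean (f j).
Proof.
move=> gf.
have gZ j : integrable_avg (fun x => c j * f j x).
  rewrite /integrable_avg (_ : avg _ = (fun t => c j * avg (f j) t)); last first.
    by apply/funext => t; rewrite avgZ.
  by have := integrableZl measurableT (c j) (gf j); apply: eq_integrable.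
elim: s => [|j s [IH1 IH2]].
  have e : (fun x : R => \sum_(j <- [::]) c j * f j x) = (fun=> 0).
    by apply/funext => x; rewrite big_nil.
  rewrite e big_nil mean_cst; split => //.
  apply: (@integrable_avg_lipschitz (fun=> 0)) => x y; by rewrite subrr normr0.
have e : (fun x : R => \sum_(j <- (j :: s)) c j * f j x) =
    (fun x => c j * f j x + \sum_(j <- s) c j * f j x).
  by apply/funext => x; rewrite big_cons.
rewrite e big_cons meanD // IH2 meanZ //; split => //.
rewrite /integrable_avg (_ : avg _ = (fun t => avg (fun x => c j * f j x) t +
    avg (fun x => \sum_(j <- s) c j * f j x) t)); last first.
  by apply/funext => t; rewrite avgD.
by have := integrableD measurableT (gZ j) IH1; apply: eq_integrable.
Qed.

Let step (x y : R) : R := (x < y)%R%:R.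

Lemma empirical_tailE t x : empirical ei t `]x, +oo[ = (avg (step x) t)%:E.
Proof.
rewrite empiricalE; congr (_%:E); rewrite /avg /empirical_count; congr (_ * _).
by apply: eq_bigr => i _; rewrite indicE mem_setE in_itv /= andbT.
Qed.

Lemma integrable_avg_step x : integrable_avg (step x).
Proof.
apply: (avg_integrable (B := 1)) => [|y _]; last first.
  by rewrite /step; case: (_ < _); rewrite ?normr1 ?normr0.
apply/measurable_EFinP; rewrite (_ : _ \o _ = (fun t => empirical ei t `]x, +oo[)).
  exact: empirical_tail_measurable r_gt0 bnd mpolyn x.
by apply/funext => t; rewrite empirical_tailE.
Qed.

Lemma empirical_mean_tailE x : empirical_mean P ei `]x, +oo[ = (mean (step x))%:E.
Proof.
rewrite /empirical_mean (eq_integral (EFin \o avg (step x))); last first.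
  by move=> t _; rewrite empirical_tailE.
by rewrite /mean /Rintegral fineK //; apply: integrable_fin_num => //; exact: integrable_avg_step.
Qed.

(** The sum over cells of |avg ramp - mean ramp| equals avg f - mean f for f the sum of the
    ramps with the appropriate signs. These signs depend on t, hence the requirement on
    all sign patterns a; f is 1-Lipschitz and may be replaced by the polynomial p a at
    the cost of 2 e. *)
Theorem empirical_wasserstein (w e s : R) (m : nat) (p : {ffun 'I_m -> bool} -> {poly R}) t :
  0 <= w -> m%:R * w = 2 * r ->
  (forall a x, `|x| <= r -> `|(p a).[x] - \sum_(j < m) (-1) ^+ (a j) * ramp r w j x| <= e) ->
  (forall a, avg (horner (p a)) t - mean (horner (p a)) <= s) ->
  (wasserstein1 (empirical ei t) (empirical_mean P ei) <= (3 * w + s + 2 * e)%:E)%E.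
Proof.
move=> w0 entry_pow hp hs.
have [mu hmu] := empirical_prob ei n_gt0 t.
have [nu hnu] := empirical_mean_prob P n_gt0 r_gt0 bnd mpolyn.
have tmu x : tail mu x = avg (step x) t by rewrite /tail hmu empirical_tailE.
have tnu x : tail nu x = mean (step x) by rewrite /tail hnu empirical_mean_tailE.
have slo x y : x < - r -> `|y| <= r -> step x y = 1.
  by move=> xr; rewrite ler_norml => /andP[ry _]; rewrite /step (lt_le_trans xr ry).
have shi y : `|y| <= r -> step r y = 0.
  by rewrite ler_norml => /andP[_ ry]; rewrite /step ltNge ry.
have avg_eq f c : (forall y, `|y| <= r -> f y = c) -> avg f t = c.
  move=> fc; rewrite -[RHS](avg_cst c t); apply/eqP; rewrite eq_le.
  by apply/andP; split; apply: avg_le => y /fc ->.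
have gcst c : integrable_avg (fun=> c).
  rewrite /integrable_avg (_ : avg _ = cst c); last by apply/funext => u; rewrite avg_cst.
  by apply: finite_measure_integrable_cst.
have mean_eq f c : integrable_avg f -> (forall y, `|y| <= r -> f y = c) -> mean f = c.
  move=> gf fc; rewrite -[RHS](mean_cst c); apply/eqP; rewrite eq_le.
  by apply/andP; split; apply: mean_le => // y /fc ->.
have mulo x : x < - r -> tail mu x = 1 by move=> xr; rewrite tmu; apply: avg_eq => y; exact: slo.
have muhi : tail mu r = 0 by rewrite tmu; exact: avg_eq.
have nulo x : x < - r -> tail nu x = 1.
  by move=> xr; rewrite tnu; apply: (mean_eq _ _ (integrable_avg_step x)) => y; exact: slo.
have nuhi : tail nu r = 0 by rewrite tnu; exact: mean_eq (integrable_avg_step r) _.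
apply: le_trans (wasserstein_grid (ltW r_gt0) w0 entry_pow mulo muhi nulo nuhi
  (fun S _ => esym (hmu S)) (fun S _ => esym (hnu S))) _.
rewrite lee_fin.
have ramp_lip j x y : `|ramp r w j x - ramp r w j y| <= `|x - y|.
  wlog xy : x y / y <= x.
    move=> H; case: (leP y x) => [|/ltW]; first exact: H.
    by move=> /H; rewrite distrC [X in _ <= X -> _]distrC.
  rewrite ger0_norm ?subr_ge0 ?ramp_mono // ger0_norm ?subr_ge0 // /ramp nodeS.
  case: (leP (x - node r w j) 0) => ?; case: (leP (x - (node r w j + w)) 0) => ?;
  case: (leP (y - node r w j) 0) => ?; case: (leP (y - (node r w j + w)) 0) => ?; lra.
have gr j : integrable_avg (ramp r w j) by exact: integrable_avg_lipschitz.
have gw x : integrable_avg (fun y => w * step x y) /\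
    mean (fun y => w * step x y) = w * mean (step x).
  have := @integrable_avg_sum 'I_1 (index_enum _) (fun=> step x) (fun=> w)
    (fun=> integrable_avg_step x).
  by rewrite (_ : (fun y => \sum_(j <- _) _) = (fun y => w * step x y)) ?big_ord1 //;
    apply/funext => y; rewrite big_ord1.
have b1 j : w * tail mu (node r w j.+1) <= avg (ramp r w j) t <= w * tail mu (node r w j).
  rewrite !tmu -!avgZ; apply/andP; split; apply: avg_le => y _; [exact: ramp_ge|exact: ramp_le].
have b2 j : w * tail nu (node r w j.+1) <= mean (ramp r w j) <= w * tail nu (node r w j).
  rewrite !tnu; have [g1 <-] := gw (node r w j.+1); have [g2 <-] := gw (node r w j).
  by apply/andP; split; apply: mean_le => // y _; [exact: ramp_ge|exact: ramp_le].
have := grid_compare m w0 b1 b2 (fun j => tail01 mu _) (fun j => tail01 nu _).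
pose a := [ffun j : 'I_m => avg (ramp r w j) t < mean (ramp r w j)].
have -> : \sum_(j < m) `|avg (ramp r w j) t - mean (ramp r w j)| =
   avg (fun x => \sum_(j < m) (-1) ^+ (a j) * ramp r w j x) t -
   mean (fun x => \sum_(j < m) (-1) ^+ (a j) * ramp r w j x).
  have [_ ->] := integrable_avg_sum (index_enum 'I_m) (fun j => (-1) ^+ (a j))
    (fun j : 'I_m => gr j).
  rewrite avg_sum -sumrB; apply: eq_bigr => j _; rewrite avgZ -mulrBr ffunE.
  case: ltP => h; rewrite ?expr1 ?expr0 ?mulN1r ?mul1r.
    by rewrite ltr0_norm ?subr_lt0.
  by rewrite ger0_norm ?subr_ge0.
have [gf _] := integrable_avg_sum (index_enum 'I_m) (fun j => (-1) ^+ (a j)) (fun j : 'I_m => gr j).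
move: gf (hp a) (hs a); set f := fun x => \sum_(j < m) _; move=> gf ha hsa.
have e0 : 0 <= e by apply: le_trans (normr_ge0 _) (ha 0 _); rewrite normr0 ltW.
have c1 : avg f t <= avg (horner (p a)) t + e.
  rewrite -[X in _ + X](avg_cst e t) -avgD; apply: avg_le => x /ha.
  by rewrite distrC => /(le_trans (ler_norm _)); rewrite lerBlDl.
have c2 : mean (horner (p a)) <= mean f + e.
  rewrite -[X in _ + X](mean_cst e) -meanD //; apply: mean_le => [||x /ha].
  - exact: integrable_avg_poly.
  - rewrite /integrable_avg (_ : avg _ = (fun u => avg f u + avg (fun=> e) u)); last first.
      by apply/funext => u; rewrite avgD.
    by have := integrableD measurableT gf (gcst e); apply: eq_integrable.
  by move=> /(le_trans (ler_norm _)); rewrite lerBlDl.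
clear - c1 c2 hsa => h; lra.
Qed.

End EmpiricalDistance.

(** * Deviation probabilities and the almost sure bound *)

Section Deviation.
Context d (T : measurableType d) (R : realType) (P : probability T R).

Lemma measurable_gt (f : T -> R) s : measurable_fun setT f -> measurable [set t | s < f t].
Proof.
move=> mf; have := mf measurableT _ (measurable_itv (Interval (BRight s) (BInfty R false))).
rewrite setTI; congr measurable; apply/seteqP; split => t /=; by rewrite in_itv /= andbT.
Qed.

Lemma even_markov (f : T -> R) (s M : R) k : measurable_fun setT f -> 0 < s ->
  P.-integrable setT (EFin \o (fun t => f t ^+ k.*2)) ->
  \int[P]_t (f t ^+ k.*2) <= M -> (P [set t | (s < f t)%R] <= (M / s ^+ k.*2)%:E)%E.
Proof.
move=> mf s0 intf hM; have mS := measurable_gt s mf.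
have sk : 0 < s ^+ k.*2 by exact: exprn_gt0.
have f0 t : 0 <= f t ^+ k.*2 by rewrite -mul2n exprM exprn_ge0 // sqr_ge0.
have fin : (P [set t | (s < f t)%R] < +oo)%E.
  exact: le_lt_trans (probability_le1 P mS) (ltry 1).
have mp : measurable_fun setT (fun t => (f t ^+ k.*2)%:E).
  by apply/measurable_EFinP; exact: measurable_funX.
have key : ((s ^+ k.*2)%:E * P [set t | (s < f t)%R] <= M%:E)%E.
  rewrite -(integral_cst P mS).
  apply: (@le_trans _ _ (\int[P]_(t in [set t | (s < f t)%R]) (f t ^+ k.*2)%:E)%E).
    apply: ge0_le_integral => //.
    - by move=> t _; rewrite lee_fin ltW.
    - exact: measurable_funTS.
    by move=> t /= st; rewrite lee_fin lerXn2r ?nnegrE // ltW // (lt_trans s0).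
  apply: (@le_trans _ _ (\int[P]_t (f t ^+ k.*2)%:E)%E).
    apply: ge0_subset_integral => //.
    - by move=> t _; rewrite lee_fin.
  rewrite -[leLHS]fineK ?lee_fin //.
  exact: integrable_fin_num.
have pE : P [set t | (s < f t)%R] = (fine (P [set t | (s < f t)%R]))%:E.
  by rewrite fineK // ge0_fin_numE.
move: key; rewrite pE -EFinM !lee_fin => key.
by rewrite ler_pdivlMr // mulrC.
Qed.

Variables (n : nat) (U : {RV P >-> borelmx R n}) (L : R) (A B : 'M[R[i]]_n).
Hypotheses (hA : herm A) (hB : herm B) (sA : spectrum_within L A) (sB : spectrum_within L B).
Hypotheses (L_gt0 : 0 < L) (n_gt0 : (0 < n)%N) (haar : haar_distributed U).

Definition sum_eigs t i : R := eigs (UAU U A t + B) i.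

Lemma sum_eigs_bound t i : `|sum_eigs t i| <= 2 * L.
Proof. exact: (eigs_sum hA hB sA sB i (orb_UAU A haar t)). Qed.

Let hW t : herm (UAU U A t) := orb_herm hA (orb_UAU A haar t).

Lemma sum_eigs_measurable (p : {poly R}) : measurable_fun setT (fun t => \sum_i p.[sum_eigs t i]).
Proof.
have [+ _] := cmeas_ev (trace_poly B (complexify p)) (mmeas_UAU U A).
congr measurable_fun; apply/funext => t.
by rewrite (ev_trace_poly_real hB p (hW t)).
Qed.

Lemma avg_linstat (p : {poly R}) c t :
  avg sum_eigs (horner p) t - c = reval (linstat B p c) (UAU U A t).
Proof. by rewrite (reval_linstat hA hB p c (orb_UAU A haar t)). Qed.

Lemma mean_linstat (p : {poly R}) : mean P sum_eigs (horner p) = haar_mean U A (linstat B p 0).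
Proof. by apply: eq_Rintegral => t _; rewrite -avg_linstat subr0. Qed.

(** Markov inequality for the moment of order 2k of the linear statistic. *)
Lemma deviation_prob (p : {poly R}) (s : R) k : 0 < s ->
  (forall x, `|x| <= 2 * L -> `|p^`().[x]| <= 1) ->
  measurable [set t | s < avg sum_eigs (horner p) t - mean P sum_eigs (horner p)] /\
  (P [set t | (s < avg sum_eigs (horner p) t - mean P sum_eigs (horner p))%R]
   <= ((k.*2%:R * (8 * L ^+ 2 / n%:R ^+ 2) / s ^+ 2) ^+ k)%:E)%E.
Proof.
move=> s0 hp; set q := linstat B p (mean P sum_eigs (horner p)).
have fE t : avg sum_eigs (horner p) t - mean P sum_eigs (horner p) = reval q (UAU U A t).
  exact: avg_linstat.
have mf : measurable_fun setT (fun t => avg sum_eigs (horner p) t - mean P sum_eigs (horner p)).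
  have [+ _] := cmeas_ev q (mmeas_UAU U A).
  by congr measurable_fun; apply/funext => t; rewrite fE.
have pwE t : reval (Pow q k.*2) (UAU U A t) =
    (avg sum_eigs (horner p) t - mean P sum_eigs (horner p)) ^+ k.*2.
  by rewrite (reval_pow _ (real_linstat hB p _) (hW t)) fE.
split; first exact: measurable_gt.
apply: le_trans (even_markov (M := (k.*2%:R * (8 * L ^+ 2 / n%:R ^+ 2)) ^+ k) mf s0 _ _) _.
- have := UAU_integrable A haar (Pow q k.*2); congr (P.-integrable _).
  by apply/funext => t /=; rewrite pwE.
- have := linstat_moment hA hB (ltW L_gt0) sA sB k n_gt0 (haar_state A haar) hp.
  rewrite -mean_linstat -/q; apply: le_trans; rewrite le_eqVlt; apply/orP; left; apply/eqP.
  by apply: eq_Rintegral => t _; rewrite pwE.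
by rewrite lee_fin -mul2n exprM -expr_div_n.
Qed.

End Deviation.

Lemma union_bound d (T : measurableType d) (R : realType) (P : probability T R)
    (I : Type) (s : seq I) (S : I -> set T) (c : R) :
  (forall a, measurable (S a)) -> (forall a, (P (S a) <= c%:E)%E) ->
  measurable (\big[setU/set0]_(a <- s) S a) /\
  (P (\big[setU/set0]_(a <- s) S a) <= ((size s)%:R * c)%:E)%E.
Proof.
move=> mS hS; elim: s => [|a s [IH1 IH2]].
  by rewrite big_nil measure0 mul0r.
rewrite big_cons; split; first exact: measurableU.
apply: le_trans (measureU2 _ _ _) _ => //.
by rewrite /= -natr1 mulrDl mul1r EFinD addrC; exact: leeD.
Qed.

(** m is the integer part of n ^ (2/3) plus one. The last bound makes the exceptional
    probability 8 ^ (- m) summable. *)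
Lemma grid_size (R : realType) (n : nat) : (0 < n)%N ->
  let x : R := n%:R `^ (2 / 3) in
  exists m : nat, (0 < m)%N /\ [/\ 0 < x, x ^+ 3 = n%:R ^+ 2, x <= m%:R,
    m%:R <= 2 * x & n%:R ^+ 2 <= 8 ^+ m :> R].
Proof.
move=> n0 x.
have n1 : (1 : R) <= n%:R by rewrite ler1n.
have x0 : 0 < x by rewrite powR_gt0 // ltr0n.
have x3 : x ^+ 3 = n%:R ^+ 2.
  rewrite -(powR_mulrn 3 (ltW x0)) -powRrM -(powR_mulrn 2 (ler0n R n)).
  by congr (_ `^ _); field.
have x1 : 1 <= x.
  rewrite leNgt; apply/negP => xl.
  have : x ^+ 3 < 1 by rewrite exprn_ilt1 // ltW.
  by rewrite x3 ltNge exprn_ege1.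
have xm : x <= (Num.truncn x).+1%:R by exact: ltW (truncnS_gt x).
exists (Num.truncn x).+1; split => //; split => //.
  have : (Num.truncn x)%:R <= x by have := truncn_le x; rewrite (ltW x0).
  by rewrite -natr1; lra.
set m := (Num.truncn x).+1 in xm *; rewrite -x3.
have -> : (8 : R) ^+ m = (2 ^ m)%:R ^+ 3 by rewrite natrX exprAC; congr (_ ^+ _); ring.
rewrite lerXn2r ?nnegrE ?ler0n // ?(ltW x0) // (le_trans xm) //.
by rewrite ler_nat ltnW // ltn_expl.
Qed.

Lemma error_budget (R : realType) (y w s e : R) : w <= 4 * y -> e <= y -> s <= 32 * y ->
  3 * w + s + 2 * e <= 12 * y + 32 * y + 2 * y.
Proof. lra. Qed.

Section ExceptionalSet.
Context d (T : measurableType d) (R : realType) (P : probability T R).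
Variables (n : nat) (U : {RV P >-> borelmx R n}) (L : R) (A B : 'M[R[i]]_n).
Hypotheses (hA : herm A) (hB : herm B) (sA : spectrum_within L A) (sB : spectrum_within L B).
Hypotheses (L_gt0 : 0 < L) (n_gt0 : (0 < n)%N) (haar : haar_distributed U).

(** With m cells there are 2 ^ m sign patterns. The moment of order 2m with the threshold
    s = 16 L m ^ (1/2) / n gives each pattern a probability at most 16 ^ (- m) of a large
    deviation, hence a total of at most 8 ^ (- m). Off this event the distance is of
    order L / m + L m ^ (1/2) / n, and m = n ^ (2/3) balances the two terms. *)
Theorem exceptional_set : exists Bad : set T, [/\ measurable Bad,
  (P Bad <= (n%:R ^- 2)%:E)%E &
  forall t, ~ Bad t ->
    (wasserstein1 (empirical (sum_eigs U A B) t) (empirical_mean P (sum_eigs U A B)) <=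
    (46 * L * n%:R `^ (- (2 / 3)))%:E)%E].
Proof.
have [m [m0 [x0 x3 xm mx nm]]] := grid_size R n_gt0.
set x : R := _ `^ _ in x0 x3 xm mx.
have n0R : (0 : R) < n%:R by rewrite ltr0n.
have m0R : (0 : R) < m%:R by rewrite ltr0n.
have r0 : 0 < 2 * L by rewrite mulr_gt0.
pose w := 4 * L / m%:R.
have w0 : 0 <= w by rewrite divr_ge0 ?ler0n // mulr_ge0 // ltW.
have entry_pow : m%:R * w = 2 * (2 * L) by rewrite /w; field; exact: lt0r_neq0.
pose e := L / m%:R.
have e0 : 0 < e by rewrite divr_gt0.
pose sg (a : {ffun 'I_m -> bool}) (j : 'I_m) : R := (-1) ^+ (a j).
have sg1 a j : `|sg a j| <= 1 by rewrite /sg normrX normrN1 expr1n.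
have /choice[p hp] (a : {ffun 'I_m -> bool}) : exists p : {poly R},
    (forall y, `|y| <= 2 * L -> `|p.[y] - \sum_(j < m) sg a j * ramp (2 * L) w j y| <= e) /\
    (forall y, `|y| <= 2 * L -> `|p^`().[y]| <= 1).
  apply: lipschitz_polynomial => // y z.
  exact: sign_ramp_lipschitz.
pose s := 16 * L * Num.sqrt m%:R / n%:R.
have s0 : 0 < s by rewrite divr_gt0 // !mulr_gt0 // sqrtr_gt0.
have s2 : s ^+ 2 = 256 * L ^+ 2 * m%:R / n%:R ^+ 2.
  by rewrite /s !exprMn exprVn sqr_sqrtr ?ler0n //; ring.
pose S a := [set t | s < avg (sum_eigs U A B) (horner (p a)) t -
  mean P (sum_eigs U A B) (horner (p a))].
have hS a := deviation_prob hA hB sA sB L_gt0 n_gt0 haar m s0 (hp a).2.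
(* one factor of the moment bound; the threshold s is chosen to make it 1 / 16 *)
have c16 : m.*2%:R * (8 * L ^+ 2 / n%:R ^+ 2) / s ^+ 2 = 16^-1.
  rewrite s2 -mul2n natrM; field.
  by rewrite !lt0r_neq0.
have [mB PB] := @union_bound _ _ _ P _ (enum {ffun 'I_m -> bool}) S ((16^-1) ^+ m)
  (fun a => (hS a).1) (fun a => ltac:(rewrite -c16; exact: (hS a).2)).
exists (\big[setU/set0]_(a <- enum {ffun 'I_m -> bool}) S a); split => //.
  apply: le_trans PB _; rewrite lee_fin.
  have -> : size (enum {ffun 'I_m -> bool}) = (2 ^ m)%N.
    by rewrite -cardE card_ffun card_bool card_ord.
  rewrite natrX -exprMn (_ : 2 * 16^-1 = 8^-1 :> R); last by field.
  by rewrite exprVn lef_pV2 // posrE exprn_gt0.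
move=> t nB.
have hs a : avg (sum_eigs U A B) (horner (p a)) t - mean P (sum_eigs U A B) (horner (p a)) <= s.
  rewrite leNgt; apply/negP => h; apply: nB.
  by rewrite -bigcup_seq; exists a => //=; rewrite mem_enum.
have := empirical_wasserstein n_gt0 r0 (sum_eigs_bound hA hB sA sB haar)
  (sum_eigs_measurable hA hB haar)
  w0 entry_pow (fun a => (hp a).1) hs.
move/le_trans; apply; rewrite lee_fin powRN -/x.
have we : w <= 4 * L / x by rewrite ler_wpM2l ?mulr_ge0 ?(ltW L_gt0) // lef_pV2.
have ee : e <= L / x by rewrite ler_wpM2l ?(ltW L_gt0) // lef_pV2.
have se : s <= 32 * L / x.
  rewrite -(@ler_pXn2r _ 2) // ?nnegrE ?(ltW s0) //; last first.
    by rewrite divr_ge0 ?(ltW x0) // mulr_ge0 // ltW.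
  rewrite s2 -x3 ler_pdivrMr ?exprn_gt0 //.
  have -> : (32 * L / x) ^+ 2 * x ^+ 3 = 256 * L ^+ 2 * (4 * x).
    by field; exact: lt0r_neq0.
  apply: ler_wpM2l; first by apply: mulr_ge0 (ler0n R 256) (sqr_ge0 L).
  apply: le_trans mx _; apply: ler_wpM2r (ltW x0) _ _ _.
  by rewrite ler_nat.
have e46 : 46 * L / x = 12 * (L / x) + 32 * (L / x) + 2 * (L / x) by ring.
rewrite e46; move: we ee se; rewrite -!mulrA => we ee se.
exact: error_budget.
Qed.

End ExceptionalSet.

(** Compare with the telescoping series of 1 / (k (k + 1)); the term k = 0 is 0. *)
Lemma inverse_squares_le2 (R : realType) (N : nat) :
  \sum_(0 <= k < N) (k%:R ^- 2 : R) <= 2.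
Proof.
have inv0 k : 0 <= (k%:R ^- 2 : R) by rewrite invr_ge0 exprn_ge0.
suff h : \sum_(0 <= k < N.+2) (k%:R ^- 2 : R) <= 2 - N.+1%:R^-1.
  apply: (@le_trans _ _ (\sum_(0 <= k < N.+2) (k%:R ^- 2 : R))).
    by rewrite big_nat_recr //= big_nat_recr //= -addrA lerDl addr_ge0.
  by apply: le_trans h _; rewrite gerBl invr_ge0.
elim: N => [|N IH].
  by rewrite !big_nat_recr //= big_geq // expr0n /= invr0 expr1n !invr1; lra.
rewrite big_nat_recr //=; apply: le_trans (lerD IH (lexx _)) _.
have a0 : (0 : R) < N.+1%:R by rewrite ltr0n.
have b0 : (0 : R) < N.+2%:R by rewrite ltr0n.
rewrite -subr_ge0 (_ : _ - _ = (N.+1%:R * N.+2%:R ^+ 2)^-1 :> R).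
  by rewrite invr_ge0 mulr_ge0 ?exprn_ge0 // ltW.
have e : N.+2%:R = N.+1%:R + 1 :> R by rewrite natr1.
move: b0; rewrite e; move: (N.+1%:R) a0 => y y0 y1; field.
by rewrite !lt0r_neq0.
Qed.

Lemma borel_cantelli d (T : measurableType d) (R : realType) (P : probability T R)
    (F : nat -> set T) : (forall k, measurable (F k)) ->
  (forall k, (P (F k) <= (k%:R ^- 2)%:E)%E) ->
  {ae P, forall t, \forall k \near \oo, ~ F k t}.
Proof.
move=> mF hF; exists (lim_sup_set F); split.
- by apply: bigcap_measurable => // k _; apply: bigcup_measurable.
- apply: lim_sup_set_cvg0 => //; apply: (@le_lt_trans _ _ 2%:E); last exact: ltry.
  apply: lime_le; first by apply: is_cvg_nneseries.
  apply: nearW => N; apply: (@le_trans _ _ (\sum_(0 <= k < N) (k%:R ^- 2)%:E)%E).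
    by apply: lee_sum => k _; exact: hF.
  by rewrite sumEFin lee_fin inverse_squares_le2.
move=> t nt k _; apply: contrapT => h; apply: nt; exists k => // j /= kj Fj.
by apply: h; exists j.
Qed.

Theorem corollary3p9 (R : realType) (L : R) (L_gt0 : 0 < L) :
  exists2 C : R, 0 < C &
  forall (d : measure_display) (T : measurableType d) (P : probability T R)
    (A B : forall n : nat, 'M[R[i]]_n)
    (U : forall n : nat, {RV P >-> borelmx R n}),
    (forall n, A n \is hermsymmx) -> (forall n, B n \is hermsymmx) ->
    (forall n, spectrum_within L (A n)) ->
    (forall n, spectrum_within L (B n)) ->
    (forall n, haar_distributed (U n)) ->
    let M n t := randomized_sum (A n) (B n) (U n t) in
    {ae P, forall t, \forall n \near \oo%classic,
      (wasserstein1 (spectral_measure (M n t)) (mean_spectral_measure P (M n))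
        <= (C * n%:R `^ (- (2 / 3)))%:E)%E}.
Proof.
exists (46 * L); first by rewrite mulr_gt0.
move=> d T P A B U hA hB sA sB hU M.
have /choice[Bad hBad] n : exists Bad : set T, [/\ measurable Bad,
    (P Bad <= (n%:R ^- 2)%:E)%E &
    (0 < n)%N -> forall t, ~ Bad t ->
      (wasserstein1 (spectral_measure (M n t)) (mean_spectral_measure P (M n)) <=
       (46 * L * n%:R `^ (- (2 / 3)))%:E)%E].
  case: (posnP n) => [->|n0].
    by exists set0; split => //; rewrite measure0 lee_fin invr_ge0 exprn_ge0.
  have [Bad [mB PB dB]] := exceptional_set (elimT (hermsymmxP _) (hA n))
    (elimT (hermsymmxP _) (hB n)) (sA n) (sB n) L_gt0 n0 (hU n).
  by exists Bad; split => // _ t /dB.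
have := borel_cantelli (fun k => let: And3 h _ _ := hBad k in h)
  (fun k => let: And3 _ h _ := hBad k in h).
apply: filterS => t; apply: filterS2 (nbhs_infty_gt 0) => n n0 nB.
by have [_ _] := hBad n; apply.
Qed.
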